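(* For all types $\sigma,\tau\Vdash n$, the coefficients of $s_{\tau}^{\otimes}$ in the $s^{\otimes}$-expansions of $E_{\sigma}^+$ and $E_{\sigma}$ are, respectively, \[ \mathcal{M}(E^+,s^{\otimes})_{\tau,\sigma}= \sum_{T\in\mathrm{TPRT}'(\tau,\sigma)} \operatorname{sgn}^+(T)\quad\text{and}\quad \mathcal{M}(E,s^{\otimes})_{\tau,\sigma}= \sum_{T\in\mathrm{TPRT}'(\tau,\sigma)} \operatorname{sgn}^-(T). \]
   Context: An integer partition is a finite (possibly empty) weakly decreasing sequence of positive integers; $\ell(\lambda)$ is its number of parts and $m_k(\lambda)$ the number of parts equal to $k$. A block is an ordered pair of positive integers written $d^m$ (degree $d$, multiplicity $m$). Blocks are ordered by $a^b\ge d^e$ iff $a>d$, or $a=d$ and $b\ge e$. A type is a finite (possibly empty) weakly decreasing sequence of blocks $\tau=(d_1^{m_1},\dots,d_s^{m_s})$; its weight is $|\tau|=\sum_id_im_i$, and $\tau\Vdash n$ means $|\tau|=n$. For $k\ge1$, $\tau|_k$ denotes the integer partition formed by the multiplicities of the blocks of $\tau$ of degree $k$; the type $\tau$ is determined by $(\tau|_k)_{k\ge1}$. Variables: $x_{k,j}$ for $k,j\ge 1$, with $\deg x_{k,j}=k$; $\mathbf{x}_{k*}=(x_{k,1},x_{k,2},\dots)$. The graded algebra $\mathsf{P\Lambda}=\bigoplus_n\mathsf{P\Lambda}^n$ of polysymmetric functions consists of the formal series over $\mathbb{Q}$ of bounded degree in all the $x_{k,j}$ that, for each fixed $k$, are unchanged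 by any permutation of the variables $\mathbf{x}_{k*}$. Define $s^{\otimes}_\tau=\prod_{k\ge1}s_{\tau|_k}(\mathbf{x}_{k*})$, where $s_\lambda$ is the Schur symmetric function; $\{s^\otimes_\tau:\tau\Vdash n\}$ is a basis of $\mathsf{P\Lambda}^n$. $E^+_d$ is the sum of all square-free monomials (no variable repeated) of degree $d$ in the variables $x_{k,j}$ (with $\deg x_{k,j}=k$); $E_d$ is the sum of the same monomials, each multiplied by $(-1)^q$ where $q$ is the number of variables in the monomial. $E^+_{d^r}$ and $E_{d^r}$ are obtained from $E^+_d$ and $E_d$ by replacing every variable $x_{k,j}$ by $x_{k,j}^r$. For $\sigma=(d_1^{r_1},\dots,d_s^{r_s})$, $E^+_\sigma=\prod_iE^+_{d_i^{r_i}}$ and $E_\sigma=\prod_iE_{d_i^{r_i}}$. For $F\in\{E^+,E\}$ the transition matrix is defined by $F_\sigma=\sum_{\tau\Vdash n}\mathcal{M}(F,s^\otimes)_{\tau,\sigma}s^\otimes_\tau$ for $\sigma\Vdash n$. The diagram $\mathrm{dg}(\mu)$ is the set of boxes $(i,j)$ (row $i$, column $j$) with $1\le i\le\ell(\mu)$, $1\le j\le\mu_i$ (row $1$ at the top, column $1$ at the left). For $\mathrm{dg}(\mu)\subseteq\mathrm{dg}(\nu)$, $\nu/\mu=\mathrm{dg}(\nu)\setminus\mathrm{dg}(\mu)$. It is an $r$-ribbon if it consists of $r$ boxes that can be labeled $b_1,\dots,b_r$ so that for $1<i\le r$, $b_i$ is one unit left of or one unit below $b_{i-1}$. If a ribbon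 $R$ has boxes in exactly $q$ different rows, $\operatorname{sgn}(R)=(-1)^{q-1}$, and $\mathrm{left}(R)$ is the least index of a column containing a box of $R$. A skew shape $\lambda/\mu$ is a dual $r^n$-polyribbon ($n\ge0$) if there exist partitions $\mu=\gamma_{(0)}\subseteq\gamma_{(1)}\subseteq\cdots\subseteq\gamma_{(n)}=\lambda$ such that $\gamma_{(i)}/\gamma_{(i-1)}$ is an $r$-ribbon for $1\le i\le n$ and $\mathrm{left}(\gamma_{(i)}/\gamma_{(i-1)})\ge\mathrm{left}(\gamma_{(i+1)}/\gamma_{(i)})$ for $1\le i\le n-1$ (such a list is unique if it exists; for $n=0$ the shape is empty). Its sign is $\operatorname{sgn}'_r(\lambda/\mu)=\prod_{i=1}^n\operatorname{sgn}(\gamma_{(i)}/\gamma_{(i-1)})$. For types $\tau,\rho$, $\tau/\rho$ is a dual $d^r$-tensor polyribbon if, for some partition $\lambda$ of $d$ (the associated partition), $(\tau|_k)/(\rho|_k)$ is a dual $r^{m_k(\lambda)}$-polyribbon for all $k\ge1$. Then $\operatorname{sgn}^+_r(\tau/\rho)=\prod_{k\ge1}\operatorname{sgn}'_r((\tau|_k)/(\rho|_k))$ and $\operatorname{sgn}^-_r(\tau/\rho)=(-1)^{\ell(\lambda)}\prod_{k\ge1}\operatorname{sgn}'_r((\tau|_k)/(\rho|_k))$. For $\sigma=(d_1^{r_1},\dots,d_s^{r_s})$, $\mathrm{TPRT}'(\tau,\sigma)$ is the set of dual tensor polyribbon tableaux of shape $\tau$ and content $\sigma$: sequences of types $\varnothing=\tau_{(0)},\tau_{(1)},\dots,\tau_{(s)}=\tau$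 (starting at the empty type) such that, for $1\le i\le s$, $\tau_{(i)}/\tau_{(i-1)}$ is a dual $d_i^{r_i}$-tensor polyribbon. The signs are $\operatorname{sgn}^{\pm}(T)=\prod_{i=1}^s\operatorname{sgn}^{\pm}_{r_i}(\tau_{(i)}/\tau_{(i-1)})$. *)

(* Defs.v *)
From HB Require Import structures.
From mathcomp Require Import all_boot all_order all_algebra finmap.
From mathcomp Require Import boolp classical_sets functions cardinality fsbigop.
From mathcomp Require Import monalg.

Set Implicit Arguments.
Unset Strict Implicit.
Unset Printing Implicit Defensive.

Import GRing.Theory.

Local Open Scope classical_set_scope.
Local Open Scope ring_scope.

Definition is_partition (lam : seq nat) : bool :=
  sorted geq lam && (0%N \notin lam).

(* The block d^m is the pair (d, m). *)
Definition block : Type := (nat * nat)%type.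

Definition block_ge (a b : block) : bool :=
  (b.1 < a.1)%N || ((a.1 == b.1) && (b.2 <= a.2)%N).

Definition is_type (tau : seq block) : bool :=
  sorted block_ge tau && all (fun b => (0 < b.1)%N && (0 < b.2)%N) tau.

Definition weight (tau : seq block) : nat := (\sum_(b <- tau) b.1 * b.2)%N.

Definition types (n : nat) : set (seq block) :=
  [set tau | is_type tau /\ weight tau = n].

Definition restr (tau : seq block) (k : nat) : seq nat :=
  [seq b.2 | b <- tau & b.1 == k].

(* Both indices are shifted by one: the pair (a, b) is the variable
   x_{a+1,b+1}, so that nat * nat indexes exactly the x_{k,j} with k, j >= 1. *)
Definition var : Type := (nat * nat)%type.

Definition monomial : Type := {cmonom var}.

Definition degree (m : monomial) : nat :=
  (\sum_(v <- finsupp m) v.1.+1 * m v)%N.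

Definition squarefree (m : monomial) : bool :=
  all (fun v => (m v <= 1)%N) (finsupp m).

(* A formal series is the function giving its coefficients.  The sums
   \sum_(_ \in _) below have finite index sets whenever blocks are positive, so
   that the convention giving 0 to sums of infinite support plays no role. *)
Definition series : Type := monomial -> rat.

Definition sone : series := fun m => if m == mone then 1 else 0.

Definition smul (f g : series) : series := fun m =>
  \sum_(p \in [set p : monomial * monomial | mmul p.1 p.2 = m]) f p.1 * g p.2.

(* Substitution of x_{k,j}^r for every x_{k,j}, meant for r > 0. *)
Definition powvars (r : nat) (f : series) : series := fun m =>
  \sum_(a \in [set a : monomial | expcmn a r = m]) f a.

(* A tableau is the list of its rows; its entries are the second indices of
   variables, hence start from 0. *)
Definition ssyt (lam : seq nat) (T : seq (seq nat)) : Prop :=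
  [/\ map size T = lam,
      forall row, row \in T -> sorted leq row
    & forall i j, (i.+1 < size T)%N -> (j < size (nth [::] T i.+1))%N ->
        (nth 0%N (nth [::] T i) j < nth 0%N (nth [::] T i.+1) j)%N].

Definition tab_monomial (k : nat) (T : seq (seq nat)) : monomial :=
  \big[mmul/mone]_(j <- flatten T) ucm ((k.-1, j) : var).

(* s_lam(x_{k,1}, x_{k,2}, ...), for k >= 1: the sum of the monomials of all
   the semistandard tableaux of shape lam. *)
Definition schur (k : nat) (lam : seq nat) : series := fun m =>
  \sum_(T \in [set T | ssyt lam T /\ tab_monomial k T = m]) (1 : rat).

(* The factors with k > |tau| are s_{()} = 1. *)
Definition stensor (tau : seq block) : series :=
  \big[smul/sone]_(1 <= k < (weight tau).+1) schur k (restr tau k).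

Definition Eplus_deg (d : nat) : series := fun m =>
  if squarefree m && (degree m == d) then 1 else 0.

Definition E_deg (d : nat) : series := fun m =>
  if squarefree m && (degree m == d) then (-1) ^+ #|` finsupp m| else 0.

Definition Eplus (sigma : seq block) : series :=
  \big[smul/sone]_(b <- sigma) powvars b.2 (Eplus_deg b.1).

Definition E (sigma : seq block) : series :=
  \big[smul/sone]_(b <- sigma) powvars b.2 (E_deg b.1).

Definition is_transition (n : nat) (F G : seq block -> series)
    (M : seq block -> seq block -> rat) : Prop :=
  forall sigma, types n sigma -> forall m,
    F sigma m = \sum_(tau \in types n) M tau sigma * G tau m.

(* The default value 0 is only returned when the F sigma do not expand
   linearly in the G tau. *)
Definition transition (n : nat) (F G : seq block -> series) :
    seq block -> seq block -> rat :=
  xget (fun _ _ => 0) [set M | is_transition n F G M].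

(* Rows and columns are numbered from 0. *)
Definition box : Type := (nat * nat)%type.

Definition dg (mu : seq nat) : seq box :=
  [seq (i, j) | i <- iota 0 (size mu), j <- iota 0 (nth 0%N mu i)].

Definition skew (nu mu : seq nat) : seq box :=
  [seq b <- dg nu | b \notin dg mu].

(* b' is one unit left of, or one unit below, b. *)
Definition ribbon_step (b b' : box) : bool :=
  (b == (b'.1, b'.2.+1)) || (b' == (b.1.+1, b.2)).

Definition is_ribbon (r : nat) (nu mu : seq nat) : Prop :=
  {subset dg mu <= dg nu} /\
  exists bs : seq box,
    [/\ perm_eq bs (skew nu mu), size bs = r & sorted ribbon_step bs].

Definition sgn_ribbon (nu mu : seq nat) : rat :=
  (-1) ^+ (size (undup [seq b.1 | b <- skew nu mu])).-1.

Definition left_col (nu mu : seq nat) : nat :=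
  head 0%N (sort leq [seq b.2 | b <- skew nu mu]).

(* The list g = (gamma_(0), ..., gamma_(n)) witnesses that lam/mu is a dual
   r^n-polyribbon, where n = size g - 1. *)
Definition polyribbon_chain (r : nat) (lam mu : seq nat)
    (g : seq (seq nat)) : Prop :=
  let gam i := nth [::] g i in
  [/\ (0 < size g)%N,
      all is_partition g,
      gam 0%N = mu /\ gam (size g).-1 = lam,
      forall i, (i.+1 < size g)%N -> is_ribbon r (gam i.+1) (gam i)
    & forall i, (i.+2 < size g)%N ->
        (left_col (gam i.+2) (gam i.+1) <= left_col (gam i.+1) (gam i))%N].

Definition is_dual_polyribbon (r n : nat) (lam mu : seq nat) : Prop :=
  exists g, polyribbon_chain r lam mu g /\ size g = n.+1.

(* The chain is unique when it exists and r > 0. *)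
Definition sgn' (r : nat) (lam mu : seq nat) : rat :=
  let g := xget [::] [set g | polyribbon_chain r lam mu g] in
  \prod_(i < (size g).-1) sgn_ribbon (nth [::] g i.+1) (nth [::] g i).

Definition associated_partition (d r : nat) (tau rho : seq block)
    (lam : seq nat) : Prop :=
  [/\ is_partition lam, sumn lam = d
    & forall k, (0 < k)%N ->
        is_dual_polyribbon r (count_mem k lam) (restr tau k) (restr rho k)].

Definition is_tensor_polyribbon (d r : nat) (tau rho : seq block) : Prop :=
  exists lam, associated_partition d r tau rho lam.

(* The factors with k > |tau| are the signs of empty shapes. *)
Definition sgn_plus (r : nat) (tau rho : seq block) : rat :=
  \prod_(1 <= k < (weight tau).+1) sgn' r (restr tau k) (restr rho k).

(* The associated partition is unique when it exists and r > 0. *)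
Definition sgn_minus (d r : nat) (tau rho : seq block) : rat :=
  (-1) ^+ size (xget [::] [set lam | associated_partition d r tau rho lam])
  * \prod_(1 <= k < (weight tau).+1) sgn' r (restr tau k) (restr rho k).

Definition TPRT' (tau sigma : seq block) : set (seq (seq block)) :=
  [set T | [/\ size T = (size sigma).+1,
      all is_type T,
      nth [::] T 0 = [::] /\ nth [::] T (size sigma) = tau
    & forall i, (i < size sigma)%N ->
        is_tensor_polyribbon (nth (0, 0)%N sigma i).1 (nth (0, 0)%N sigma i).2
          (nth [::] T i.+1) (nth [::] T i)]].

Definition sgnT_plus (sigma : seq block) (T : seq (seq block)) : rat :=
  \prod_(i < size sigma)
    sgn_plus (nth (0, 0)%N sigma i).2 (nth [::] T i.+1) (nth [::] T i).

Definition sgnT_minus (sigma : seq block) (T : seq (seq block)) : rat :=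
  \prod_(i < size sigma)
    sgn_minus (nth (0, 0)%N sigma i).1 (nth (0, 0)%N sigma i).2
      (nth [::] T i.+1) (nth [::] T i).

(* Main.v *)
(** Everything reduces to the rule
      s_mu(x) e_c(x^r) = sum over lambda of sgn'_r(lambda/mu) s_lambda(x),
    the sum being over the lambda such that lambda/mu is a dual
    r^c-polyribbon.  In N variables, multiply by the Vandermonde determinant:
    s_mu becomes the alternant of exponent vector mu + delta, and multiplying it
    by e_c(x^r) adds r to c of the exponents in all possible ways.  Adding r to
    the exponent of row i and sorting the result adds an r-ribbon with lowest
    row i, with its sign, unless two exponents coincide and the alternant
    vanishes.  Doing this for the chosen rows from top to bottom yields exactly
    the chains with weakly decreasing left columns.  The expansion of
    E_(d^r) as a sum over partitions of d of products over k of
    e_(m_k)(x_k*^r) then gives one step of a tableau, and the s^otimes_tau are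
    linearly independent because Kostka numbers are unitriangular. *)
From HB Require Import structures.
From mathcomp Require Import all_boot all_order all_algebra finmap.
From mathcomp Require Import boolp classical_sets cardinality fsbigop.
From mathcomp Require Import monalg perm zify.
Require Import Defs.

Set Implicit Arguments.
Unset Strict Implicit.
Unset Printing Implicit Defensive.

Import GRing.Theory.

Local Open Scope classical_set_scope.
Local Open Scope ring_scope.

(** * Alternants *)

(** The Vandermonde argument needs finitely many variables and a cancellable factor, whereas the
    objects are series in infinitely many variables. Both obstacles shape the development: the
    coefficient of a fixed monomial is compared after discarding the variables of second index at
    least N, with N chosen once the monomial is known, and the series form a commutative ring in
    which the difference of two distinct variables of the same degree is a non-zero-divisor. Since
    Schur functions are given by tableaux, the bialternant formula passes through a third form, the
    recursion that removes the last variable; alternants and tableaux both satisfy it, with the same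
    interlacing shapes. Shapes are functions of the row index, zero beyond the last row, and the
    staircase is kept outside of them, so a chain of ribbons is encoded by a strictly increasing
    list of rows. For a given initial shape and r > 0 the final shape determines this list, which
    settles the uniqueness behind [sgn']. Both signs are treated at once through a rational [s],
    specialised to 1 or -1 at the end. *)

Definition alternant (R : comNzRingType) (x : nat -> R) (N : nat)
    (f : nat -> nat) : R :=
  \det (\matrix_(i < N, j < N) x j ^+ (f i + (N.-1 - i))).

Definition elem_pow (R : comNzRingType) (x : nat -> R) (N r c : nat) : R :=
  \sum_(S : {set 'I_N} | #|S| == c) \prod_(j in S) x j ^+ r.

(** In the Leibniz expansion at a permutation [s], row [i] meets column [s i]. The columns chosen by
    the elementary symmetric polynomial are therefore the image under [s] of a set of rows, and
    reindexing by this image turns each factor x_j^r into an increase of a row exponent. *)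
Lemma alternant_elem_pow (R : comNzRingType) (x : nat -> R) (N r c : nat)
    (f : nat -> nat) :
  alternant x N f * elem_pow x N r c =
  \sum_(S : {set 'I_N} | #|S| == c)
     alternant x N (fun i => (f i + r * (i \in [seq val j | j in S]))%N).
Proof.
rewrite /alternant /determinant mulr_suml.
rewrite [RHS]exchange_big /=; apply: eq_bigr => s _.
rewrite -mulrA -[RHS]mulr_sumr; congr (_ * _).
rewrite /elem_pow mulr_sumr.
rewrite (reindex_inj (h := fun S : {set 'I_N} => s @: S)) /=; last first.
  by apply: imset_inj; apply: perm_inj.
apply: eq_big => [S|S _]; first by rewrite card_imset //; apply: perm_inj.
rewrite big_imset /=; last by move=> ? ? _ _; apply: perm_inj.
rewrite [X in _ * X]big_mkcond -big_split /=; apply: eq_bigr => i _.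
rewrite !mxE (fintype.mem_image val_inj).
by case: (i \in S); rewrite ?muln1 ?muln0 ?addn0 ?mulr1 // -exprD addnAC.
Qed.

(* Adding [r] to the exponent [f i + (N.-1 - i)] of row [i] and moving it up to
   its sorted place, expressed on [f] so that [N] disappears: [ribbon_top] is
   that place, and [movable] says that the new exponent is not already there. *)
Definition ribbon_top (r i : nat) (f : nat -> nat) : nat :=
  find (fun j => (f j + (i - j) < f i + r)%N) (iota 0 i.+1).

Definition movable (r i : nat) (f : nat -> nat) : bool :=
  all (fun j => (f j + (i - j) != f i + r)%N) (iota 0 i).

Definition add_ribbon (r i : nat) (f : nat -> nat) (j : nat) : nat :=
  let p := ribbon_top r i f in
  (if j < p then f j
   else if j == p then f i + r - (i - p)
   else if j <= i then (f j.-1).+1 else f j)%N.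

Definition nonincr (f : nat -> nat) := forall i j, (i <= j)%N -> (f j <= f i)%N.

(** For a weakly decreasing [f] the numbers [f j + (i - j)] strictly decrease, so the rows passing
    the test of [find] form a final segment of 0..i, which contains [i] because r > 0. Above that
    segment [movable] excludes equality and leaves the strict reverse inequality. *)
Lemma ribbon_topP (r i : nat) (f : nat -> nat) : (0 < r)%N -> nonincr f ->
  movable r i f ->
  [/\ (ribbon_top r i f <= i)%N,
      forall j, (j < ribbon_top r i f)%N -> (f i + r < f j + (i - j))%N &
      forall j, (ribbon_top r i f <= j <= i)%N -> (f j + (i - j) < f i + r)%N].
Proof.
move=> r0 fP mv; set a := (fun j => (f j + (i - j) < f i + r)%N).
have ha : has a (iota 0 i.+1).
  apply/hasP; exists i; first by rewrite mem_iota; lia.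
  by rewrite /a; lia.
have hp : (ribbon_top r i f <= i)%N.
  by move: ha; rewrite has_find size_iota.
split=> // j hj.
  have := before_find 0%N hj; rewrite nth_iota ?add0n; last lia.
  have := allP mv j; rewrite mem_iota => /(_ ltac:(lia)); lia.
have := nth_find 0%N ha; rewrite -/(ribbon_top r i f) nth_iota ?add0n; last lia.
rewrite /a; have := fP (ribbon_top r i f) j; lia.
Qed.

Lemma add_ribbon_nonincr (r i : nat) (f : nat -> nat) : (0 < r)%N ->
  nonincr f -> movable r i f -> nonincr (add_ribbon r i f).
Proof.
move=> r0 fP mv; have [pi lo hi] := ribbon_topP r0 fP mv.
suff st j : (add_ribbon r i f j.+1 <= add_ribbon r i f j)%N.
  move=> j k jk; rewrite -(subnK jk); elim: (k - j)%N => // n IH.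
  by rewrite addSn; apply: leq_trans (st _) IH.
rewrite /add_ribbon; set p := ribbon_top r i f in pi lo hi *.
case: (ltngtP j p) => hj.
- case: (ltngtP j.+1 p) => hj'; try lia; first by apply: fP.
  have := lo _ hj; lia.
- have -> : (j.+1 < p)%N = false by lia.
  have -> : (j.+1 == p)%N = false by lia.
  have h1 := fP j j.+1 (leqnSn j); have h2 := fP j.-1 j (leq_pred j).
  by case: ifP; case: ifP => /=; lia.
- subst j; have -> : (p.+1 < p)%N = false by lia.
  have -> : (p.+1 == p)%N = false by lia.
  have h1 := hi p ltac:(lia); rewrite /=.
  case: ifP => h; first lia.
  have h2 := fP p p.+1 (leqnSn p); have e : i = p by lia.
  by lia.
Qed.


(** Row [i] of the first matrix is row [p] of the second, and the other rows agree in order; the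
    Laplace expansions along these two rows thus have the same minors, with cofactor signs that
    differ by (-1)^(i+p). The hypotheses compare staircase-shifted exponents, written additively to
    avoid truncated subtraction. *)
Lemma alternant_swap_row (R : comNzRingType) (x : nat -> R) (N : nat)
    (f g : nat -> nat) (i p : 'I_N) :
  (f i + p = g p + i)%N ->
  (forall j, (j.+1 < N)%N -> (f (bump i j) + bump p j = g (bump p j) + bump i j)%N) ->
  alternant x N f = (-1) ^+ (i + p) * alternant x N g.
Proof.
move=> e1 e2; rewrite /alternant (expand_det_row _ i) [in RHS](expand_det_row _ p).
rewrite mulr_sumr; apply: eq_bigr => j _; rewrite /cofactor !mxE.
have -> : (f i + (N.-1 - i) = g p + (N.-1 - p))%N.
  by have := ltn_ord i; have := ltn_ord p; lia.
rewrite [RHS]mulrCA; congr (_ * _).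
rewrite mulrA; congr (_ * _).
  rewrite -exprD -signr_odd -[RHS]signr_odd.
  by congr (_ ^+ nat_of_bool _); lia.
congr (\det _); apply/matrixP => a b; rewrite !mxE /=; congr (_ ^+ _).
have la : (a.+1 < N)%N by have := ltn_ord a; lia.
by have := e2 a la; have := ltn_ord i; have := ltn_ord p; rewrite /bump; lia.
Qed.

Lemma alternant_eq0 (R : comNzRingType) (x : nat -> R) (N : nat)
    (f : nat -> nat) (i p : 'I_N) :
  i != p -> (f i + p = f p + i)%N -> alternant x N f = 0.
Proof.
move=> ip e; apply: (determinant_alternate ip) => j; rewrite !mxE.
by congr (_ ^+ _); have := ltn_ord i; have := ltn_ord p; lia.
Qed.

Lemma eq_alternant (R : comNzRingType) (x : nat -> R) (N : nat)
    (f g : nat -> nat) : (forall i, (i < N)%N -> f i = g i) ->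
  alternant x N f = alternant x N g.
Proof.
by move=> e; congr (\det _); apply/matrixP=> i j; rewrite !mxE e.
Qed.

(** [g] holds the increments still owed to lower rows. Sorting row [i] upwards only disturbs rows up
    to [i], where [g] vanishes, so the pending increments pass through unchanged; this is why the
    rows are treated from top to bottom. *)
Lemma alternant_add_ribbon (R : comNzRingType) (x : nat -> R) (N r i : nat)
    (f g : nat -> nat) : (0 < r)%N -> nonincr f -> (i < N)%N ->
    (forall j, (j <= i)%N -> g j = 0%N) ->
  alternant x N (fun j => f j + r * (j == i) + g j)%N =
  if movable r i f then
    (-1) ^+ (i - ribbon_top r i f) *
      alternant x N (fun j => add_ribbon r i f j + g j)%N
  else 0.
Proof.
move=> r0 fP iN g0; case: ifPn => mv.
  have [pi lo hi] := ribbon_topP r0 fP mv.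
  set p := ribbon_top r i f in pi lo hi *.
  have pN : (p < N)%N by lia.
  rewrite (@alternant_swap_row _ x N _ (fun j => add_ribbon r i f j + g j)%N
             (Ordinal iN) (Ordinal pN)) /=.
  - congr (_ * _); rewrite -signr_odd -[RHS]signr_odd; congr (_ ^+ nat_of_bool _); lia.
  - rewrite /add_ribbon -/p ltnn eqxx !g0 // eqxx; have := hi p ltac:(lia); lia.
  - move=> j jN; rewrite /add_ribbon -/p /bump.
    case: (leqP p j) => pj; case: (leqP i j) => ij; rewrite ?add1n ?add0n.
    + have -> : (j.+1 < p)%N = false by lia.
      have -> : (j.+1 == p)%N = false by lia.
      have -> : (j.+1 == i)%N = false by lia.
      lia.
    + have -> : (j.+1 < p)%N = false by lia.
      have -> : (j.+1 == p)%N = false by lia.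
      rewrite /= !g0 //; last lia.
      have -> : (j == i)%N = false by lia.
      by rewrite /=; lia.
    + lia.
    + rewrite /=.
      have -> : (j == i)%N = false by lia.
      by rewrite pj /=; lia.
case/allPn: mv => j; rewrite mem_iota negbK add0n => /andP[_ ji] /eqP e.
have jN : (j < N)%N by lia.
apply: (@alternant_eq0 _ x N _ (Ordinal iN) (Ordinal jN)).
  by apply/eqP => /(congr1 val) /=; lia.
rewrite /= !g0 // ?eqxx; last lia.
have -> : (j == i)%N = false by lia.
lia.
Qed.

(* A ribbon is determined by its lowest row; [s] lists the lowest rows of
   successive ribbons. *)
Fixpoint add_ribbons (r : nat) (s : seq nat) (f : nat -> nat) : nat -> nat :=
  if s is i :: s' then add_ribbons r s' (add_ribbon r i f) else f.

Fixpoint all_movable (r : nat) (s : seq nat) (f : nat -> nat) : bool :=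
  if s is i :: s' then
    movable r i f && all_movable r s' (add_ribbon r i f)
  else true.

Fixpoint ribbons_height (r : nat) (s : seq nat) (f : nat -> nat) : nat :=
  if s is i :: s' then
    ((i - ribbon_top r i f) + ribbons_height r s' (add_ribbon r i f))%N
  else 0%N.

Lemma alternant_add_ribbons (R : comNzRingType) (x : nat -> R) (N r : nat)
    (s : seq nat) (f : nat -> nat) :
    (0 < r)%N -> nonincr f -> sorted ltn s -> all (fun i => i < N)%N s ->
  alternant x N (fun j => f j + r * (j \in s))%N =
  if all_movable r s f then
    (-1) ^+ ribbons_height r s f * alternant x N (add_ribbons r s f)
  else 0.
Proof.
move=> r0; elim: s f => [|i s IH] f fP /=.
  move=> _ _; rewrite mul1r; apply: eq_alternant => j _.
  by rewrite ?in_nil muln0 addn0.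
move=> ps /andP[iN sN].
have is_ j : j \in s -> (i < j)%N.
  by move: ps; rewrite (path_sortedE ltn_trans) => /andP[/allP + _] => /(_ j).
transitivity (alternant x N (fun j => f j + r * (j == i) + r * (j \in s))%N).
  apply: eq_alternant => j _; rewrite inE.
  case: eqP => [->|_] /=; last by rewrite muln0 addn0.
  case h : (i \in s); last by rewrite muln0 addn0.
  by have := is_ _ h; rewrite ltnn.
rewrite alternant_add_ribbon //; last first.
  move=> j ji; case h : (j \in s); last by rewrite muln0.
  by have := is_ _ h; lia.
case: ifPn => // mv /=.
rewrite IH //; first by case: ifP; rewrite ?mulr0 // mulrA -exprD.
- exact: add_ribbon_nonincr.
- exact: path_sorted ps.
Qed.

(** * The bialternant formula *)

(** Consecutive rows of a Gelfand-Tsetlin pattern: the lists one entry shorter than [l] whose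
    entries lie between neighbouring entries of [l]. Zeros are kept, so that lengths count
    variables. *)
Fixpoint interlace (l : seq nat) : seq (seq nat) :=
  if l is a :: l' then
    if l' is b :: _ then
      [seq v :: w | v <- iota b (a.+1 - b), w <- interlace l']
    else [:: [::]]
  else [::].

Lemma mem_interlace (l w : seq nat) : w \in interlace l =
  (size l == (size w).+1) &&
  all (fun i => (nth 0 l i.+1 <= nth 0 w i <= nth 0 l i)%N) (iota 0 (size w)).
Proof.
elim: l w => [|a [|b l] IH] w //=; first by case: w.
case: w => [|v w]; first by rewrite /=; apply/allpairsP => -[[? ?] [_ _ ]].
apply/allpairsP/idP => /=.
  move=> [[v' w'] /= []]; rewrite mem_iota => hv + [-> ->].
  rewrite (IH w') => /andP[/eqP [es] hall].
  rewrite /= eqSS es eqxx /=; apply/andP; split; first lia.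
  by rewrite (iotaDl 1) all_map.
rewrite !eqSS => /and3P[es hv hw]; exists (v, w); split=> //=.
  by rewrite mem_iota; lia.
by rewrite (IH w) /= eqSS es; rewrite (iotaDl 1) all_map in hw.
Qed.

(** The entries of an interlacing list range over independent intervals, so the sum distributes over
    the product. *)
Lemma sum_interlace_prod (R : comNzRingType) (N : nat) (l : seq nat)
    (F : 'I_N -> nat -> R) : size l = N.+1 ->
  \sum_(w <- interlace l) \prod_(i < N) F i (nth 0%N w i) =
  \prod_(i < N) \sum_(nth 0%N l i.+1 <= v < (nth 0%N l i).+1) F i v.
Proof.
elim: N l F => [|N IH] [|a [|b l]] F //= sl.
  by rewrite big_seq1 !big_ord0.
rewrite big_allpairs_dep /= big_ord_recl /= mulr_suml.
apply: eq_bigr => v _; rewrite -(IH (b :: l) (fun i => F (lift ord0 i))); last first.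
  by case: sl => /= ->.
by rewrite mulr_sumr; apply: eq_bigr => w _; rewrite big_ord_recl.
Qed.

(** Multilinearity of the determinant in its rows, with the independent row sums gathered into one
    sum over interlacing lists. *)
Lemma det_interlace (R : comNzRingType) (N : nat) (l : seq nat)
    (G : 'I_N -> nat -> 'I_N -> R) : size l = N.+1 ->
  \det (\matrix_(i < N, j < N)
      \sum_(nth 0%N l i.+1 <= v < (nth 0%N l i).+1) G i v j) =
  \sum_(w <- interlace l) \det (\matrix_(i < N, j < N) G i (nth 0%N w i) j).
Proof.
move=> sl; rewrite /determinant exchange_big /=; apply: eq_bigr => s _.
rewrite -mulr_sumr; congr (_ * _).
under eq_bigr do rewrite mxE.
rewrite -(sum_interlace_prod (fun i v => G i v (s i)) sl).
by apply: eq_bigr => w _; apply: eq_bigr => i _; rewrite mxE.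
Qed.

Lemma sumnB_nth (N : nat) (l w : seq nat) : size l = N.+1 -> size w = N ->
  (forall i : 'I_N, nth 0 w i <= nth 0 l i)%N ->
  (sumn l - sumn w =
    nth 0 l N + \sum_(i < N) (nth 0 l i - nth 0 w i))%N.
Proof.
move=> sl sw le; rewrite !sumnE [in LHS](big_nth 0%N) sl.
rewrite [X in (_ - X)%N](big_nth 0%N) sw !big_mkord big_ord_recr /=.
have -> : (\sum_(i < N) nth 0 l i =
  \sum_(i < N) nth 0 w i + \sum_(i < N) (nth 0 l i - nth 0 w i))%N.
  by rewrite -big_split /=; apply: eq_bigr => i _; rewrite subnKC.
by rewrite -addnA addKn addnC.
Qed.

(** The branching rule at the level of determinants: after row operations, the factorisation of a
    difference of powers makes row [i] a sum over the interval from [l_(i+1)] to [l_i], and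
    multilinearity collects these sums into one over interlacing lists. *)
Lemma alternant_branch (R : comNzRingType) (x : nat -> R) (N : nat)
    (l : seq nat) : size l = N.+1 -> sorted geq l ->
  alternant x N.+1 (nth 0%N l) =
  (\prod_(j < N) (x j - x N)) *
  \sum_(w <- interlace l) x N ^+ (sumn l - sumn w) * alternant x N (nth 0%N w).
Proof.
move=> sl ls; have lP i : (nth 0 l i.+1 <= nth 0 l i)%N.
  have [il|il] := ltnP i.+1 (size l); last by rewrite nth_default.
  exact: (@sorted_leq_nth _ geq (fun _ _ _ a b => leq_trans b a) leqnn 0%N l ls
    i i.+1 (ltnW il) il (leqnSn i)).
set A := (\matrix_(i < N.+1, j < N.+1) x j ^+ (nth 0%N l i + (N - i))).
(* [d i] is the difference of the exponents of rows [i] and [i.+1]; the extra 1 comes from the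
   staircase. *)
pose d i := (nth 0%N l i - nth 0%N l i.+1).+1.
pose P := \matrix_(i < N.+1, j < N.+1)
   (if j == i then 1 else if j == i.+1 :> nat then - x N ^+ d i else 0 : R).
have dP : \det P = 1.
  rewrite -det_tr det_trig; last first.
    apply/is_trig_mxP => i j ij; rewrite !mxE.
    have -> : (i == j) = false by apply/eqP => e; subst; rewrite ltnn in ij.
    by have -> : (i == j.+1 :> nat) = false by lia.
  by rewrite big1 // => i _; rewrite !mxE eqxx.
(* Subtracting [x N ^+ d i] times row [i.+1] from row [i] clears the last
   column above its last entry and makes [x j - x N] a factor of the other
   entries in column [j]. *)
pose A' := P *m A.
have eA' (i j : 'I_N.+1) : A' i j = if (i < N)%N then
     (x j - x N) * \sum_(nth 0%N l i.+1 <= v < (nth 0%N l i).+1)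
        (x N ^+ (nth 0%N l i - v) * x j ^+ (v + (N.-1 - i)))
   else x j ^+ nth 0%N l N.
  rewrite mxE; case: ifPn => iN.
    have iN1 : (i.+1 < N.+1)%N by [].
    rewrite (bigD1 i) //= (bigD1 (Ordinal iN1)) /=; last first.
      by apply/eqP => /(congr1 val) /=; lia.
    rewrite big1 ?addr0; last first.
      move=> k /andP[k1 k2]; rewrite !mxE (negbTE k1).
      case: eqP => [e|_]; last by rewrite mul0r.
      by case/eqP: k2; apply: val_inj.
    rewrite !mxE !eqxx mul1r /=.
    have -> : (Ordinal iN1 == i) = false by apply/eqP => /(congr1 val) /=; lia.
    have -> : (nth 0%N l i + (N - i) = d i + (nth 0%N l i.+1 + (N - i.+1)))%N.
      by rewrite /d; have := lP i; lia.
    rewrite exprD mulNr -mulrBl subrXX -mulrA; congr (_ * _).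
    rewrite mulr_suml -{2}[nth 0%N l i.+1]add0n big_addn.
    have -> : ((nth 0%N l i).+1 - nth 0%N l i.+1 = d i)%N.
      by rewrite /d; have := lP i; lia.
    rewrite big_mkord [LHS](reindex_inj rev_ord_inj) /=.
    apply: eq_bigr => k _; rewrite mulrAC -exprD mulrC; congr (_ * _).
      by congr (_ ^+ _); have := ltn_ord k; rewrite /d; lia.
    by congr (_ ^+ _); have := ltn_ord k; rewrite /d; lia.
  have ei : i = N :> nat by have := ltn_ord i; lia.
  rewrite (bigD1 i) //= big1 ?addr0; last first.
    move=> k k1; rewrite !mxE (negbTE k1).
    have -> : (k == i.+1 :> nat) = false by have := ltn_ord k; lia.
    by rewrite mul0r.
  by rewrite !mxE eqxx mul1r ei subnn addn0.
have -> : alternant x N.+1 (nth 0%N l) = \det A' by rewrite det_mulmx dP mul1r.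
(* In the last column the factor [x j - x N] is zero, so only the bottom entry survives. *)
clearbody A'; rewrite (expand_det_col _ ord_max) (bigD1 ord_max) //= big1 ?addr0; last first.
  move=> i iN; rewrite eA' subrr mul0r ifT ?mul0r //.
  have := ltn_ord i; rewrite ltnS leq_eqVlt => /orP[/eqP e|//].
  by case/eqP: iN; apply: val_inj.
rewrite eA' /= ltnn /cofactor /= addnn -signr_odd odd_double expr0 mul1r.
pose G (i : 'I_N) v (j : 'I_N) :=
  (x N ^+ (nth 0%N l i - v) * x j ^+ (v + (N.-1 - i))).
transitivity (x N ^+ nth 0%N l N * ((\prod_(j < N) (x j - x N)) *
   \det (\matrix_(i < N, j < N)
      \sum_(nth 0%N l i.+1 <= v < (nth 0%N l i).+1) G i v j))).
  congr (_ * _); rewrite /determinant mulr_sumr; apply: eq_bigr => s _.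
  rewrite mulrCA; congr (_ * _).
  (* The factor [x j - x N] belongs to a column; along the permutation [s] the product over columns
     is rewritten as a product over rows. *)
  rewrite [in RHS](reindex_inj (@perm_inj _ s)) /= -big_split /=.
  by apply: eq_bigr => i _; rewrite !mxE eA' !lift_max ltn_ord.
rewrite (det_interlace G sl) mulrCA; congr (_ * _); rewrite mulr_sumr.
rewrite !big_seq; apply: eq_bigr => w; rewrite mem_interlace sl eqSS.
case/andP => /eqP sw /allP hw.
have {}hw (i : 'I_N) : (nth 0 w i <= nth 0 l i)%N.
  by have := hw i; rewrite mem_iota -sw ltn_ord => /(_ isT) /andP[].
have -> : (sumn l - sumn w =
           nth 0%N l N + \sum_(i < N) (nth 0%N l i - nth 0%N w i))%N.
  by apply: sumnB_nth; rewrite ?sl.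
rewrite exprD -mulrA; congr (_ * _).
rewrite -prodrXr /determinant mulr_sumr; apply: eq_bigr => s _.
rewrite [RHS]mulrCA; congr (_ * _).
by rewrite -big_split /=; apply: eq_bigr => i _; rewrite !mxE.
Qed.

(** The branching rule taken as a definition, so that it can be matched with quotients of alternants
    on one side and with tableaux on the other. The list [l] is meant to have exactly [N] entries,
    trailing zeros included. *)
Fixpoint schur_poly (R : comNzRingType) (x : nat -> R) (N : nat)
    (l : seq nat) : R :=
  if N is N'.+1 then
    \sum_(w <- interlace l) x N' ^+ (sumn l - sumn w) * schur_poly x N' w
  else 1.

Fixpoint vandermonde (R : comNzRingType) (x : nat -> R) (N : nat) : R :=
  if N is N'.+1 then (\prod_(j < N') (x j - x N')) * vandermonde x N' else 1.

Lemma interlace_sorted (l w : seq nat) : w \in interlace l -> sorted geq w.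
Proof.
rewrite mem_interlace => /andP[_ /allP h].
apply/(sortedP 0%N) => i iw.
have := h i; have := h i.+1; rewrite !mem_iota.
move=> /(_ ltac:(lia)) /andP[h1 h2] /(_ ltac:(lia)) /andP[h3 h4].
exact: leq_trans h2 h3.
Qed.

(** By [alternant_branch] both sides obey the same recursion in the last variable; [vandermonde] is
    built up in the order in which that recursion produces its factors. *)
Lemma bialternant (R : comNzRingType) (x : nat -> R) (N : nat) (l : seq nat) :
  size l = N -> sorted geq l ->
  alternant x N (nth 0%N l) = vandermonde x N * schur_poly x N l.
Proof.
elim: N l => [|N IH] l sl ls /=; first by rewrite mulr1 /alternant det_mx00.
rewrite alternant_branch // -mulrA; congr (_ * _); rewrite mulr_sumr.
rewrite !big_seq; apply: eq_bigr => w wl.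
rewrite IH ?(interlace_sorted wl) // 1?mulrCA //.
by move: wl; rewrite mem_interlace sl eqSS => /andP[/eqP].
Qed.

(** * Ribbons *)

Lemma partition_nonincr (l : seq nat) : sorted geq l -> nonincr (nth 0%N l).
Proof.
move=> ls i j ij; have [jl|jl] := ltnP j (size l); last by rewrite nth_default.
exact: (@sorted_leq_nth _ geq (fun _ _ _ a b => leq_trans b a) leqnn 0%N l ls
    i j (leq_ltn_trans ij jl) jl ij).
Qed.

Lemma mem_dg (l : seq nat) (b : box) : (b \in dg l) = (b.2 < nth 0 l b.1)%N.
Proof.
case: b => i j /=; apply/allpairsPdep/idP => [[a [c]]|h].
  by rewrite !mem_iota !add0n => -[_ hc [-> ->]]; lia.
exists i, j; rewrite !mem_iota !add0n; split=> //=.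
by case: ltnP => // hl; rewrite nth_default in h.
Qed.

Lemma mem_skew (nu mu : seq nat) (b : box) :
  (b \in skew nu mu) = (nth 0 mu b.1 <= b.2 < nth 0 nu b.1)%N.
Proof. by rewrite mem_filter !mem_dg -leqNgt. Qed.

Lemma uniq_skew (nu mu : seq nat) : uniq (skew nu mu).
Proof.
apply: filter_uniq; apply: allpairs_uniq_dep => //; first exact: iota_uniq.
  by move=> i _; exact: iota_uniq.
by move=> [i j] [i' j'] _ _ [-> ->].
Qed.

(** An [r]-ribbon in rows [p] to [i], described without boxes. Consecutive rows overlap in exactly
    one column, which is the condition [g j.+1 = (f j).+1]; with these overlaps the row lengths
    telescope, and the equation at [p] says that there are [r] boxes. *)
Definition ribbon_move (r p i : nat) (f g : nat -> nat) : Prop :=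
  [/\ (p <= i)%N, forall j, (j < p)%N -> g j = f j,
      (g p + (i - p) = f i + r)%N,
      forall j, (p <= j < i)%N -> g j.+1 = (f j).+1 &
      forall j, (i < j)%N -> g j = f j].

(** Every step goes left or down and raises row minus column by exactly one. *)
Lemma ribbon_step_nth (bs : seq box) (t u : nat) :
  sorted ribbon_step bs -> (t <= u < size bs)%N ->
  [/\ (nth (0, 0) bs t).1 <= (nth (0, 0) bs u).1,
      (nth (0, 0) bs u).2 <= (nth (0, 0) bs t).2 &
      (nth (0, 0) bs u).1 + (nth (0, 0) bs t).2 =
      (nth (0, 0) bs t).1 + (nth (0, 0) bs u).2 + (u - t)]%N.
Proof.
move=> /(sortedP (0, 0)%N) st /andP[tu]; rewrite -(subnK tu).
elim: (u - t)%N => [|n IH]; first by rewrite add0n subnn addn0 addnC.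
rewrite addSn => h; have [] := IH (ltnW h); have := st _ h.
case: (nth _ bs (n + t)) => a b; case: (nth _ bs (n + t).+1) => a' b'.
by rewrite /ribbon_step !xpair_eqE /= => /orP[/andP[/eqP ->
  /eqP ->]|/andP[/eqP -> /eqP ->]]; split; lia.
Qed.

Lemma is_ribbon_sub (r : nat) (nu mu : seq nat) (j : nat) :
  is_ribbon r nu mu -> (nth 0 mu j <= nth 0 nu j)%N.
Proof.
move=> [sub _]; case e : (nth 0 mu j)%N => [//|m].
by have := sub (j, m); rewrite !mem_dg /= e => /(_ (ltnSn _)).
Qed.

(** [p] and [i] are the rows of the first and last labelled box. Monotonicity of rows and columns
    along the labelling locates the end boxes of every row. *)
Lemma is_ribbonE (r : nat) (nu mu : seq nat) : (0 < r)%N ->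
  is_ribbon r nu mu ->
  exists p i, ribbon_move r p i (nth 0%N mu) (nth 0%N nu).
Proof.
move=> r0 rib; have le j := is_ribbon_sub j rib.
case: rib => _ [bs [pe sz st]].
set f := nth 0%N mu in le *; set g := nth 0%N nu in le *.
pose b := nth (0, 0)%N bs.
have inb j c : (f j <= c < g j)%N -> exists2 u, (u < r)%N & b u = (j, c).
  move=> h; have : (j, c) \in bs by rewrite (perm_mem pe) mem_skew.
  by move=> /(nthP (0, 0)%N)[u]; rewrite sz; exists u.
have bin u : (u < r)%N -> (f (b u).1 <= (b u).2 < g (b u).1)%N.
  by move=> ur; rewrite -mem_skew -(perm_mem pe) mem_nth ?sz.
have mono t u := @ribbon_step_nth bs t u st; rewrite sz in mono.
have st1 t : (t.+1 < r)%N -> ribbon_step (b t) (b t.+1).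
  by rewrite -sz; exact: (sortedP (0, 0)%N st).
exists (b 0%N).1, (b r.-1).1.
have rng u : (u < r)%N -> ((b 0%N).1 <= (b u).1 <= (b r.-1).1)%N.
  move=> ur; have [] := mono 0%N u ltac:(lia).
  by have [] := mono u r.-1 ltac:(lia); rewrite /b; lia.
have out j : ~~ ((b 0%N).1 <= j <= (b r.-1).1)%N -> g j = f j.
  move=> nj; apply/eqP; rewrite eqn_leq le andbT leqNgt; apply/negP => h.
  have [u ur e] := inb j (f j) ltac:(lia).
  by have := rng u ur; rewrite e (negbTE nj).
split.
- by have := rng 0%N r0; lia.
- by move=> j hj; apply: out; lia.
(* The first box is the right end of row [p] and the last box is the left end of row [i]; their
   values of row minus column differ by [r - 1]. *)
- have h0 := bin 0%N r0; have h1 := bin r.-1 ltac:(lia).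
  have [u ur e] := inb (b 0%N).1 (g (b 0%N).1).-1 ltac:(lia).
  have [v vr e'] := inb (b r.-1).1 (f (b r.-1).1) ltac:(lia).
  have [_ + _] := mono 0%N u ltac:(lia); rewrite -!/(b _) e /=.
  have [_ + _] := mono v r.-1 ltac:(lia); rewrite -!/(b _) e' /=.
  have [] := mono 0%N r.-1 ltac:(lia); rewrite -!/(b _).
  lia.
- move=> j /andP[pj ji].
  (* The first box below row [j] is reached by a vertical step. Its column is both the left end of
     the skew part of row [j] and the right end of that of row [j.+1]. *)
  have ex : exists t, (t < r)%N && (j < (b t).1)%N by exists r.-1; lia.
  have /ex_minnP[t /andP[tr tj] tmin] := ex.
  case: t tr tj tmin => [|t] tr tj tmin; first lia.
  have tj' : ((b t).1 <= j)%N.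
    by rewrite leqNgt; apply/negP => h; have := tmin t; rewrite h; lia.
  have [e1 e2] : (b t).1 = j /\ b t.+1 = (j.+1, (b t).2).
    move: (st1 _ tr) tj tj'; rewrite /ribbon_step.
    by case/orP => /eqP ->; rewrite /=; try lia; move=> *; split; [|congr pair]; lia.
  have h1 := bin t ltac:(lia); have := bin t.+1 tr; rewrite e2 /= => h2.
  rewrite e1 in h1.
  have [u ur e] := inb j (f j) ltac:(lia).
  have [v vr e'] := inb j.+1 (g j.+1).-1 ltac:(lia).
  have uc : (f j >= (b t).2)%N.
    have [ut|ut] := leqP u t.
      by have [_ + _] := mono u t ltac:(lia); rewrite -!/(b _) e.
    have [+ _ _] := mono t.+1 u ltac:(lia).
    by rewrite -!/(b _) e e2 /=; lia.
  have vc : ((g j.+1).-1 <= (b t).2)%N.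
    have [ut|ut] := leqP v t.
      by have [+ _ _] := mono v t ltac:(lia); rewrite -!/(b _) e' e1 /=; lia.
    have [_ + _] := mono t.+1 v ltac:(lia).
    by rewrite -!/(b _) e' e2.
  lia.
- by move=> j hj; apply: out; lia.
Qed.

(** Listed from right to left, the direction in which [ribbon_step] runs through a row. *)
Fixpoint row_boxes (j a k : nat) : seq box :=
  if k is k'.+1 then (j, a + k')%N :: row_boxes j a k' else [::].

Fixpoint ribbon_boxes (f g : nat -> nat) (j n : nat) : seq box :=
  row_boxes j (f j) (g j - f j) ++
  if n is n'.+1 then ribbon_boxes f g j.+1 n' else [::].

Lemma mem_row_boxes (j a k : nat) (b : box) :
  (b \in row_boxes j a k) = (b.1 == j) && (a <= b.2 < a + k)%N.
Proof.
case: b => x y; elim: k => [|k IH]; rewrite /= ?in_nil ?inE ?IH ?xpair_eqE /=; lia.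
Qed.

Lemma mem_ribbon_boxes (f g : nat -> nat) (j n : nat) (b : box) :
  (b \in ribbon_boxes f g j n) =
  (j <= b.1 <= j + n)%N && (f b.1 <= b.2 < g b.1)%N.
Proof.
elim: n j => [|n IH] j /=; rewrite mem_cat mem_row_boxes ?in_nil ?IH.
  by case: eqP => [->|]; lia.
by case: eqP => [->|]; lia.
Qed.

Lemma row_boxes_path (j a k : nat) :
  path ribbon_step (j, a + k)%N (row_boxes j a k).
Proof.
elim: k => //= k ->; rewrite andbT /ribbon_step /= addnS.
by rewrite eqxx.
Qed.

Lemma last_row_boxes (x : box) (j a k : nat) :
  last x (row_boxes j a k.+1) = (j, a).
Proof.
elim: k x => [|k IH] x; first by rewrite /= addn0.
exact: (IH (j, a + k.+1)%N).
Qed.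

(** The preceding box [x] is arbitrary so that the induction can cross from one row to the next:
    [g i.+1 = (f i).+1] puts the first box of a row directly below the last box of the row above. *)
Lemma ribbon_boxes_path (f g : nat -> nat) (j n : nat) (x : box) :
  (forall i, (j <= i <= j + n)%N -> (f i < g i)%N) ->
  (forall i, (j <= i < j + n)%N -> g i.+1 = (f i).+1) ->
  ribbon_step x (j, (g j).-1) -> path ribbon_step x (ribbon_boxes f g j n).
Proof.
elim: n j x => [|n IH] j x lt eq hx /=; rewrite cat_path.
all: have := lt j ltac:(lia) => hj;
  have -> : (g j - f j = (g j - f j).-1.+1)%N by lia.
all: rewrite last_row_boxes /= row_boxes_path.
all: have -> : (f j + (g j - f j).-1 = (g j).-1)%N by lia.
all: rewrite hx //=.
apply: IH; try by move=> i hi; try (apply: lt; lia); try (apply: eq; lia).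
by rewrite /ribbon_step eq ?eqxx ?orbT //=; lia.
Qed.

Lemma size_row_boxes (j a k : nat) : size (row_boxes j a k) = k.
Proof. by elim: k => //= k ->. Qed.

Lemma size_ribbon_boxes (f g : nat -> nat) (j n : nat) :
  (forall i, (j <= i <= j + n)%N -> (f i < g i)%N) ->
  (forall i, (j <= i < j + n)%N -> g i.+1 = (f i).+1) ->
  (size (ribbon_boxes f g j n) + f (j + n) = g j + n)%N.
Proof.
elim: n j => [|n IH] j lt eq /=; rewrite size_cat size_row_boxes.
  by have := lt j; rewrite addn0 /=; lia.
have := IH j.+1 ltac:(by move=> i hi; apply: lt; lia)
   ltac:(by move=> i hi; apply: eq; lia).
by rewrite eq; [have := lt j ltac:(lia); rewrite addSnnS; lia | lia].
Qed.

Lemma ribbon_move_lt (r p i : nat) (f g : nat -> nat) : (0 < r)%N ->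
  nonincr f -> nonincr g -> ribbon_move r p i f g ->
  forall j, (p <= j <= i)%N -> (f j < g j)%N.
Proof.
move=> r0 fP gP [pi h1 h2 h3 h4] j hj.
have [e|ne] := eqVneq j p; last first.
  have := h3 j.-1 ltac:(lia); have := fP j.-1 j ltac:(lia).
  by rewrite prednK; lia.
subst j; have [e|ne] := eqVneq p i; first by subst p; lia.
have := gP p p.+1 ltac:(lia); rewrite h3; lia.
Qed.

Lemma ribbon_move_le (r p i : nat) (f g : nat -> nat) : (0 < r)%N ->
  nonincr f -> nonincr g -> ribbon_move r p i f g ->
  forall j, ((f j < g j)%N = (p <= j <= i)%N) /\ (f j <= g j)%N.
Proof.
move=> r0 fP gP mv j; have := ribbon_move_lt r0 fP gP mv (j := j).
case: mv => pi h1 h2 h3 h4.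
have [] := boolP (p <= j <= i)%N; first by move=> h /(_ isT); lia.
move=> h _; have -> : g j = f j; last by rewrite ltnn leqnn.
by case: (ltnP j p) => hj; [exact: h1 | apply: h4; lia].
Qed.

(** The rows from [p] to [i] are exactly those that gain boxes, which gives the sign. As [mu] is
    weakly decreasing, the leftmost box of the ribbon lies in its lowest row [i], which gives the
    left column. *)
Lemma ribbon_moveE (r p i : nat) (nu mu : seq nat) : (0 < r)%N ->
  nonincr (nth 0%N mu) -> nonincr (nth 0%N nu) ->
  ribbon_move r p i (nth 0%N mu) (nth 0%N nu) ->
  [/\ is_ribbon r nu mu, sgn_ribbon nu mu = (-1) ^+ (i - p) &
      left_col nu mu = nth 0%N mu i].
Proof.
move=> r0 fP gP mv; have lt := ribbon_move_lt r0 fP gP mv.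
have le := ribbon_move_le r0 fP gP mv; case: mv => pi _ h2 h3 h4.
set f := nth 0%N mu in fP gP lt le h2 h3 h4 *.
set g := nth 0%N nu in fP gP lt le h2 h3 h4 *.
have pin : (p + (i - p) = i)%N by lia.
split.
- split=> [[j c]|]; first by rewrite !mem_dg /= -/f -/g; have [_] := le j; lia.
  exists (ribbon_boxes f g p (i - p)).
  (* The box just right of the ribbon in its top row serves as a virtual start of the path. *)
  have st : path ribbon_step (p, g p) (ribbon_boxes f g p (i - p)).
    apply: ribbon_boxes_path; rewrite ?pin //.
    rewrite /ribbon_step /= prednK ?eqxx //.
    by have := lt p ltac:(lia); lia.
  split; last exact: path_sorted st.
    apply: uniq_perm; [|exact: uniq_skew|].
      (* Row minus column strictly increases along the steps, so no box is repeated. *)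
      apply: (@sorted_uniq _ (fun a b : box => a.1 + b.2 < a.2 + b.1)%N).
      - by move=> [a b] [c d] [e e'] /=; lia.
      - by move=> [a b] /=; lia.
      apply: sub_sorted (path_sorted st) => -[a b] [c d].
      rewrite /ribbon_step /= !xpair_eqE /=; lia.
    move=> [a b]; rewrite mem_ribbon_boxes mem_skew /= pin -/f -/g.
    by have [] := le a; case: (p <= a <= i)%N => //=; lia.
  have := @size_ribbon_boxes f g p (i - p); rewrite pin => /(_ lt h3); lia.
- rewrite /sgn_ribbon; congr (_ ^+ _).
  have -> : size (undup [seq b.1 | b <- skew nu mu]) = size (iota p (i - p).+1).
    apply: perm_size; apply: uniq_perm; [exact: undup_uniq|exact: iota_uniq|].
    move=> j; rewrite mem_undup mem_iota; apply/mapP/idP => [[[a b]]|hj].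
      by rewrite mem_skew /= => h ->; have [] := le a; rewrite /f /g; lia.
    by exists (j, f j) => //; rewrite mem_skew /= -/f -/g; have := lt j; lia.
  by rewrite size_iota.
- rewrite /left_col; set s := [seq b.2 | b <- skew nu mu].
  have fs : f i \in s.
    by apply/mapP; exists (i, f i) => //; rewrite mem_skew /= -/f -/g; have := lt i; lia.
  have sf c : c \in s -> (f i <= c)%N.
    case/mapP => -[a b]; rewrite mem_skew /= -/f -/g => h ->.
    by have := fP a i; have [] := le a; lia.
  have := sort_sorted leq_total s.
  have : sort leq s =i s by apply: mem_sort.
  case: (sort leq s) => [|y t] e; first by have := e (f i); rewrite fs.
  rewrite /= (path_sortedE leq_trans) => /andP[/allP ha _].
  have := sf y; rewrite -e inE eqxx => /(_ isT) h.
  have := fs; rewrite -e inE => /orP[/eqP -> //|/ha]; rewrite -/f; lia.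
Qed.

(** The lowest row and [r] determine the ribbon: monotonicity of [f] and [g] forces the new exponent
    of row [i] to lie strictly between the old exponents of rows [p - 1] and [p], which is the place
    found by [ribbon_top]. *)
Lemma ribbon_move_add (r p i : nat) (f g : nat -> nat) : (0 < r)%N ->
  nonincr f -> nonincr g -> ribbon_move r p i f g ->
  [/\ movable r i f, p = ribbon_top r i f & g =1 add_ribbon r i f].
Proof.
move=> r0 fP gP mv; have lt := ribbon_move_lt r0 fP gP mv.
case: mv => pi h1 h2 h3 h4.
have lo j : (j < p)%N -> (f i + r < f j + (i - j))%N.
  by move=> jp; have := gP j p (ltnW jp); rewrite (h1 j jp); lia.
have hi j : (p <= j <= i)%N -> (f j + (i - j) < f i + r)%N.
  move=> pj; have [->|ne] := eqVneq j i; first lia.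
  by have := h3 j ltac:(lia); have := gP p j.+1 ltac:(lia); lia.
have mv : movable r i f.
  apply/allP => j; rewrite mem_iota => ji; have := lo j; have := hi j.
  by case: (ltnP j p); lia.
have [ti tlo thi] := ribbon_topP r0 fP mv.
have ep : p = ribbon_top r i f.
  case: (ltngtP p (ribbon_top r i f)) => // h.
    by have := tlo p h; have := hi p ltac:(lia); lia.
  by have := lo _ h; have := thi (ribbon_top r i f) ltac:(lia); lia.
split=> // j; rewrite /add_ribbon -ep.
case: (ltngtP j p) => [/h1 //|jp|->]; last by have := hi p; lia.
case: leqP => ji; last exact: h4.
by rewrite -(h3 j.-1) ?prednK //; lia.
Qed.

Lemma add_ribbon_move (r i : nat) (f : nat -> nat) : (0 < r)%N ->
  nonincr f -> movable r i f ->
  ribbon_move r (ribbon_top r i f) i f (add_ribbon r i f).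
Proof.
move=> r0 fP mv; have [ti tlo thi] := ribbon_topP r0 fP mv.
rewrite /add_ribbon; split=> // [j ->//||j hj|j hj].
- by rewrite ltnn eqxx; have := thi (ribbon_top r i f); lia.
- have -> : (j.+1 < ribbon_top r i f)%N = false by lia.
  have -> : (j.+1 == ribbon_top r i f)%N = false by lia.
  by have -> : (j < i)%N by lia.
- have -> : (j < ribbon_top r i f)%N = false by lia.
  have -> : (j == ribbon_top r i f)%N = false by lia.
  by have -> : (j <= i)%N = false by lia.
Qed.

Lemma add_ribbons_nonincr (r : nat) (s : seq nat) (f : nat -> nat) :
  (0 < r)%N -> nonincr f -> all_movable r s f -> nonincr (add_ribbons r s f).
Proof.
move=> r0; elim: s f => //= i s IH f fP /andP[mv mvs].
by apply: IH => //; apply: add_ribbon_nonincr.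
Qed.

Lemma add_ribbons_rcons (r : nat) (s : seq nat) (i : nat) (f : nat -> nat) :
  add_ribbons r (rcons s i) f = add_ribbon r i (add_ribbons r s f).
Proof. by elim: s f => /=. Qed.

Lemma all_movable_rcons (r : nat) (s : seq nat) (i : nat) (f : nat -> nat) :
  all_movable r (rcons s i) f =
  all_movable r s f && movable r i (add_ribbons r s f).
Proof. by elim: s f => [|j s IH] f /=; rewrite ?andbT // IH andbA. Qed.

Lemma add_ribbon_above (r i : nat) (f : nat -> nat) (k : nat) : (0 < r)%N ->
  nonincr f -> movable r i f -> (i < k)%N -> add_ribbon r i f k = f k.
Proof. by move=> r0 fP mv; have [_ _ _ _] := add_ribbon_move r0 fP mv; apply. Qed.

Lemma add_ribbons_above (r : nat) (s : seq nat) (f : nat -> nat) (k : nat) :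
  (0 < r)%N -> nonincr f -> all_movable r s f ->
  (forall i, i \in s -> i < k)%N -> add_ribbons r s f k = f k.
Proof.
move=> r0; elim: s f => //= i s IH f fP /andP[mv mvs] h.
rewrite IH ?add_ribbon_above ?h ?mem_head //.
  exact: add_ribbon_nonincr.
by move=> j js; apply: h; rewrite inE js orbT.
Qed.

Lemma add_ribbon_gt (r i : nat) (f : nat -> nat) : (0 < r)%N ->
  nonincr f -> movable r i f -> (f i < add_ribbon r i f i)%N.
Proof.
move=> r0 fP mv; have mo := add_ribbon_move r0 fP mv.
apply: (ribbon_move_lt r0 fP _ mo); first exact: add_ribbon_nonincr.
by case: mo => h _ _ _ _; rewrite h leqnn.
Qed.

Lemma add_ribbons_ge (r : nat) (s : seq nat) (f : nat -> nat) (k : nat) :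
  (0 < r)%N -> nonincr f -> all_movable r s f -> (f k <= add_ribbons r s f k)%N.
Proof.
move=> r0; elim: s f => //= i s IH f fP /andP[mv mvs].
have gP := add_ribbon_nonincr r0 fP mv.
apply: leq_trans (IH _ gP mvs).
by have [] := ribbon_move_le r0 fP gP (add_ribbon_move r0 fP mv) k.
Qed.

Lemma add_ribbons_gt0 (r : nat) (s : seq nat) (f : nat -> nat) (k : nat) :
  (0 < r)%N -> nonincr f -> all_movable r s f -> k \in s ->
  (0 < add_ribbons r s f k)%N.
Proof.
move=> r0; elim: s f => //= i s IH f fP /andP[mv mvs].
have gP := add_ribbon_nonincr r0 fP mv.
rewrite inE => /orP[/eqP ->|]; last exact: IH.
apply: leq_trans (add_ribbons_ge i r0 gP mvs).
exact: leq_ltn_trans (leq0n _) (add_ribbon_gt r0 fP mv).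
Qed.

(** The move is undone from its result h. The top row satisfies h(p) + (i - p) = f(i) + r, and h(p)
    - p is strictly decreasing in p, so p is recovered; shifting the rows back then recovers all but
    row [i], whose value must be supplied as a hypothesis. *)
Lemma add_ribbon_inj (r i : nat) (f g : nat -> nat) : (0 < r)%N ->
  nonincr f -> nonincr g -> movable r i f -> movable r i g -> f i = g i ->
  add_ribbon r i f =1 add_ribbon r i g -> f =1 g.
Proof.
move=> r0 fP gP mf mg efg e j.
have [pf f1 f2 f3 f4] := add_ribbon_move r0 fP mf.
have [pg g1 g2 g3 g4] := add_ribbon_move r0 gP mg.
have hP := add_ribbon_nonincr r0 fP mf.
have ep : ribbon_top r i f = ribbon_top r i g.
  move: g2; rewrite -e -efg => g2.
  case: (ltngtP (ribbon_top r i f) (ribbon_top r i g)) => // h.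
    by have := hP _ _ (ltnW h); lia.
  by have := hP _ _ (ltnW h); lia.
have [ji|ji|->] := ltngtP j i; last by [].
  have [jp|jp] := ltnP j (ribbon_top r i f).
    by rewrite -f1 // -g1 -?ep // e.
  by apply: succn_inj; rewrite -f3 ?jp // -g3 -?ep ?jp // e.
by rewrite -f4 // -g4 // e.
Qed.

(* The largest index is the last row that changes, so the last ribbon can be
   recognised and removed. *)
Lemma add_ribbons_inj (r : nat) (s t : seq nat) (f : nat -> nat) :
  (0 < r)%N -> nonincr f -> sorted ltn s -> sorted ltn t ->
  all_movable r s f -> all_movable r t f ->
  add_ribbons r s f =1 add_ribbons r t f -> s = t.
Proof.
move=> r0 fP.
have lt_last u i : sorted ltn (rcons u i) ->
    sorted ltn u /\ (forall j, j \in u -> (j < i)%N).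
  rewrite !(sorted_pairwise ltn_trans) pairwise_rcons.
  by move=> /andP[/allP].
have stop u i : sorted ltn (rcons u i) -> all_movable r (rcons u i) f ->
    [/\ nonincr (add_ribbons r u f), movable r i (add_ribbons r u f),
        add_ribbons r u f i = f i, (f i < add_ribbons r (rcons u i) f i)%N &
        forall j, (i < j)%N -> add_ribbons r (rcons u i) f j = f j].
  move=> /lt_last[_ ui] mu; have := mu.
  rewrite all_movable_rcons => /andP[mv mvi].
  have uP := add_ribbons_nonincr r0 fP mv.
  have e : add_ribbons r u f i = f i by apply: add_ribbons_above.
  split=> //; first by rewrite -{1}e add_ribbons_rcons; apply: add_ribbon_gt.
  move=> j ij; apply: add_ribbons_above => // k.
  rewrite mem_rcons inE => /orP[/eqP -> //|/ui ki]; exact: ltn_trans ki ij.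
elim/last_ind: s t => [|s i IH] t; case/lastP: t => [|t k] //.
- by move=> _ st _ mt e; have [_ _ _ + _] := stop _ _ st mt; rewrite -e ltnn.
- by move=> ss _ ms _ e; have [_ _ _ + _] := stop _ _ ss ms; rewrite e ltnn.
move=> ss st ms mt e.
have [sP smv se slt sgt] := stop _ _ ss ms.
have [tP tmv te tlt tgt] := stop _ _ st mt.
have ik : i = k.
  case: (ltngtP i k) => // h; first by move: tlt; rewrite -e sgt ?ltnn.
  by move: slt; rewrite e tgt ?ltnn.
subst k; congr rcons.
have [ss' _] := lt_last _ _ ss; have [st' _] := lt_last _ _ st.
move: ms mt; rewrite !all_movable_rcons => /andP[ms _] /andP[mt _].
apply: IH => //; apply: (add_ribbon_inj r0 sP tP smv tmv); first by rewrite se.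
by move=> j; rewrite -!add_ribbons_rcons.
Qed.

Lemma partition_eq (l l' : seq nat) : is_partition l -> is_partition l' ->
  nth 0%N l =1 nth 0%N l' -> l = l'.
Proof.
move=> /andP[ls l0] /andP[ls' l0'] e.
have sz (k k' : seq nat) : 0%N \notin k' -> nth 0%N k =1 nth 0%N k' ->
    (size k' <= size k)%N.
  move=> k0 ek; rewrite leqNgt; apply/negP => h.
  have := mem_nth 0%N h; rewrite -ek nth_default //; exact/negP.
apply: (@eq_from_nth _ 0%N) => [|i _]; last exact: e.
by apply/eqP; rewrite eqn_leq !sz.
Qed.

Definition to_partition (N : nat) (f : nat -> nat) : seq nat :=
  [seq a <- mkseq f N | a != 0%N].

Lemma nth_to_partition (N : nat) (f : nat -> nat) :
  nonincr f -> f N = 0%N -> nth 0%N (to_partition N f) =1 f.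
Proof.
move=> fP fN i; rewrite /to_partition.
elim: N f fP fN i => [|N IH] f fP fN i.
  by rewrite /= nth_nil; apply/esym/eqP; rewrite -leqn0 -fN; apply: fP.
have e : mkseq f N.+1 = f 0%N :: mkseq (fun j => f j.+1) N.
  by rewrite /mkseq /= -[1%N]addn0 iotaDl -map_comp.
rewrite e /=; case: eqP => /= [f0|f0].
  have z j : f j = 0%N by apply/eqP; rewrite -leqn0 -f0; apply: fP.
  rewrite IH ?z // => j k _; by rewrite !z.
case: i => // i; rewrite /= IH // => j k jk; exact: fP.
Qed.

Lemma to_partitionP (N : nat) (f : nat -> nat) :
  nonincr f -> is_partition (to_partition N f).
Proof.
move=> fP; apply/andP; split; last first.
  by rewrite mem_filter.
apply: sorted_filter; first by move=> a b c h h'; apply: leq_trans h' h.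
apply/(sortedP 0%N) => i; rewrite size_mkseq => h.
by rewrite !nth_mkseq ?(ltnW h) //; apply: fP.
Qed.

Lemma is_ribbon_sumn (r : nat) (nu mu : seq nat) : is_ribbon r nu mu ->
  sumn nu = (sumn mu + r)%N.
Proof.
move=> [sub [bs [pe sz _]]].
have szdg l : size (dg l) = sumn l.
  rewrite size_allpairs_dep; congr sumn; apply: (@eq_from_nth _ 0%N).
    by rewrite !size_map size_iota.
  move=> i; rewrite size_map size_iota => h.
  by rewrite (nth_map 0%N) ?size_iota // nth_iota // size_iota.
have udg l : uniq (dg l).
  apply: allpairs_uniq_dep => //; first exact: iota_uniq.
    by move=> i _; exact: iota_uniq.
  by move=> [i j] [i' j'] _ _ [-> ->].
rewrite -!szdg -sz (perm_size pe) -size_cat; apply: perm_size.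
apply: perm_trans (_ : perm_eq _ (filter (mem (dg mu)) (dg nu) ++
  filter (predC (mem (dg mu))) (dg nu))) _.
  by rewrite perm_sym; apply/permPl; apply: perm_filterC.
rewrite perm_cat2r; apply: uniq_perm; rewrite ?filter_uniq ?udg // => b.
rewrite mem_filter /=; case: (boolP (b \in dg mu)) => //= h; exact: sub.
Qed.

(** * Dual polyribbons *)

(** Each ribbon is replaced by its lowest row. A ribbon with lowest row [i] has its left column at
    the old length of row [i], so weakly decreasing left columns become strictly increasing rows.
    The final clause carries the left column of the first ribbon through the induction. *)
Lemma polyribbon_chain_rows (r : nat) (nu mu : seq nat) (g : seq (seq nat)) :
  (0 < r)%N -> polyribbon_chain r nu mu g ->
  exists s, [/\ size g = (size s).+1, sorted ltn s,
    all_movable r s (nth 0%N mu),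
    nth 0%N nu =1 add_ribbons r s (nth 0%N mu) &
    \prod_(i < (size g).-1) sgn_ribbon (nth [::] g i.+1) (nth [::] g i) =
      (-1) ^+ ribbons_height r s (nth 0%N mu)] /\
    (if s is i :: _ then left_col (nth [::] g 1) mu = nth 0%N mu i else True).
Proof.
move=> r0; elim: g mu => [|m [|m' g] IH] mu [] //= _.
  by move=> _ [-> <-] _ _; exists [::]; split; split; rewrite ?big_ord0.
move=> /and3P[pm pm' pg] [em enu] hrib hleft; subst m.
have ch : polyribbon_chain r nu m' (m' :: g).
  split=> //=; first by rewrite pm' pg.
    by move=> i ig; apply: (hrib i.+1).
  by move=> i ig; apply: (hleft i.+1).
have [s [[sz ss ms es hs] hd]] := IH m' ch.
have [p [i mv]] := is_ribbonE r0 (hrib 0%N isT).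
have muP : nonincr (nth 0%N mu) by apply: partition_nonincr; case/andP: pm.
have mP : nonincr (nth 0%N m') by apply: partition_nonincr; case/andP: pm'.
have [/= _ sg lf] := ribbon_moveE r0 muP mP mv.
have [mvi ep /funext eg] := ribbon_move_add r0 muP mP mv.
rewrite -/(nth 0%N m') in eg.
exists (i :: s); split=> //; split=> //=.
- by rewrite -sz.
(* If the next lowest row [k] were at most [i], then mu_i < m'_i <= m'_k. But m'_k is the left
   column of the next ribbon, hence at most mu_i. *)
- case: s sz ss ms es hs hd => //= k s sz -> ms _ _ hd; rewrite andbT.
  have := hleft 0%N; rewrite /= lf; case: (g) sz hd => // m2 g' _ /= hd.
  rewrite hd => /(_ isT) le; rewrite ltnNge; apply/negP => ki.
  have := mP _ _ ki; have := ribbon_move_lt r0 muP mP mv (j := i).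
  by case: mv => pi _ _ _ _; rewrite pi leqnn => /(_ isT); lia.
- by rewrite mvi -eg.
- by rewrite -eg.
- rewrite big_ord_recl /= sg -ep -eg exprD; congr (_ * _).
  by rewrite -hs; apply: eq_bigr.
Qed.

Lemma rows_polyribbon_chain (r : nat) (s : seq nat) (nu mu : seq nat) :
  (0 < r)%N -> is_partition mu -> is_partition nu ->
  sorted ltn s -> all_movable r s (nth 0%N mu) ->
  nth 0%N nu =1 add_ribbons r s (nth 0%N mu) ->
  exists2 g, polyribbon_chain r nu mu g & size g = (size s).+1.
Proof.
move=> r0; elim: s mu => [|i s IH] mu pmu pnu.
  move=> _ _ e; exists [:: mu] => //; split=> //=; first by rewrite pmu.
  by rewrite (partition_eq pnu pmu e).
move=> ss /= /andP[mv ms] e.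
have muP : nonincr (nth 0%N mu) by apply: partition_nonincr; case/andP: pmu.
have nuP : nonincr (nth 0%N nu) by apply: partition_nonincr; case/andP: pnu.
have fP := add_ribbon_nonincr r0 muP mv.
(* [size nu] rows suffice for the intermediate shape because later ribbons only enlarge it towards
   [nu]. *)
pose m' := to_partition (size nu) (add_ribbon r i (nth 0%N mu)).
have pm' : is_partition m' by apply: to_partitionP.
have em' : nth 0%N m' = add_ribbon r i (nth 0%N mu).
  apply/funext; apply: nth_to_partition => //.
  have := add_ribbons_ge (size nu) r0 fP ms.
  by rewrite -e nth_default // leqn0 => /eqP.
have mo := add_ribbon_move r0 muP mv; rewrite -em' in mo.
have m'P : nonincr (nth 0%N m') by rewrite em'.
have [ri _ lf] := ribbon_moveE r0 muP m'P mo.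
rewrite -em' in ms e.
have [g ch sg] := IH m' pm' pnu (path_sorted ss) ms e.
(* The rows of the chain given by induction are read back and identified with [s] by injectivity;
   this yields the left column of its first ribbon, to be compared with that of the new one. *)
have [s' [[sz' ss' ms' es' _] hd]] := polyribbon_chain_rows r0 ch.
have es : s' = s.
  apply: (add_ribbons_inj r0 m'P) => //; first exact: path_sorted ss.
  by move=> j; rewrite -es' e.
subst s'; case: ch => g0 pg [e0 el] hrib hleft.
exists (mu :: g); last by rewrite /= sg.
case: g g0 pg e0 el hrib hleft sg hd sz' => // a g _ /= pg e0 el hrib hleft sg hd _.
subst a; split=> //=; first by rewrite pmu.
  by case=> [|j] /=; [|apply: hrib].
case=> [|j] /=; last by apply: hleft.
rewrite ltnS => g0; case: s ss sg hd {IH ms e ms' es' ss'} => [|k s] /=.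
  by move=> _ [/eqP]; rewrite size_eq0 => /eqP g00; rewrite g00 in g0.
move=> /andP[ik _] _ hd; rewrite lf.
case: g g0 hd {pg el hrib hleft} => //= b g _ ->.
by rewrite em' add_ribbon_above //; apply: muP; apply: ltnW.
Qed.

(** Whichever chain [xget] selects, its list of lowest rows leads from [mu] to [nu] and is therefore
    [s]. *)
Lemma sgn'_rows (r : nat) (s : seq nat) (nu mu : seq nat) :
  (0 < r)%N -> is_partition mu -> is_partition nu ->
  sorted ltn s -> all_movable r s (nth 0%N mu) ->
  nth 0%N nu =1 add_ribbons r s (nth 0%N mu) ->
  sgn' r nu mu = (-1) ^+ ribbons_height r s (nth 0%N mu).
Proof.
move=> r0 pmu pnu ss ms e; rewrite /sgn'.
have [g0 ch0 _] := rows_polyribbon_chain r0 pmu pnu ss ms e.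
case: xgetP => [g _ /= ch|/(_ g0)] //.
have [s' [[_ ss' ms' e' ->] _]] := polyribbon_chain_rows r0 ch.
congr (_ ^+ ribbons_height _ _ _).
apply: (add_ribbons_inj r0 _ ss' ss ms' ms); last by move=> j; rewrite -e -e'.
by apply: partition_nonincr; case/andP: pmu.
Qed.

Definition pieri_coef (r c : nat) (mu nu : seq nat) : rat :=
  if `[< is_dual_polyribbon r c nu mu >] then sgn' r nu mu else 0.

Definition rows_of (N : nat) (S : {set 'I_N}) : seq nat := [seq val j | j in S].

Lemma rows_of_sorted (N : nat) (S : {set 'I_N}) : sorted ltn (rows_of S).
Proof.
apply: (@subseq_sorted _ ltn ltn_trans _ (iota 0 N)); last exact: iota_ltn_sorted.
rewrite -val_enum_ord; apply: map_subseq; rewrite enumT; exact: filter_subseq.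
Qed.

Lemma size_rows_of (N : nat) (S : {set 'I_N}) : size (rows_of S) = #|S|.
Proof. by rewrite size_image. Qed.

Lemma rows_of_lt (N : nat) (S : {set 'I_N}) : all (fun i => i < N)%N (rows_of S).
Proof. by apply/allP => i /mapP[j _ ->]; apply: ltn_ord. Qed.

Lemma rows_of_inj (N : nat) (S S' : {set 'I_N}) : rows_of S = rows_of S' -> S = S'.
Proof.
move=> e; apply/setP => j.
have mem_rows A : (val j \in rows_of A) = (j \in A).
  by rewrite /rows_of (fintype.mem_image val_inj).
by rewrite -!mem_rows e.
Qed.

Lemma rows_of_surj (N : nat) (s : seq nat) : sorted ltn s ->
  all (fun i => i < N)%N s -> exists S : {set 'I_N}, rows_of S = s.
Proof.
move=> ss /allP sN; exists [set j : 'I_N | val j \in s]%SET.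
apply: (irr_sorted_eq ltn_trans ltnn (rows_of_sorted _) ss) => i.
apply/fintype.imageP/idP => [[j]|si]; first by rewrite inE => ? ->.
by exists (Ordinal (sN i si)); rewrite ?inE.
Qed.

Lemma is_dual_polyribbon_rows (r c : nat) (nu mu : seq nat) : (0 < r)%N ->
  is_dual_polyribbon r c nu mu ->
  exists s, [/\ size s = c, sorted ltn s,
    all_movable r s (nth 0%N mu) & nth 0%N nu =1 add_ribbons r s (nth 0%N mu)].
Proof.
move=> r0 [g [ch sg]].
have [s [[sz ss ms es _] _]] := polyribbon_chain_rows r0 ch.
by exists s; split=> //; apply: succn_inj; rewrite -sz.
Qed.

Lemma is_dual_polyribbon_sumn (r c : nat) (nu mu : seq nat) :
  is_dual_polyribbon r c nu mu -> sumn nu = (sumn mu + r * c)%N.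
Proof.
move=> [g [[_ _ [<- <-] hrib _] sg]]; rewrite sg /=.
have : (c < size g)%N by rewrite sg.
elim: c {sg} => [|c IH] h; first by rewrite muln0 addn0.
by rewrite (is_ribbon_sumn (hrib c h)) IH ?(ltnW h) // mulnS addnAC addnA.
Qed.

(** At most one set of rows leads from [mu] to [nu], so the sum has at most one non-zero term. This
    is the form in which the coefficient comes out of the product with [elem_pow]. *)
Lemma pieri_coefE (r c N : nat) (nu mu : seq nat) : (0 < r)%N ->
  is_partition mu -> is_partition nu -> (size nu <= N)%N ->
  pieri_coef r c mu nu =
  \sum_(S : {set 'I_N} | #|S| == c)
    if all_movable r (rows_of S) (nth 0%N mu) &&
       `[< nth 0%N nu = add_ribbons r (rows_of S) (nth 0%N mu) >]
    then (-1) ^+ ribbons_height r (rows_of S) (nth 0%N mu) else 0.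
Proof.
move=> r0 pmu pnu nuN; rewrite /pieri_coef.
have muP : nonincr (nth 0%N mu) by apply: partition_nonincr; case/andP: pmu.
case: asboolP => [hd|nd]; last first.
  rewrite big1 // => S /eqP cS; case: ifP => // /andP[mv /asboolP e].
  have [g ch sg] := rows_polyribbon_chain r0 pmu pnu (rows_of_sorted S) mv
    (fun j => congr1 (@^~ j) e).
  by case: nd; exists g; rewrite sg size_rows_of cS.
have [s [sc ss ms es]] := is_dual_polyribbon_rows r0 hd.
have [|S eS] := @rows_of_surj N s ss.
  (* The lowest row of a ribbon is a non-empty row of [nu], hence has index less than [N]. *)
  apply/allP => i si; have := add_ribbons_gt0 r0 muP ms si.
  rewrite -es; apply: contraTT; rewrite -leqNgt => Ni.
  by rewrite nth_default ?ltnn //; apply: leq_trans Ni.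
have /funext es' := es.
rewrite (bigD1 S) /=; last by rewrite -size_rows_of eS sc.
rewrite eS ms asboolT //= (sgn'_rows r0 pmu pnu ss ms es) big1 ?addr0 //.
move=> S' /andP[_ SS']; case: ifP => // /andP[mv /asboolP e].
case/eqP: SS'; apply: rows_of_inj; rewrite eS.
apply: (add_ribbons_inj r0 muP (rows_of_sorted S') ss mv ms) => j.
by rewrite -es -e.
Qed.

(** Multiplying by the Vandermonde product turns the claim into the computation with alternants; the
    hypothesis that this product is regular allows it to be cancelled without an integral domain. *)
Lemma schur_poly_elem_pow (R : comNzRingType) (x : nat -> R) (N r c : nat)
    (l : seq nat) :
    (forall a, vandermonde x N * a = 0 -> a = 0) ->
    (0 < r)%N -> sorted geq l -> size l = N ->
  schur_poly x N l * elem_pow x N r c =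
  \sum_(S : {set 'I_N} | #|S| == c)
    if all_movable r (rows_of S) (nth 0%N l) then
      (-1) ^+ ribbons_height r (rows_of S) (nth 0%N l) *
        schur_poly x N (mkseq (add_ribbons r (rows_of S) (nth 0%N l)) N)
    else 0.
Proof.
move=> reg r0 ls sl; have lP := partition_nonincr ls.
apply/eqP; rewrite -subr_eq0; apply/eqP/reg; rewrite mulrBr; apply/eqP.
rewrite subr_eq0 mulrA -bialternant // alternant_elem_pow mulr_sumr; apply/eqP.
apply: eq_bigr => S _.
rewrite alternant_add_ribbons ?rows_of_sorted ?rows_of_lt //.
case: ifP => mv; last by rewrite mulr0.
rewrite mulrCA; congr (_ * _).
rewrite -bialternant ?size_mkseq //.
  by apply: eq_alternant => i iN; rewrite nth_mkseq.
apply/(sortedP 0%N) => i; rewrite size_mkseq => h.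
by rewrite !nth_mkseq ?(ltnW h) //; apply: add_ribbons_nonincr.
Qed.

(** * The ring of formal series *)

Lemma cm_eqP (m n : monomial) : (forall v, m v = n v) -> m = n.
Proof. by move=> e; apply/eqP/cmP. Qed.

Lemma cm_mulIl (a b c : monomial) : mmul a b = mmul a c -> b = c.
Proof.
move=> e; apply: cm_eqP => v; have := congr1 (fun m : monomial => m v) e.
by rewrite !cmM => /addnI.
Qed.

(** A divisor lives on the support of [m] with exponents at most the largest exponent [n] of [m], so
    the finite functions on that support produce all of them. This makes the sum in [smul] a genuine
    finite sum. *)
Lemma finite_divisors (m : monomial) :
  finite_set [set d : monomial | exists e, mmul d e = m].
Proof.
pose n := \max_(v <- finsupp m) m v.
pose mk (h : {ffun finsupp m -> 'I_n.+1}) : monomial :=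
  [cmonom (h i : nat) | i : finsupp m]%M.
apply: (@sub_finite_set _ _ (mk @` [set: {ffun finsupp m -> 'I_n.+1}])).
  move=> d [e de] /=; have dm v : (d v <= m v)%N by rewrite -de cmM leq_addr.
  exists [ffun i => inord (d (val i))] => //.
  apply: cm_eqP => v; rewrite cmE fsfun_ffun.
  case: insubP => [i vi <-|vi] /=.
    rewrite ffunE inordK // ltnS; apply: leq_trans (dm _) _.
    by apply: leq_bigmax_seq => //; apply: valP.
  have := dm v; have := cmE_eq0 m v; rewrite vi => /eqP ->.
  by rewrite leqn0 => /eqP.
exact: finite_image.
Qed.

Definition divisors_of (m : monomial) : seq monomial :=
  fset_set [set d : monomial | exists e, mmul d e = m].

Lemma mem_divisors_of (m d : monomial) :
  (d \in divisors_of m) = `[< exists e, mmul d e = m >].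
Proof.
rewrite /divisors_of in_fset_set; last exact: finite_divisors.
by apply/idP/asboolP; rewrite inE.
Qed.

Lemma uniq_divisors_of (m : monomial) : uniq (divisors_of m).
Proof. exact: fset_uniq. Qed.

Lemma divisors_of_trans (m d e : monomial) :
  d \in divisors_of m -> e \in divisors_of d -> e \in divisors_of m.
Proof.
rewrite !mem_divisors_of => /asboolP[a <-] /asboolP[b <-].
by apply/asboolP; exists (mmul b a); rewrite mulmA.
Qed.

Lemma fsbig_list (T : choiceType) (s : seq T) (A : set T) (F : T -> rat) :
  uniq s -> (forall x, (x \in s) <-> A x) ->
  \sum_(x \in A) F x = \sum_(x <- s) F x.
Proof.
move=> us sA; have -> : A = [set` s] by apply/seteqP; split=> x /= /sA.
by rewrite [RHS]fsbig_seq.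
Qed.

(** The freedom in [s] lets a nested product, whose inner sum runs over the divisors of a divisor,
    share one index list with the outer sum. *)
Lemma smul_widen (s : seq monomial) (m : monomial) (f g : series) :
  uniq s -> {subset divisors_of m <= s} ->
  smul f g m = \sum_(a <- s) \sum_(b <- s) (f a * g b) *+ (mmul a b == m).
Proof.
move=> us sub; rewrite /smul.
rewrite (@fsbig_list _ [seq p <- [seq (a, b) | a <- s, b <- s] | mmul p.1 p.2 == m]).
- rewrite big_filter big_mkcond big_allpairs.
  apply: eq_bigr => a _; apply: eq_bigr => b _ /=.
  by case: eqP.
- by apply: filter_uniq; apply: allpairs_uniq => // -[? ?] [? ?].
- move=> [a b] /=; rewrite mem_filter /=; split=> [/andP[/eqP]//|e].
  rewrite e eqxx; apply/allpairsP; exists (a, b); split=> //=; apply: sub.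
    by rewrite mem_divisors_of; apply/asboolP; exists b.
  by rewrite mem_divisors_of; apply/asboolP; exists a; rewrite mulmC.
Qed.

Lemma sum_indicator (s : seq monomial) (d : monomial) (F : monomial -> rat) :
  uniq s -> (d \notin s -> F d = 0) -> \sum_(a <- s) F a *+ (d == a) = F d.
Proof.
move=> us h; have [ds|/[dup] ds /h ->] := boolP (d \in s).
  rewrite (bigD1_seq d) //= eqxx big1 ?addr0 // => a ad.
  by rewrite eq_sym (negbTE ad).
by rewrite big_seq big1 // => a sa; case: eqP ds => // ->; rewrite sa.
Qed.

Lemma smulC : commutative smul.
Proof.
move=> f g; apply/funext => m; have us := uniq_divisors_of m.
rewrite !(smul_widen _ _ us) // exchange_big /=.
by apply: eq_bigr => a _; apply: eq_bigr => b _; rewrite mulrC mulmC.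
Qed.

(** Both bracketings of a triple product reduce to this sum, which is symmetric in the three factors
    up to renaming indices. *)
Lemma smulAl (f g h : series) (m : monomial) : smul (smul f g) h m =
  \sum_(a <- divisors_of m) \sum_(b <- divisors_of m) \sum_(c <- divisors_of m)
    (f a * g b * h c) *+ (mmul (mmul a b) c == m).
Proof.
have us := uniq_divisors_of m; rewrite (smul_widen _ _ us) //.
transitivity (\sum_(p <- divisors_of m) \sum_(a <- divisors_of m)
  \sum_(b <- divisors_of m) (\sum_(c <- divisors_of m)
   (f a * g b * h c) *+ (mmul p c == m)) *+ (mmul a b == p)).
  apply: eq_big_seq => p pm.
  rewrite (smul_widen _ _ us); last by move=> d; apply: divisors_of_trans.
  under eq_bigr => c _ do rewrite mulr_suml -sumrMnl.
  rewrite exchange_big /=; apply: eq_bigr => a _.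
  under eq_bigr => c _ do rewrite mulr_suml -sumrMnl.
  rewrite exchange_big /=; apply: eq_bigr => b _.
  rewrite -sumrMnl; apply: eq_bigr => c _.
  by rewrite -mulrnAl mulrnAl mulrnAl; case: eqP; case: eqP.
rewrite exchange_big /=; apply: eq_bigr => a _.
rewrite exchange_big /=; apply: eq_bigr => b _.
rewrite (sum_indicator (F := fun p => \sum_(c <- divisors_of m)
  (f a * g b * h c) *+ (mmul p c == m))) // => nm.
rewrite big1 // => c _; case: eqP => // e; case/negP: nm.
by rewrite mem_divisors_of; apply/asboolP; exists c.
Qed.

Lemma smulA : associative smul.
Proof.
move=> f g h; rewrite smulC; apply/funext => m; rewrite !smulAl.
rewrite [RHS]exchange_big /=; apply: eq_bigr => b _.
rewrite exchange_big /=; apply: eq_bigr => c _; apply: eq_bigr => a _.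
by rewrite [g b * h a * _]mulrC mulrA [mmul (mmul b a) _]mulmC mulmA.
Qed.

Lemma smul1l : left_id sone smul.
Proof.
move=> f; apply/funext => m; have us := uniq_divisors_of m.
rewrite (smul_widen _ _ us) //.
have mm : m \in divisors_of m.
  by rewrite mem_divisors_of; apply/asboolP; exists mone; rewrite mulm1.
have m1 : mone \in divisors_of m.
  by rewrite mem_divisors_of; apply/asboolP; exists m; rewrite mul1m.
rewrite (bigD1_seq mone) //= [X in _ + X]big1 ?addr0 => [|a a1]; last first.
  by rewrite big1 // => b _; rewrite /sone (negbTE a1) mul0r mul0rn.
transitivity (\sum_(b <- divisors_of m) f b *+ (m == b)).
  by apply: eq_bigr => b _; rewrite /sone eqxx mul1r mul1m eq_sym.
by rewrite sum_indicator // mm.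
Qed.

Definition sadd (f g : series) : series := fun m => f m + g m.
Definition sopp (f : series) : series := fun m => - f m.
Definition szero : series := fun=> 0.

Lemma saddA : associative sadd.
Proof. by move=> f g h; apply/funext => m; rewrite /sadd addrA. Qed.

Lemma saddC : commutative sadd.
Proof. by move=> f g; apply/funext => m; rewrite /sadd addrC. Qed.

Lemma sadd0l : left_id szero sadd.
Proof. by move=> f; apply/funext => m; rewrite /sadd add0r. Qed.

Lemma saddNl : left_inverse szero sopp sadd.
Proof. by move=> f; apply/funext => m; rewrite /sadd addNr. Qed.

Lemma smulDl : left_distributive smul sadd.
Proof.
move=> f g h; apply/funext => m; have us := uniq_divisors_of m.
rewrite /sadd !(smul_widen _ _ us) // -big_split /=.
apply: eq_bigr => a _; rewrite -big_split /=; apply: eq_bigr => b _.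
by rewrite mulrDl mulrnDl.
Qed.

Lemma sone_neq0 : sone <> szero.
Proof. by move=> /(congr1 (@^~ mone)); rewrite /sone eqxx => /eqP; rewrite oner_eq0. Qed.

(** The alternant identities hold over any commutative ring; these instances make them available for
    series. The ring product is [smul] itself, so [\big[smul/sone]] and [\prod] agree by
    conversion. *)
HB.instance Definition _ := gen_eqMixin series.
HB.instance Definition _ := gen_choiceMixin series.
HB.instance Definition _ := GRing.isZmodule.Build series saddA saddC sadd0l saddNl.

Lemma soner_neq0 : sone != 0 :> series.
Proof. by apply/eqP; exact: sone_neq0. Qed.

HB.instance Definition _ := GRing.Zmodule_isComNzRing.Build series
  smulA smulC smul1l smulDl soner_neq0.

Lemma sumE (I : Type) (s : seq I) (P : pred I) (F : I -> series) (m : monomial) :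
  (\sum_(i <- s | P i) F i) m = \sum_(i <- s | P i) F i m.
Proof. by elim/big_rec2: _ => // i a b _ <-. Qed.

Lemma oppE (f : series) m : (- f) m = - f m.
Proof. by []. Qed.

Lemma prodE (I : Type) (s : seq I) (P : pred I) (F : I -> series) :
  \big[smul/sone]_(i <- s | P i) F i = \prod_(i <- s | P i) F i.
Proof. by []. Qed.

Definition mon (a : monomial) : series := fun m => (m == a)%:R.

Lemma mulE (f g : series) (m : monomial) : (f * g) m =
  \sum_(a <- divisors_of m) \sum_(b <- divisors_of m) (f a * g b) *+ (mmul a b == m).
Proof. exact: (smul_widen _ _ (uniq_divisors_of m)). Qed.

Lemma mon1 : mon mone = 1.
Proof. apply/funext => m; rewrite /mon. transitivity (sone m);
  last by []. by rewrite /sone; case: (m == mone). Qed.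

Lemma mon_mulE (a : monomial) (f : series) (m : monomial) :
  (mon a * f) (mmul a m) = f m.
Proof.
rewrite mulE.
have aD : a \in divisors_of (mmul a m).
  by rewrite mem_divisors_of; apply/asboolP; exists m.
have mD : m \in divisors_of (mmul a m).
  by rewrite mem_divisors_of; apply/asboolP; exists a; rewrite mulmC.
rewrite (bigD1_seq a) ?uniq_divisors_of //= [X in _ + X]big1 ?addr0; last first.
  by move=> b ba; rewrite big1 // => c _; rewrite /mon (negbTE ba) mul0r mul0rn.
rewrite (bigD1_seq m) ?uniq_divisors_of //= [X in _ + X]big1 ?addr0; last first.
  by move=> c cm; case: eqP => // /cm_mulIl e; rewrite e eqxx in cm.
by rewrite /mon !eqxx mul1r.
Qed.

Lemma mon_mul0 (a : monomial) (f : series) (m : monomial) :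
  ~ (exists b, mmul a b = m) -> (mon a * f) m = 0.
Proof.
move=> na; rewrite mulE big1 // => b _; rewrite big1 // => c _.
rewrite /mon; case: (eqVneq b a) => [->|_]; last by rewrite mul0r mul0rn.
by case: eqP => // e; case: na; exists c.
Qed.

Lemma monM (a b : monomial) : mon (mmul a b) = mon a * mon b.
Proof.
apply/funext => m; case: (pselect (exists c, mmul a c = m)) => [[c <-]|nc].
  rewrite mon_mulE /mon; congr (_%:R); apply/congr1.
  by apply/eqP/eqP => [/cm_mulIl|->].
rewrite mon_mul0 // /mon; case: eqP => // e; case: nc; by exists b.
Qed.

(** * Tableaux in finitely many variables *)

(* The variable x_{k+1,j+1}. *)
Definition xvar (k j : nat) : series := mon (ucm ((k, j) : var)).

(** If x_i f = x_j f, the coefficient of f at m equals its coefficient at m x_i / x_j, or is 0 when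
    x_j does not divide m x_i. Each such move lowers the exponent of x_j by one, hence the induction
    on that exponent. *)
Lemma xvar_sub_regular (k i j : nat) (f : series) : i != j ->
  (xvar k i - xvar k j) * f = 0 -> f = 0.
Proof.
move=> ij /eqP; rewrite mulrBl subr_eq0 => /eqP e; apply/funext => m.
have {}e a : (mon (ucm ((k, i) : var)) * f) a = (mon (ucm ((k, j) : var)) * f) a.
  exact: (congr1 (fun g : series => g a) e).
elim: {m}(m (k, j)) {-2}m (erefl (m (k, j))) => [|n IH] m mj.
  rewrite -(mon_mulE (ucm ((k, i) : var)) f m) e; apply: mon_mul0.
  move=> [b /(congr1 (fun a : monomial => a (k, j)))]; rewrite !cmM !cmU mj eqxx.
  by rewrite xpair_eqE (negbTE ij) andbF.
rewrite -(mon_mulE (ucm ((k, i) : var)) f m) e.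
case: (pselect (exists b, mmul (ucm ((k, j) : var)) b = mmul (ucm ((k, i) : var)) m)).
  move=> [b eb]; rewrite -eb mon_mulE; apply: IH.
  have := congr1 (fun a : monomial => a (k, j)) eb; rewrite !cmM !cmU mj eqxx.
  by rewrite xpair_eqE (negbTE ij) andbF => -[].
by move=> nb; apply: mon_mul0.
Qed.

Lemma vandermonde_regular (k N : nat) (f : series) :
  vandermonde (xvar k) N * f = 0 -> f = 0.
Proof.
elim: N f => [|N IH] f /=; first by rewrite mul1r.
rewrite -mulrA => h; apply: IH; move: h; move: (vandermonde _ _ * f).
apply: (big_ind (fun p : series => forall g, p * g = 0 -> g = 0)).
- by move=> g; rewrite mul1r.
- by move=> p q IHp IHq g; rewrite -mulrA => /IHp /IHq.
by move=> j _ g; apply: xvar_sub_regular; rewrite ltn_eqF.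
Qed.

(** Equality after setting to zero all variables of second index at least [N]. It is compatible with
    products because a factor of a monomial uses only variables of that monomial. *)
Definition eq_upto (N : nat) (f g : series) : Prop :=
  forall m : monomial, (forall v, m v != 0%N -> (v.2 < N)%N) -> f m = g m.

Lemma eq_upto_mul (N : nat) (f f' g g' : series) :
  eq_upto N f f' -> eq_upto N g g' -> eq_upto N (f * g) (f' * g').
Proof.
move=> ef eg m hm; rewrite !mulE; apply: eq_bigr => a _; apply: eq_bigr => b _.
case: eqP => // e; congr (_ * _ *+ _).
  by apply: ef => v av; apply: hm; rewrite -e cmM addn_eq0 negb_and av.
by apply: eg => v bv; apply: hm; rewrite -e cmM addn_eq0 negb_and bv orbT.
Qed.

Lemma expcmnE (a : monomial) (r : nat) v : expcmn a r v = (r * a v)%N.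
Proof.
rewrite /expcmn; case: r => [|r]; first by rewrite /= onecmE.
elim: r => [|r IH]; first by rewrite mul1n.
by move: IH; rewrite !iteropS iterS mulcmE => ->; rewrite mulSn.
Qed.

Lemma expcmn_inj (r : nat) (a b : monomial) : (0 < r)%N ->
  expcmn a r = expcmn b r -> a = b.
Proof.
move=> r0 e; apply: cm_eqP => v.
have := congr1 (fun m : monomial => m v) e; rewrite !expcmnE => /eqP.
by rewrite eqn_pmul2l // => /eqP.
Qed.

Lemma cm_prodE (T : Type) (s : seq T) (P : pred T) (F : T -> monomial) v :
  (\big[mmul/mone]_(i <- s | P i) F i : monomial) v = (\sum_(i <- s | P i) F i v)%N.
Proof. by elim/big_rec2: _ => [|i a b _ <-]; rewrite ?cm1 ?cmM. Qed.

Lemma mon_prod (T : Type) (s : seq T) (P : pred T) (F : T -> monomial) :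
  mon (\big[mmul/mone]_(i <- s | P i) F i) = \prod_(i <- s | P i) mon (F i).
Proof. by elim/big_rec2: _ => [|i a b _ <-]; rewrite ?mon1 ?monM. Qed.

Lemma mon_exp (a : monomial) (r : nat) : mon (expcmn a r) = mon a ^+ r.
Proof.
elim: r => [|r IH]; first by rewrite expr0 -mon1.
rewrite exprS -IH -monM; congr mon; apply: cm_eqP => v.
by rewrite cmM !expcmnE mulSn.
Qed.

Definition extend_tableau (N : nat) (l w : seq nat) (T : seq (seq nat)) :
    seq (seq nat) :=
  mkseq (fun i => nth [::] T i ++ nseq (nth 0%N l i - nth 0%N w i) N) N.+1.

(** The same recursion as [schur_poly]: deleting the largest possible entry from a tableau of shape
    [l] leaves a tableau whose shape interlaces [l]. *)
Fixpoint tableaux (N : nat) (l : seq nat) : seq (seq (seq nat)) :=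
  if N is N'.+1 then
    [seq extend_tableau N' l w T | w <- interlace l, T <- tableaux N' w]
  else [:: [::]].

Lemma size_interlace (l w : seq nat) : w \in interlace l -> size l = (size w).+1.
Proof. by rewrite mem_interlace => /andP[/eqP]. Qed.

Lemma schur_poly_tableaux (R : comNzRingType) (x : nat -> R) (N : nat)
    (l : seq nat) : size l = N ->
  schur_poly x N l = \sum_(T <- tableaux N l) \prod_(j <- flatten T) x j.
Proof.
elim: N l => [|N IH] l sl; first by rewrite /= big_seq1 big_nil.
rewrite [LHS]/= big_allpairs_dep !big_seq; apply: eq_bigr => w wl.
have sw : size w = N by apply: succn_inj; rewrite -(size_interlace wl).
rewrite IH // mulr_sumr !big_seq; apply: eq_bigr => T hT.
have sT : size T = N.
  by case: (N) hT => [|N'] /=; [rewrite inE => /eqP ->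
    | case/allpairsPdep => [? [? [_ _ ->]]]; rewrite size_mkseq].
rewrite [RHS]big_flatten [RHS]big_map -/(index_iota 0 N.+1) big_mkord.
under [RHS]eq_bigr => i _ do rewrite /= big_cat big_nseq iter_mulr_1.
rewrite big_split /= big_ord_recr /= nth_default ?sT // big_nil mulr1 mulrC.
congr (_ * _).
  rewrite big_flatten (big_nth [::]) sT big_mkord; exact: eq_bigr.
rewrite prodrXr; congr (_ ^+ _).
rewrite (sumnB_nth sl sw); last first.
  move=> i; move: wl; rewrite mem_interlace => /andP[_ /allP /(_ i)].
  by rewrite mem_iota sw ltn_ord => /(_ isT) /andP[].
by rewrite big_ord_recr /= [nth 0%N w N]nth_default ?sw // subn0 addnC.
Qed.

Lemma ssyt_rowE (l : seq nat) (T : seq (seq nat)) (i : nat) :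
  ssyt l T -> size (nth [::] T i) = nth 0%N l i.
Proof.
move=> [<- _ _]; have [h|h] := ltnP i (size T); first by rewrite (nth_map [::]).
by rewrite !nth_default ?size_map.
Qed.

Lemma ssyt_row_sorted (l : seq nat) (T : seq (seq nat)) (i : nat) :
  ssyt l T -> sorted leq (nth [::] T i).
Proof.
move=> [_ h _]; have [hi|hi] := ltnP i (size T); first by apply/h/mem_nth.
by rewrite nth_default.
Qed.

Lemma ssyt_col (l : seq nat) (T : seq (seq nat)) (i j : nat) :
  ssyt l T -> (j < nth 0 l i.+1)%N ->
  (nth 0 (nth [::] T i) j < nth 0 (nth [::] T i.+1) j)%N.
Proof.
move=> hT; rewrite -(ssyt_rowE _ hT) => hj; case: hT => _ _; apply=> //.
by rewrite ltnNge; apply/negP => h; rewrite nth_default in hj.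
Qed.

(** Columns strictly increase downwards and entries start from 0. *)
Lemma ssyt_row_ge (l : seq nat) (T : seq (seq nat)) (i j : nat) :
  sorted geq l -> ssyt l T -> (j < nth 0 l i)%N ->
  (i <= nth 0 (nth [::] T i) j)%N.
Proof.
move=> ls hT; have lP := partition_nonincr ls.
elim: i => // i IH h; apply: leq_ltn_trans (ssyt_col hT h).
by apply: IH; apply: leq_trans h (lP _ _ _).
Qed.

Lemma ssytP (l : seq nat) (T : seq (seq nat)) :
  size T = size l -> (forall i, size (nth [::] T i) = nth 0%N l i) ->
  (forall i, sorted leq (nth [::] T i)) ->
  (forall i j, (j < nth 0 l i.+1)%N ->
     (nth 0 (nth [::] T i) j < nth 0 (nth [::] T i.+1) j)%N) -> ssyt l T.
Proof.
move=> sT sr srt col; split.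
- apply: (@eq_from_nth _ 0%N); rewrite size_map // => i h.
  by rewrite (nth_map [::]).
- by move=> row /(nthP [::])[i _ <-].
- by move=> i j _; rewrite sr; apply: col.
Qed.

Lemma nth_nseq_cat (s : seq nat) (n N j : nat) :
  nth 0%N (s ++ nseq n N) j =
  if (j < size s)%N then nth 0%N s j else if (j < size s + n)%N then N else 0%N.
Proof.
rewrite nth_cat nth_nseq; case: ifP => // h; case: ifP => h'; case: ifP => //; lia.
Qed.

Lemma sorted_leq_split (N : nat) (s : seq nat) : sorted leq s ->
  all (fun a => a < N.+1)%N s ->
  s = filter (fun a => a < N)%N s ++
      nseq (size s - size (filter (fun a => a < N)%N s)) N.
Proof.
elim: s => //= a s IH pa /andP[aN sN].
have ss := path_sorted pa; case: ltnP => h /=; first by rewrite subSS -IH.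
have e : s = nseq (size s) N.
  apply/all_pred1P; apply/allP => b bs /=; have := allP sN b bs.
  by have := pa; rewrite (path_sortedE leq_trans) => /andP[/allP /(_ b bs)]; lia.
have -> : [seq x <- s | (x < N)%N] = [::].
  by apply/eqP; rewrite -(negbK (_ == _)) -has_filter e has_nseq ltnn andbF.
by rewrite /= -e; congr (_ :: _); lia.
Qed.

(** Interlacing shapes are those that differ by a horizontal strip, and the boxes holding the
    largest entry of a semistandard tableau form such a strip. *)
Lemma mem_tableaux (N : nat) (l : seq nat) (T : seq (seq nat)) :
  sorted geq l -> size l = N ->
  T \in tableaux N l <->
  ssyt l T /\ forall row, row \in T -> all (fun a => a < N)%N row.
Proof.
elim: N l T => [|N IH] l T ls sl.
  case: l ls sl => // _ _; rewrite inE; split.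
    by move=> /eqP ->; split=> //; apply: ssytP => // i; rewrite !nth_nil.
  by move=> [[]]; case: T.
have lP := partition_nonincr ls.
split.
- move=> /allpairsPdep[w [U [wl hU eT]]].
  have sw : size w = N by apply: succn_inj; rewrite -sl (size_interlace wl).
  have [UP UN] := (IH w U (interlace_sorted wl) sw).1 hU.
  have rT i : nth [::] T i =
      nth [::] U i ++ nseq (nth 0%N l i - nth 0%N w i) N.
    have [iN|iN] := ltnP i N.+1; first by rewrite eT nth_mkseq.
    have sU : size U = N by case: UP => eU _ _; rewrite -sw -eU size_map.
    by rewrite eT ![nth _ _ i]nth_default ?size_mkseq ?sl ?sU ?sw ?(ltnW iN).
  have wP i : (nth 0 w i <= nth 0 l i)%N /\ ((i < N)%N -> (nth 0 l i.+1 <= nth 0 w i)%N).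
    have [iN|iN] := ltnP i N; last by rewrite [nth _ w i]nth_default ?sw.
    move: wl; rewrite mem_interlace => /andP[_ /allP /(_ i)].
    by rewrite mem_iota sw iN => /(_ isT) /andP[].
  have Ulast i a : a \in nth [::] U i -> (a < N)%N.
    have [iU|iU] := ltnP i (size U); last by rewrite nth_default.
    exact: allP (UN _ (mem_nth [::] iU)) a.
  split; last first.
    move=> row /(nthP [::])[i _ <-]; rewrite rT all_cat; apply/andP; split.
      by apply/allP => a /Ulast; lia.
    by apply/allP => a /nseqP[-> _].
  apply: ssytP => [|i|i|i j hj].
  + by rewrite eT size_mkseq sl.
  + by rewrite rT size_cat size_nseq (ssyt_rowE _ UP) subnKC //; case: (wP i).
  + rewrite rT; apply/(sortedP 0%N) => j; rewrite size_cat size_nseq => hj.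
    have := ssyt_row_sorted i UP => /(sortedP 0%N) /(_ j).
    rewrite !nth_nseq_cat hj (ltnW hj).
    case: (ltnP j.+1) => h1; first by rewrite (ltnW h1); apply.
    case: (ltnP j) => // h2 _; apply: ltnW; apply: (Ulast i); exact: mem_nth.
  + have iN : (i < N)%N.
      by rewrite ltnNge; apply/negP => h; rewrite nth_default // sl in hj.
    have [_ /(_ iN) h1] := wP i; have [h2 _] := wP i.+1.
    rewrite !rT !nth_nseq_cat !(ssyt_rowE _ UP).
    (* Interlacing, in the form l_(i+1) <= w_i, puts the box above into the old part of its row; an
       entry [N] in row [i.+1] thus lies below an entry smaller than [N]. *)
    have -> : (j < nth 0 w i)%N by lia.
    case: (ltnP j (nth 0%N w i.+1)) => h3; first exact: (ssyt_col UP h3).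
    have -> : (j < nth 0 w i.+1 + (nth 0 l i.+1 - nth 0 w i.+1))%N by lia.
    by apply: (Ulast i); apply: mem_nth; rewrite (ssyt_rowE _ UP); lia.
- move=> [TP TN].
  pose fl := filter (fun a : nat => (a < N)%N).
  pose U := mkseq (fun i => fl (nth [::] T i)) N.
  pose w := mkseq (fun i => size (fl (nth [::] T i))) N.
  have TNi i : all (fun a => a < N.+1)%N (nth [::] T i).
    have [h|h] := ltnP i (size T); first by apply/TN/mem_nth.
    by rewrite nth_default.
  have spl i : nth [::] T i = fl (nth [::] T i) ++
      nseq (size (nth [::] T i) - size (fl (nth [::] T i))) N.
    exact: sorted_leq_split (ssyt_row_sorted i TP) (TNi i).
  (* The entries of row [N] are at least [N], so the truncated tableau needs only [N] rows. *)
  have last0 : fl (nth [::] T N) = [::].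
    apply/eqP; rewrite -(negbK (_ == _)) -has_filter; apply/hasPn => a.
    move=> /(nthP 0%N)[j]; rewrite (ssyt_rowE _ TP) => hj <-.
    by rewrite -leqNgt; apply: (ssyt_row_ge ls TP hj).
  have eU i : nth [::] U i = fl (nth [::] T i) /\ nth 0%N w i = size (fl (nth [::] T i)).
    have [iN|iN] := ltnP i N; first by rewrite !nth_mkseq.
    rewrite [nth _ U i]nth_default ?size_mkseq // [nth _ w i]nth_default ?size_mkseq //.
    have [<-|ne] := eqVneq N i; first by rewrite last0.
    rewrite [nth _ T i]nth_default //.
    by case: TP => eT _ _; rewrite -(size_map size) eT sl; lia.
  have flj i j : (j < size (fl (nth [::] T i)))%N ->
      nth 0%N (fl (nth [::] T i)) j = nth 0%N (nth [::] T i) j.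
    by move=> h; rewrite [in RHS](spl i) nth_nseq_cat h.
  have sfl i : (size (fl (nth [::] T i)) <= nth 0 l i)%N.
    by rewrite -(ssyt_rowE i TP) size_filter count_size.
  have wl : w \in interlace l.
    rewrite mem_interlace size_mkseq sl eqxx; apply/allP => i.
    rewrite mem_iota => /andP[_ iN]; rewrite (eU i).2 sfl andbT leqNgt.
    (* Otherwise the first entry [N] of row [i] would have a box below it, whose entry would have to
       exceed [N]. *)
    apply/negP => h; have := ssyt_col TP h.
    have -> : nth 0%N (nth [::] T i) (size (fl (nth [::] T i))) = N.
      rewrite {1}spl nth_nseq_cat -/(fl _) ltnn subnKC ?(ssyt_rowE _ TP) ?sfl //.
      by rewrite (leq_trans h) // lP.
    have : nth 0%N (nth [::] T i.+1) (size (fl (nth [::] T i))) \in nth [::] T i.+1.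
      by apply: mem_nth; rewrite (ssyt_rowE _ TP).
    by move=> /(allP (TNi i.+1)) /=; lia.
  apply/allpairsPdep; exists w, U; split=> //.
    apply/IH; rewrite ?size_mkseq ?(interlace_sorted wl) //; split.
      apply: ssytP => [|i|i|i j].
      + by rewrite !size_mkseq.
      + by rewrite (eU i).1 (eU i).2.
      + rewrite (eU i).1; apply: sorted_filter (ssyt_row_sorted i TP); exact: leq_trans.
      + rewrite (eU i.+1).2 (eU i.+1).1 (eU i).1 => hj.
        have hj' : (j < nth 0 l i.+1)%N by apply: leq_trans hj (sfl _).
        have lt := ssyt_col TP hj'; rewrite (flj i.+1) //.
        rewrite [in ltnLHS](spl i) nth_nseq_cat in lt.
        case: (ltnP j (size (fl (nth [::] T i)))) lt => // h.
        case: ifP => _ lt.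
          have := mem_nth 0%N hj;
            rewrite (flj i.+1) // -(flj i.+1) // /fl mem_filter -/(fl _) (flj i.+1) // => /andP[/= lt' _].
          by have := ltn_trans lt lt'; rewrite ltnn.
        by rewrite [nth _ (fl _) j]nth_default.
    move=> row /(nthP [::])[i _ <-]; rewrite (eU i).1; exact: filter_all.
  apply: (@eq_from_nth _ [::]); rewrite /extend_tableau ?size_mkseq.
    by case: TP => eT _ _; rewrite -(size_map size) eT sl.
  move=> i hi; rewrite nth_mkseq; last first.
    by case: TP => eT _ _; rewrite -sl -eT size_map.
  by rewrite {1}spl (eU i).1 (eU i).2 (ssyt_rowE _ TP).
Qed.

(** * The Pieri rule for dual polyribbons *)

Lemma uniq_interlace (l : seq nat) : uniq (interlace l).
Proof.
elim: l => //= a [|b l] IH //; apply: allpairs_uniq => //; first exact: iota_uniq.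
by move=> [? ?] [? ?] _ _ [-> ->].
Qed.

Lemma filter_extend_row (N n : nat) (s : seq nat) : all (fun a => a < N)%N s ->
  filter (fun a => a < N)%N (s ++ nseq n N) = s.
Proof.
move=> sN; rewrite filter_cat (all_filterP sN) filter_nseq ltnn /= cats0 //.
Qed.

Lemma uniq_tableaux (N : nat) (l : seq nat) :
  sorted geq l -> size l = N -> uniq (tableaux N l).
Proof.
elim: N l => // N IH l ls sl; rewrite [tableaux _ _]/=.
apply: allpairs_uniq_dep; first exact: uniq_interlace.
  move=> w wl; apply: IH; first exact: interlace_sorted wl.
  by apply: succn_inj; rewrite -(size_interlace wl).
move=> p q /allpairsPdep[w [T [wl hT ->]]] /allpairsPdep[w' [T' [wl' hT' ->]]] /= e.
(* Deleting the entries [N] from the first [N] rows undoes [extend_tableau]. *)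
have key w0 T0 : w0 \in interlace l -> T0 \in tableaux N w0 ->
   T0 = [seq filter (fun a => a < N)%N row | row <- take N (extend_tableau N l w0 T0)]
   /\ w0 = map size T0.
  move=> hw hU; have sw : size w0 = N.
    by apply: succn_inj; rewrite -(size_interlace hw).
  have [hS hN] := (mem_tableaux T0 (interlace_sorted hw) sw).1 hU.
  have eS : map size T0 = w0 by case: hS.
  have sT : size T0 = N by rewrite -(size_map size) eS.
  split=> //; apply: (@eq_from_nth _ [::]).
    by rewrite size_map size_take size_mkseq ltnSn.
  move=> i iT; have iN : (i < N)%N by rewrite -sT.
  rewrite (nth_map [::]) ?size_take ?size_mkseq ?ltnSn // nth_take //.
  rewrite nth_mkseq; last exact: ltnW.
  by rewrite filter_extend_row //; apply/hN/mem_nth.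
have [e1 e2] := key _ _ wl hT; have [e1' e2'] := key _ _ wl' hT'.
have eT : T = T' by rewrite e1 e1' e.
by have ew : w = w' by [rewrite e2 e2' eT]; rewrite ew eT.
Qed.

(** Determinants and [schur_poly] require exactly [N] rows, whereas partitions carry no zeros. *)
Definition pad (N : nat) (l : seq nat) : seq nat := l ++ nseq (N - size l) 0%N.

Lemma nth_pad (N : nat) (l : seq nat) : nth 0%N (pad N l) =1 nth 0%N l.
Proof.
move=> i; rewrite nth_cat nth_nseq; case: ltnP => // h.
by rewrite nth_default //; case: ifP.
Qed.

Lemma size_pad (N : nat) (l : seq nat) : (size l <= N)%N -> size (pad N l) = N.
Proof. by move=> h; rewrite size_cat size_nseq subnKC. Qed.

Lemma pad_sorted (N : nat) (l : seq nat) : sorted geq l -> sorted geq (pad N l).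
Proof.
move=> ls; apply/(sortedP 0%N) => i _; rewrite !nth_pad.
exact: partition_nonincr ls _ _ (leqnSn i).
Qed.

Lemma tab_monomialE (k : nat) (T : seq (seq nat)) (v : var) :
  tab_monomial k.+1 T v = count (fun j => (k, j) == v) (flatten T).
Proof.
rewrite /tab_monomial cm_prodE -sum1_count [RHS]big_mkcond /=.
by apply: eq_bigr => j _; rewrite cmU; case: eqP.
Qed.

Lemma flatten_nseq_nil (T : Type) (n : nat) :
  flatten (nseq n [::]) = [::] :> seq T.
Proof. by elim: n. Qed.

Lemma ssyt_pad (N : nat) (l : seq nat) (T : seq (seq nat)) :
  is_partition l -> (size l <= N)%N ->
  ssyt l T -> ssyt (pad N l) (T ++ nseq (N - size l) [::]).
Proof.
move=> pl lN hT; have sT : size T = size l by case: hT => <- _ _; rewrite size_map.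
have eT i : nth [::] (T ++ nseq (N - size l) [::]) i = nth [::] T i.
  rewrite nth_cat nth_nseq; case: ltnP => // h.
  by rewrite nth_default //; case: ifP.
apply: ssytP => [|i|i|i j]; rewrite ?eT ?nth_pad.
- by rewrite !size_cat !size_nseq sT.
- exact: ssyt_rowE.
- exact: ssyt_row_sorted hT.
- exact: ssyt_col.
Qed.

Lemma ssyt_unpad (N : nat) (l : seq nat) (T : seq (seq nat)) :
  (size l <= N)%N -> ssyt (pad N l) T ->
  ssyt l (take (size l) T) /\
  T = take (size l) T ++ nseq (N - size l) [::].
Proof.
move=> lN hT; have sT : size T = N.
  by case: hT => eT _ _; rewrite -(size_map size) eT size_pad.
have st : size (take (size l) T) = size l by rewrite size_take sT; case: ltngtP lN.
have eT : T = take (size l) T ++ nseq (N - size l) [::].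
  rewrite -[LHS](cat_take_drop (size l)); congr (_ ++ _).
  have : size (drop (size l) T) = (N - size l)%N by rewrite size_drop sT.
  move=> <-; apply/all_pred1P/allP => row /(nthP [::])[i].
  rewrite size_drop nth_drop => hi <- /=; rewrite -size_eq0 (ssyt_rowE _ hT).
  by rewrite nth_pad nth_default //; lia.
split=> //.
have en i : nth [::] (take (size l) T) i = nth [::] T i.
  rewrite [in RHS]eT nth_cat nth_nseq; case: ltnP => // h.
  by rewrite nth_default //; case: ifP.
apply: ssytP => // [i|i|i j]; rewrite !en.
- by rewrite (ssyt_rowE _ hT) nth_pad.
- exact: ssyt_row_sorted hT.
- by rewrite -(nth_pad N) => /(ssyt_col hT).
Qed.

(** A tableau whose monomial involves only variables of second index below [N] has all its entries
    below [N], so the infinite family of tableaux meets the finite list [tableaux]; padding adds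
    only empty rows. *)
Lemma schur_upto (k N : nat) (l : seq nat) : is_partition l ->
  (size l <= N)%N ->
  eq_upto N (schur k.+1 l) (schur_poly (xvar k) N (pad N l)).
Proof.
move=> pl lN m hm; have ls : sorted geq l by case/andP: pl.
have ps := pad_sorted N ls; have sp := size_pad lN.
rewrite schur_poly_tableaux // sumE.
transitivity (\sum_(T <- tableaux N (pad N l)) (m == tab_monomial k.+1 T)%:R :
  rat); last first.
  by apply: eq_bigr => T _; rewrite -mon_prod.
pose s := [seq T <- tableaux N (pad N l) | m == tab_monomial k.+1 T].
have us : uniq s by rewrite filter_uniq ?uniq_tableaux.
have sP T : T \in s -> m = tab_monomial k.+1 T /\ ssyt (pad N l) T.
  rewrite mem_filter => /andP[/eqP ->] /(mem_tableaux _ ps sp)[]; by split.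
rewrite /schur (@fsbig_list _ [seq take (size l) T | T <- s]).
- rewrite big_map big_filter big_mkcond; apply: eq_bigr => T _.
  by case: ifP.
- rewrite map_inj_in_uniq // => T T' /sP[_ hT] /sP[_ hT'] e.
  by rewrite (ssyt_unpad lN hT).2 (ssyt_unpad lN hT').2 e.
- move=> U; split=> [/mapP[T /sP[-> hT] ->] /=|[hU eU]].
    have [h e] := ssyt_unpad lN hT; split=> //.
    by rewrite [in RHS]e /tab_monomial flatten_cat flatten_nseq_nil cats0.
  have sU : size U = size l by case: hU => <- _ _; rewrite size_map.
  apply/mapP; exists (U ++ nseq (N - size l) [::]); last by rewrite take_size_cat.
  rewrite mem_filter; apply/andP; split.
    by rewrite -eU /tab_monomial flatten_cat flatten_nseq_nil cats0.
  apply/mem_tableaux => //; split; first exact: ssyt_pad.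
  move=> row; rewrite mem_cat => /orP[hr|/nseqP[-> _] //].
  apply/allP => a ar; apply: (hm (k, a)); rewrite -eU tab_monomialE -lt0n -has_count.
  by apply/hasP; exists a => //; apply/flattenP; exists row.
Qed.

(* e_c(x_{k+1,1}^r, x_{k+1,2}^r, ...) *)
Definition elem_pow_series (k r c : nat) : series := fun m =>
  if all (fun v => (m v == r) && (v.1 == k)) (finsupp m) &&
     (#|` finsupp m| == c) then 1 else 0.

Definition set_monomial (k N : nat) (S : {set 'I_N}) : monomial :=
  \big[mmul/mone]_(j in S) ucm ((k, val j) : var).

Lemma set_monomialE (k N : nat) (S : {set 'I_N}) (v : var) :
  set_monomial k S v = (v.1 == k) && (v.2 \in rows_of S) :> nat.
Proof.
rewrite /set_monomial cm_prodE; case: v => a b /=.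
under eq_bigr do rewrite cmU xpair_eqE eq_sym.
case: eqP => [_|_] /=; last by rewrite big1.
case: (boolP (b \in rows_of S)) => [/mapP[j]|nb].
  rewrite mem_enum => jS ->; rewrite (bigD1 j) //= eqxx big1 //.
  by move=> i /andP[_ ij]; rewrite (inj_eq val_inj) (negbTE ij).
rewrite big1 // => j jS; case: eqP => // e; case/negP: nb.
by rewrite -e; apply/mapP; exists j; rewrite ?mem_enum.
Qed.

Lemma finsupp_set_monomial (k N : nat) (S : {set 'I_N}) :
  perm_eq (finsupp (set_monomial k S)) [seq (k, j) | j <- rows_of S].
Proof.
apply: uniq_perm; rewrite ?fset_uniq //.
  rewrite map_inj_uniq; last by move=> ? ? [].
  exact: (sorted_uniq ltn_trans ltnn (rows_of_sorted S)).
move=> v; rewrite -cmE_neq0 set_monomialE eqb0 negbK.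
apply/andP/mapP => [[/eqP e h]|[j h ->]] /=; last by rewrite eqxx.
by exists v.2 => //; case: v e h => a b /= ->.
Qed.

(** A monomial arises from at most one set of variables, namely its support. *)
Lemma elem_pow_upto (k N r c : nat) : (0 < r)%N ->
  eq_upto N (elem_pow_series k r c) (elem_pow (xvar k) N r c).
Proof.
move=> r0 m hm; rewrite /elem_pow sumE.
transitivity (\sum_(S : {set 'I_N} | #|S| == c)
   (m == expcmn (set_monomial k S) r)%:R : rat); last first.
  apply: eq_bigr => S _; rewrite prodrXl.
  by rewrite -mon_prod -mon_exp.
have supp (S : {set 'I_N}) : m = expcmn (set_monomial k S) r ->
    finsupp m = finsupp (set_monomial k S).
  move=> ->; apply/fsetP => v.
  by rewrite -!cmE_neq0 expcmnE muln_eq0 negb_or -lt0n r0.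
rewrite /elem_pow_series; case: ifPn => [/andP[/allP hall /eqP cm]|nm]; last first.
  rewrite big1 // => S /eqP cS; case: eqP => // e; case/negP: nm.
  rewrite (supp S e) (perm_size (finsupp_set_monomial k S)) size_map size_rows_of.
  rewrite cS eqxx andbT; apply/allP => v; rewrite -cmE_neq0 set_monomialE.
  rewrite eqb0 negbK => h; case/andP: (h) => -> _.
  by rewrite e expcmnE set_monomialE h muln1 eqxx.
pose S := [set j : 'I_N | m (k, val j) != 0%N]%SET.
have eS : m = expcmn (set_monomial k S) r.
  apply: cm_eqP => v; rewrite expcmnE set_monomialE.
  have [v0|nv] := eqVneq (m v) 0%N.
    rewrite v0; case: andP => [[/eqP vk /mapP[j]]|]; last by rewrite muln0.
    rewrite mem_enum inE => jS vj; case/eqP: jS.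
    by rewrite -vj -vk -surjective_pairing.
  have [/eqP -> /eqP vk] : (m v == r) /\ (v.1 == k).
    by apply/andP/hall; rewrite -cmE_neq0.
  rewrite vk eqxx /=; suff -> : v.2 \in rows_of S by rewrite muln1.
  apply/mapP; exists (Ordinal (hm _ nv)) => //.
  by rewrite mem_enum inE /= -vk -surjective_pairing.
have cS : #|S| = c.
  rewrite -cm (supp S eS) (perm_size (finsupp_set_monomial k S)).
  by rewrite size_map size_rows_of.
rewrite (bigD1 S) /= ?cS // -eS eqxx big1 ?addr0 // => S' /andP[_ SS'].
case: eqP => // e; case/eqP: SS'; apply: rows_of_inj.
have e' : set_monomial k S' = set_monomial k S.
  by apply: (expcmn_inj r0); rewrite -eS.
apply: (irr_sorted_eq ltn_trans ltnn) => [||j]; try exact: rows_of_sorted.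
have := congr1 (fun b : monomial => b (k, j)) e'.
by rewrite !set_monomialE /= eqxx; case: (_ \in _); case: (_ \in _).
Qed.

Lemma size_le_sumn (l : seq nat) : 0%N \notin l -> (size l <= sumn l)%N.
Proof.
elim: l => //= a l IH; rewrite inE negb_or => /andP[a0 /IH h]; lia.
Qed.

Lemma signE (n : nat) (f : series) (m : monomial) :
  ((-1) ^+ n * f) m = (-1) ^+ n * f m.
Proof.
elim: n f => [|n IH] f; first by rewrite !expr0 !mul1r.
by rewrite !exprSr -!mulrA IH !mulN1r oppE.
Qed.

(** The identity is checked one coefficient at a time, in a number of variables depending on the
    monomial. The bound [B] makes the index list [P] finite while it still contains every shape that
    can occur. *)
Lemma pieri_series (k r c B : nat) (mu : seq nat) (P : seq (seq nat)) :
  (0 < r)%N -> is_partition mu -> (sumn mu + r * c <= B)%N -> uniq P ->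
  (forall nu, nu \in P <-> is_partition nu /\ (sumn nu <= B)%N) ->
  forall m, (schur k.+1 mu * elem_pow_series k r c) m =
    \sum_(nu <- P) pieri_coef r c mu nu * schur k.+1 nu m.
Proof.
move=> r0 pmu hB uP hP m.
(* [B] bounds the number of rows of every shape in [P], [size mu] makes room for [mu], and the
   maximum covers the variables of [m]. *)
pose N := (B + size mu + \max_(v <- finsupp m) v.2.+1)%N.
have hm v : m v != 0%N -> (v.2 < N)%N.
  rewrite cmE_neq0 => hv; apply: (@leq_trans (\max_(v <- finsupp m) v.2.+1)).
    exact: (@leq_bigmax_seq _ _ xpredT (fun v : var => v.2.+1) v hv isT).
  exact: leq_addl.
have muN : (size mu <= N)%N by rewrite /N; lia.
have mus : sorted geq mu by case/andP: pmu.
have muP := partition_nonincr mus.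
have szP nu : nu \in P -> is_partition nu /\ (size nu <= N)%N.
  move=> /hP[pnu sn]; split=> //; case/andP: pnu => _ /size_le_sumn h.
  by rewrite /N -addnA (leq_trans h) // (leq_trans sn) // leq_addr.
rewrite (eq_upto_mul (schur_upto k pmu muN) (elem_pow_upto k c r0) hm).
rewrite schur_poly_elem_pow ?size_pad ?pad_sorted //; last first.
  exact: vandermonde_regular.
have -> : nth 0%N (pad N mu) = nth 0%N mu by apply/funext/nth_pad.
rewrite sumE [RHS]big_seq.
under [RHS]eq_bigr => nu /szP[pnu nuN].
  rewrite (pieri_coefE _ r0 pmu pnu nuN) mulr_suml.
over.
rewrite -big_seq exchange_big /=; apply: eq_bigr => S /eqP cS.
case: (boolP (all_movable _ _ _)) => mv; last first.
  by rewrite big1 // => nu _; rewrite mul0r.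
set F := add_ribbons r (rows_of S) (nth 0%N mu).
have FP : nonincr F := add_ribbons_nonincr r0 muP mv.
(* Only rows of index less than [N] receive ribbons as lowest rows, and row [N] of [mu] is empty. *)
have FN : F N = 0%N.
  rewrite /F add_ribbons_above // ?nth_default // => i.
  by move=> /(allP (rows_of_lt S)).
have eF : nth 0%N (to_partition N F) = F by apply/funext/nth_to_partition.
have pF := to_partitionP N FP.
have hF : to_partition N F \in P.
  apply/hP; split=> //.
  have [g ch sg] := rows_polyribbon_chain r0 pmu pF (rows_of_sorted S) mv
    (fun i => congr1 (@^~ i) eF).
  have -> : sumn (to_partition N F) = (sumn mu + r * c)%N; last by [].
  by apply: is_dual_polyribbon_sumn; exists g; rewrite sg size_rows_of cS.
have [_ sF] := szP _ hF.
rewrite (bigD1_seq (to_partition N F)) //= eF asboolT // [X in _ + X]big1_seq ?addr0; last first.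
  move=> nu /andP[nF /szP[pnu _]]; case: asboolP => [e|]; last by rewrite mul0r.
  case/eqP: nF; apply: partition_eq => // i; by rewrite e eF.
rewrite signE; congr (_ * _); rewrite (schur_upto k pF sF hm).
suff -> : mkseq F N = pad N (to_partition N F) by [].
apply: (@eq_from_nth _ 0%N).
  by rewrite size_mkseq size_pad.
by move=> i; rewrite size_mkseq => iN; rewrite nth_mkseq // nth_pad eF.
Qed.

(** * Products over the degrees *)

Definition mfilter (p : pred nat) (m : monomial) : monomial :=
  [cmonom (if p v.1 then m v else 0)%N | v in finsupp m]%M.

Lemma mfilterE (p : pred nat) (m : monomial) (v : var) :
  mfilter p m v = (if p v.1 then m v else 0)%N.
Proof.
rewrite /mfilter cmE fsfun_fun; case: ifPn => // h.
by have := cmE_eq0 m v; rewrite h => /eqP ->; case: ifP.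
Qed.

Definition concentrated (k : nat) (f : series) : Prop :=
  forall m : monomial, f m != 0 -> forall v, m v != 0%N -> v.1 = k.

Lemma mul_single (f g : series) (a b : monomial) :
  (forall a' b', mmul a' b' = mmul a b -> f a' != 0 -> g b' != 0 -> a' = a) ->
  (f * g) (mmul a b) = f a * g b.
Proof.
move=> h; rewrite mulE.
have aD : a \in divisors_of (mmul a b).
  by rewrite mem_divisors_of; apply/asboolP; exists b.
have bD : b \in divisors_of (mmul a b).
  by rewrite mem_divisors_of; apply/asboolP; exists a; rewrite mulmC.
rewrite (bigD1_seq a) ?uniq_divisors_of //= [X in _ + X]big1 ?addr0; last first.
  move=> a' aa; rewrite big1 // => b' _; case: eqP => // e; rewrite mulr1n.
  apply/eqP; rewrite mulf_eq0; apply/contraR: aa; rewrite negb_or => /andP[fa gb].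
  by apply/eqP; apply: h e fa gb.
rewrite (bigD1_seq b) ?uniq_divisors_of //= [X in _ + X]big1 ?addr0 ?eqxx //.
by move=> c cb; case: eqP => // /cm_mulIl e; rewrite e eqxx in cb.
Qed.

Lemma mul_none (f g : series) (m : monomial) :
  (forall a b, mmul a b = m -> f a != 0 -> g b != 0 -> False) -> (f * g) m = 0.
Proof.
move=> h; rewrite mulE big1 // => a _; rewrite big1 // => b _.
case: eqP => // e; rewrite mulr1n; apply/eqP; rewrite mulf_eq0; apply/negPn.
by rewrite negb_or; apply/negP => /andP[fa gb]; apply: h e fa gb.
Qed.

(** The factors use disjoint sets of variables, so a monomial splits among them in only one way and
    the convolution collapses to a single term. *)
Lemma prod_concentrated (K : nat) (f : nat -> series) :
  (forall k, concentrated k (f k)) -> forall m : monomial,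
  (\prod_(k < K) f k) m =
  if all (fun v => v.1 < K)%N (finsupp m) then
    \prod_(k < K) f k (mfilter (fun i => i == k) m)
  else 0.
Proof.
move=> fc; elim: K => [|K IH] m.
  rewrite !big_ord0; transitivity (sone m) => //; rewrite /sone.
  case: (eqVneq m mone) => [->|m1].
    by rewrite ifT //; apply/allP => v; rewrite -cmE_neq0 cm1.
  case: ifP => // /allP h; case/eqP: m1; apply: cm_eqP => v; rewrite cm1.
  by apply/eqP; rewrite cmE_eq0; apply/negP => /h.
have IH0 a : (\prod_(k < K) f k) a != 0 -> forall v, a v != 0%N -> (v.1 < K)%N.
  rewrite IH; case: ifP => [/allP h _ v|]; last by rewrite eqxx.
  by rewrite cmE_neq0; apply: h.
rewrite big_ord_recr /=; case: ifPn => [/allP h|/allPn[v hv nv]]; last first.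
  apply: mul_none => a b e /IH0 ha /(fc K) hb; case/negP: nv.
  move: hv; rewrite -cmE_neq0 -e cmM addn_eq0 negb_and => /orP[/ha|/hb ->//].
  exact: ltnW.
pose a := mfilter (fun i => i < K)%N m; pose b := mfilter (fun i => i == K) m.
have em : m = mmul a b.
  apply: cm_eqP => v; rewrite cmM !mfilterE /=.
  have [mv|mv] := eqVneq (m v) 0%N; first by rewrite mv !if_same.
  have := h v; rewrite -cmE_neq0 ltnS leq_eqVlt => /(_ mv).
  by case: ltngtP => //= _ _; rewrite ?addn0 ?add0n.
rewrite {1}em mul_single; last first.
  move=> a' b'; rewrite -em => e /IH0 ha /(fc K) hb; apply: cm_eqP => v.
  rewrite mfilterE -e cmM; case: ltnP => hv.
    have [->|/hb e'] := eqVneq (b' v) 0%N; first by rewrite addn0.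
    by rewrite e' ltnn in hv.
  have [//|/ha e'] := eqVneq (a' v) 0%N; by rewrite ltnNge hv in e'.
rewrite big_ord_recr /= IH ifT.
  congr (_ * _); apply: eq_bigr => k _; congr (f k _); apply: cm_eqP => v.
  rewrite !mfilterE /=; case: eqP => // ->; by rewrite ltn_ord.
by apply/allP => v; rewrite -cmE_neq0 mfilterE; case: ifP.
Qed.

Lemma schur_concentrated (k : nat) (l : seq nat) : concentrated k (schur k.+1 l).
Proof.
move=> m nz v mv; apply/eqP; apply: contraR nz => vk.
rewrite /schur fsbig1 // => T [_ eT].
have := mv; rewrite -eT tab_monomialE -lt0n -has_count => /hasP[j _ /eqP e].
by rewrite -e eqxx in vk.
Qed.

Lemma elem_pow_series_concentrated (k r c : nat) :
  concentrated k (elem_pow_series k r c).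
Proof.
move=> m; rewrite /elem_pow_series; case: ifP; last by rewrite eqxx.
by move=> /andP[/allP h _] _ v; rewrite cmE_neq0 => /h /andP[_ /eqP].
Qed.

Definition scal (q : rat) (f : series) : series := fun m => q * f m.

Lemma scalM (p q : rat) (f g : series) : scal p f * scal q g = scal (p * q) (f * g).
Proof.
apply/funext => m; rewrite /scal mulE [in RHS]mulE mulr_sumr.
apply: eq_bigr => a _; rewrite mulr_sumr; apply: eq_bigr => b _.
by rewrite mulrnAr mulrACA.
Qed.

Lemma scal1 (f : series) : scal 1 f = f.
Proof. by apply/funext => m; rewrite /scal mul1r. Qed.

Lemma scalA (p q : rat) (f : series) : scal p (scal q f) = scal (p * q) f.
Proof. by apply/funext => m; rewrite /scal mulrA. Qed.

Lemma scal_sumr (I : Type) (s : seq I) (P : pred I) (q : rat) (F : I -> series) :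
  scal q (\sum_(i <- s | P i) F i) = \sum_(i <- s | P i) scal q (F i).
Proof. by apply/funext => m; rewrite /scal !sumE mulr_sumr. Qed.

Lemma scal_suml (I : Type) (s : seq I) (P : pred I) (F : I -> rat) (f : series) :
  scal (\sum_(i <- s | P i) F i) f = \sum_(i <- s | P i) scal (F i) f.
Proof. by apply/funext => m; rewrite /scal !sumE mulr_suml. Qed.

Lemma scal_prod (I : Type) (s : seq I) (P : pred I) (q : I -> rat) (F : I -> series) :
  \prod_(i <- s | P i) scal (q i) (F i) =
  scal (\prod_(i <- s | P i) q i) (\prod_(i <- s | P i) F i).
Proof.
elim/big_rec3: _ => [|i a b c _ ->]; first by rewrite scal1.
by rewrite scalM.
Qed.

(* [Eplus_deg] and [E_deg] are the cases [s = 1] and [s = -1]. *)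
Definition signed_E_block (s : rat) (d r : nat) : series := fun m =>
  if all (fun v => m v == r) (finsupp m) &&
     (\sum_(v <- finsupp m) v.1.+1 == d)%N
  then s ^+ #|` finsupp m| else 0.

Definition signed_E_deg (s : rat) (d : nat) : series := fun m =>
  if squarefree m && (degree m == d) then s ^+ #|` finsupp m| else 0.

(** A monomial is the [r]-th power of a square-free one exactly when all its non-zero exponents
    equal [r], and the root is then unique. *)
Lemma powvars_signed_E_deg (s : rat) (d r : nat) : (0 < r)%N ->
  powvars r (signed_E_deg s d) = signed_E_block s d r.
Proof.
move=> r0; apply/funext => m; rewrite /powvars /signed_E_block.
have supp a : expcmn a r = m -> finsupp m = finsupp a.
  move=> <-; apply/fsetP => v.
  by rewrite -!cmE_neq0 expcmnE muln_eq0 negb_or -lt0n r0.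
have val a : expcmn a r = m -> signed_E_deg s d a = signed_E_block s d r m.
  move=> e; rewrite /signed_E_deg /signed_E_block (supp a e).
  have -> : squarefree a = all (fun v => m v == r) (finsupp a).
    apply: eq_in_all => v; rewrite -cmE_neq0 -e expcmnE => av.
    by rewrite -{2}[r]muln1 eqn_pmul2l //; lia.
  case: allP => //= h; rewrite /degree.
  suff -> : (\sum_(v <- finsupp a) v.1.+1 * a v = \sum_(v <- finsupp a) v.1.+1)%N by [].
  apply: eq_big_seq => v va; have := h v va; rewrite -e expcmnE.
  by rewrite -{2}[r]muln1 eqn_pmul2l // => /eqP ->; rewrite muln1.
case: (pselect (exists a, expcmn a r = m)) => [[a ea]|na].
  have -> : [set a | expcmn a r = m] = [set a].
    apply/seteqP; split=> b /=; last by move=> ->.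
    by move=> eb; apply: (expcmn_inj r0); rewrite ea.
  by rewrite fsbig_set1 val.
rewrite fsbig1; last by move=> a /= e; case: na; exists a.
case: ifP => // /andP[/allP h _]; case: na.
exists [cmonom 1%N | v in finsupp m]%M; apply: cm_eqP => v.
rewrite expcmnE cmE fsfun_fun; case: ifPn => hv; first by rewrite muln1 (eqP (h v hv)).
by have := cmE_eq0 m v; rewrite hv muln0 => /eqP ->.
Qed.

(** Monomials are grouped by the number [c k] of variables of degree [k.+1] in them. Such a vector
    of total degree [d] is the multiplicity vector of a partition of [d]; as a finite function it
    can later be exchanged with products over the degrees. *)
Lemma signed_E_block_expand (s : rat) (K d r : nat) : (0 < r)%N -> (d <= K)%N ->
  signed_E_block s d r =
  \sum_(c : {ffun 'I_K -> 'I_d.+1} | \sum_(k < K) k.+1 * c k == d)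
     scal (s ^+ (\sum_(k < K) c k)) (\prod_(k < K) elem_pow_series k r (c k)).
Proof.
move=> r0 dK; apply/funext => m; rewrite sumE /scal.
have prodm (c : {ffun 'I_K -> 'I_d.+1}) :
  (\prod_(k < K) elem_pow_series k r (c k)) m =
  if all (fun v => v.1 < K)%N (finsupp m) then
    \prod_(k < K) elem_pow_series k r (c k) (mfilter (fun i => i == k) m)
  else 0.
  (* [prod_concentrated] expects a family indexed by all naturals; the value 0 outside ['I_K] is
     only a filler. *)
  pose f (k : nat) : series := elem_pow_series k r
    (if (insub k : option 'I_K) is Some i then c i : nat else 0%N).
  have ef (k : 'I_K) : f k = elem_pow_series k r (c k) by rewrite /f valK.
  rewrite -(eq_bigr _ (fun k _ => ef k)) prod_concentrated; last first.
    by move=> k; apply: elem_pow_series_concentrated.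
  by case: ifP => // _; apply: eq_bigr => k _; rewrite ef.
under eq_bigr do rewrite prodm.
pose n (k : nat) := count (fun v : var => v.1 == k) (finsupp m).
have suppk k : perm_eq (finsupp (mfilter (fun i => i == k) m))
    (filter (fun v : var => v.1 == k) (finsupp m)).
  apply: uniq_perm; rewrite ?filter_uniq ?fset_uniq // => v.
  rewrite -cmE_neq0 mfilterE mem_filter /= -cmE_neq0.
  by case: (v.1 == k).
pose ok := all (fun v => m v == r) (finsupp m).
pose small := all (fun v => v.1 < K)%N (finsupp m).
have elemE (k : 'I_K) c : elem_pow_series k r c (mfilter (fun i => i == k) m) =
   if all (fun v => m v == r) (filter (fun v : var => v.1 == k) (finsupp m)) && (n k == c)
   then 1 else 0.
  rewrite /elem_pow_series (perm_size (suppk k)) size_filter -/(n k).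
  rewrite (perm_all _ (suppk k)).
  suff -> : all (fun v => (mfilter (fun i => i == k) m v == r) && (v.1 == k))
     (filter (fun v : var => v.1 == k) (finsupp m)) =
     all (fun v => m v == r) (filter (fun v : var => v.1 == k) (finsupp m)) by [].
  apply: eq_in_all => v; rewrite mem_filter mfilterE /= => /andP[-> _].
  by rewrite andbT.
have prodE (c : {ffun 'I_K -> 'I_d.+1}) :
  (if small then \prod_(k < K) elem_pow_series k r (c k)
       (mfilter (fun i => i == k) m) else 0) =
  if [&& small, ok & [forall k, n (val k) == c k]] then 1 else 0.
  case: ifPn => //= /allP sm.
  under eq_bigr do rewrite elemE.
  case: ifPn => [/andP[/allP hok /forallP hc]|].
    rewrite big1 // => k _; rewrite hc andbT ifT //.
    by apply/allP => v; rewrite mem_filter => /andP[_ /hok].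
  rewrite negb_and => /orP[/allPn[v vm vr]|/forallPn[k hk]].
    rewrite (bigD1 (Ordinal (sm v vm))) //= ifF ?mul0r //.
    apply/negP => /andP[/allP /(_ v)]; rewrite mem_filter eqxx => /(_ vm) e.
    by rewrite e in vr.
  by rewrite (bigD1 k) //= (negbTE hk) andbF mul0r.
under eq_bigr do rewrite prodE.
have count_sum (F : nat -> nat) : small ->
    (\sum_(v <- finsupp m) F v.1 = \sum_(k < K) F k * n k)%N.
  move=> /allP sm.
  transitivity (\sum_(v <- finsupp m) \sum_(k < K) if v.1 == k then F k else 0)%N.
    apply: eq_big_seq => v vm; rewrite -big_mkcond /=.
    rewrite (big_pred1 (Ordinal (sm v vm))) //=.
  rewrite exchange_big /=; apply: eq_bigr => k _.
  by rewrite -big_mkcond big_const_seq iter_addn_0.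
rewrite /signed_E_block -/ok; case: (boolP ok) => /= hok; last first.
  by rewrite big1 // => c _; rewrite andbF mulr0.
case: eqP => hd; last first.
  rewrite big1 // => c /eqP hc; case: ifP => [/andP[sm /forallP nc]|]; last by rewrite mulr0.
  case: hd; rewrite (count_sum succn sm) -[RHS]hc.
  by apply: eq_bigr => k _; rewrite (eqP (nc k)).
have sm : small.
  apply/allP => v vm; apply: leq_trans dK; rewrite -hd.
  by rewrite (bigD1_seq v) ?fset_uniq //= leq_addr.
have nd k : (n k < d.+1)%N.
  rewrite ltnS -hd; apply: leq_trans (count_size _ _) _.
  by rewrite -sum1_size; apply: leq_sum.
(* The only vector that contributes is the one counting the variables of [m] in each degree. *)
pose c0 : {ffun 'I_K -> 'I_d.+1} := [ffun k => Ordinal (nd (val k))].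
have hc0 : (\sum_(k < K) k.+1 * c0 k == d)%N.
  by apply/eqP; rewrite -[RHS]hd (count_sum succn sm); apply: eq_bigr => k _; rewrite ffunE.
rewrite (bigD1 c0) //= [X in _ + X]big1 ?addr0; last first.
  move=> c /andP[_ cc]; case: ifP => [/andP[_ /forallP nc]|]; last by rewrite mulr0.
  case/eqP: cc; apply/ffunP => k; apply/val_inj.
  by rewrite ffunE /= (eqP (nc k)).
rewrite sm ifT ?mulr1; last by apply/forallP => k; rewrite ffunE.
congr (_ ^+ _); rewrite -sum1_size (count_sum (fun=> 1%N) sm).
by apply: eq_bigr => k _; rewrite ffunE mul1n.
Qed.

(** * Types *)

Lemma block_ge_trans : transitive block_ge.
Proof. move=> [a b] [c d] [e f]; rewrite /block_ge /=; lia. Qed.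

Lemma block_ge_total : total block_ge.
Proof. move=> [a b] [c d]; rewrite /block_ge /=; lia. Qed.

Lemma block_ge_anti : antisymmetric block_ge.
Proof.
move=> [a b] [c d]; rewrite /block_ge /= => h.
by congr pair; lia.
Qed.

Lemma geq_trans : transitive geq.
Proof. by move=> a b c h h'; apply: leq_trans h' h. Qed.

Lemma mem_restr (tau : seq block) (k x : nat) :
  (x \in restr tau k) = ((k, x) \in tau).
Proof.
apply/mapP/idP => [[[a b]]|h]; last by exists (k, x); rewrite ?mem_filter ?eqxx.
by rewrite mem_filter /= => /andP[/eqP -> h] ->.
Qed.

Lemma restr_sorted (tau : seq block) (k : nat) : sorted block_ge tau ->
  sorted geq (restr tau k).
Proof.
move=> st; rewrite /restr sorted_map.
have := sorted_filter block_ge_trans (fun b => b.1 == k) st.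
apply: (@sub_in_sorted _ (fun b : block => b.1 == k)); last first.
  by apply/allP => b; rewrite mem_filter => /andP[].
move=> [a b] [c d]; rewrite !unfold_in /block_ge /= => /eqP -> /eqP ->.
by rewrite ltnn eqxx.
Qed.

Lemma restr_partition (tau : seq block) (k : nat) : is_type tau ->
  is_partition (restr tau k).
Proof.
move=> /andP[st /allP pt]; apply/andP; split; first exact: restr_sorted.
by rewrite mem_restr; apply/negP => /pt; rewrite andbF.
Qed.

Lemma type_degree (tau : seq block) (b : block) : is_type tau -> b \in tau ->
  (0 < b.1 <= weight tau)%N.
Proof.
move=> /andP[_ /allP pt] hb; have /andP[b1 b2] := pt b hb; rewrite b1 /=.
rewrite /weight (big_rem b) //=.
by apply: leq_trans (leq_addr _ _); rewrite leq_pmulr.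
Qed.

Lemma restr_large (tau : seq block) (k : nat) : is_type tau ->
  (weight tau < k)%N -> restr tau k = [::].
Proof.
move=> pt h; apply/eqP; rewrite -size_eq0 size_map size_filter.
rewrite -leqn0 leqNgt -has_count; apply/hasPn => b /(type_degree pt).
by case: eqP => // ->; lia.
Qed.

Lemma sum_by_degree (T : eqType) (s : seq T) (deg : T -> nat) (F : T -> nat)
    (K : nat) : {in s, forall b, 0 < deg b <= K}%N ->
  (\sum_(b <- s) F b = \sum_(k < K) \sum_(b <- s | deg b == k.+1) F b)%N.
Proof.
move=> h; under [RHS]eq_bigr do rewrite big_mkcond.
rewrite exchange_big /=; apply: eq_big_seq => b /h hb.
have kK : ((deg b).-1 < K)%N by lia.
rewrite (bigD1 (Ordinal kK)) //= ifT; last by lia.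
rewrite big1 ?addn0 // => i iK; case: eqP => // e; case/eqP: iK.
by apply/val_inj; rewrite /= e.
Qed.

Lemma weightE (tau : seq block) (K : nat) : is_type tau -> (weight tau <= K)%N ->
  weight tau = (\sum_(k < K) k.+1 * sumn (restr tau k.+1))%N.
Proof.
move=> pt tK; rewrite /weight (@sum_by_degree _ _ (fun b => b.1) _ K).
  apply: eq_bigr => k _; rewrite sumnE big_map big_filter big_distrr /=.
  by apply: eq_bigr => b /eqP ->.
by move=> b /(type_degree pt) /andP[b0 bw] /=; rewrite b0 (leq_trans bw).
Qed.

Lemma type_eq (tau rho : seq block) : is_type tau -> is_type rho ->
  (forall k, restr tau k = restr rho k) -> tau = rho.
Proof.
move=> /andP[st _] /andP[sr _] e.
apply: (sorted_eq block_ge_trans block_ge_anti st sr).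
apply/allP => -[k x] _ /=; apply/eqP.
have count_restr t : count_mem (k, x) t = count_mem x (restr t k).
  rewrite count_map count_filter; apply: eq_count => -[a b] /=.
  by rewrite xpair_eqE andbC.
by rewrite !count_restr e.
Qed.

(** Reassembles a type from its restrictions; [nu k] belongs to degree [k.+1]. *)
Definition type_of (K : nat) (nu : nat -> seq nat) : seq block :=
  sort block_ge (flatten [seq [seq (k.+1, x) | x <- nu k] | k <- iota 0 K]).

Lemma type_ofP (K : nat) (nu : nat -> seq nat) :
  (forall k, is_partition (nu k)) -> is_type (type_of K nu).
Proof.
move=> pn; apply/andP; split; first exact: sort_sorted block_ge_total _.
rewrite all_sort; apply/allP => b /flattenP[_ /mapP[k _ ->] /mapP[x xn ->]] /=.
rewrite lt0n; apply/eqP => x0; have /andP[_] := pn k; rewrite -x0 xn //.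
Qed.

Lemma restr_type_of (K : nat) (nu : nat -> seq nat) (k : nat) :
  (forall k, is_partition (nu k)) ->
  restr (type_of K nu) k.+1 = if (k < K)%N then nu k else [::].
Proof.
move=> pn; have st : sorted geq (restr (type_of K nu) k.+1).
  by apply: restr_sorted; apply: sort_sorted block_ge_total _.
have sn : sorted geq (if (k < K)%N then nu k else [::]).
  by case: ifP => // _; case/andP: (pn k).
apply: (sorted_eq geq_trans _ st sn); first by move=> a b; rewrite /=; lia.
rewrite /restr; apply: perm_trans (_ : perm_eq _ [seq b.2 | b <- flatten
   [seq [seq (i.+1, x) | x <- nu i] | i <- iota 0 K] & b.1 == k.+1]) _.
  by apply/perm_map/perm_filter; rewrite perm_sort.
rewrite filter_flatten map_flatten -!map_comp.
have -> : [seq (map (fun b : nat * nat => b.2) \o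
    (filter (fun b => b.1 == k.+1) \o
       (fun i => [seq (i.+1, x) | x <- nu i]))) i | i <- iota 0 K] =
  [seq (if i == k then nu k else [::]) | i <- iota 0 K].
  apply: eq_map => i /=; rewrite filter_map -map_comp.
  case: eqP => [->|ne]; last first.
    rewrite (eq_filter (a2 := pred0)) ?filter_pred0 // => x /=.
    by apply/eqP => -[].
  rewrite (eq_filter (a2 := predT)) ?filter_predT; first by rewrite map_id.
  by move=> x /=; rewrite eqxx.
suff -> : flatten [seq (if i == k then nu k else [::]) | i <- iota 0 K] =
  if (k < K)%N then nu k else [::] by [].
elim: K {st sn} => // K IH; rewrite -addn1 iotaD map_cat flatten_cat IH /=.
by rewrite add0n cats0 addn1 ltnS; case: (ltngtP k K); rewrite ?cats0.
Qed.

Lemma restr0 (tau : seq block) : is_type tau -> restr tau 0 = [::].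
Proof.
move=> pt; apply/eqP; rewrite -size_eq0 size_map size_filter.
rewrite -leqn0 leqNgt -has_count; apply/hasPn => b /(type_degree pt).
by case: eqP => // ->.
Qed.

(** * Finite enumerations of partitions and types *)

Definition partitions_upto (B : nat) : seq (seq nat) :=
  undup [seq l <- [seq [seq a <- [seq val (h i) | i <- enum 'I_B] | a != 0%N]
                     | h : {ffun 'I_B -> 'I_B.+1}]
           | is_partition l && (sumn l <= B)%N].

Lemma mem_sumn (l : seq nat) (a : nat) : a \in l -> (a <= sumn l)%N.
Proof.
elim: l => //= b l IH; rewrite inE => /orP[/eqP ->|/IH h]; first exact: leq_addr.
exact: leq_trans h (leq_addl _ _).
Qed.

(** A partition of size at most [B] has at most [B] parts, each at most [B]; padded with zeros it is
    a function from ['I_B] to ['I_B.+1]. *)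
Lemma mem_partitions_upto (B : nat) (l : seq nat) :
  l \in partitions_upto B <-> is_partition l /\ (sumn l <= B)%N.
Proof.
rewrite mem_undup mem_filter; split=> [/andP[/andP[]]//|[pl lB]].
rewrite pl lB /=; have /andP[ls l0] := pl.
have sl : (size l <= B)%N by apply: leq_trans (size_le_sumn l0) lB.
apply/mapP; exists [ffun i : 'I_B => inord (nth 0%N l i)].
  by rewrite mem_enum.
have -> : [seq val ([ffun i : 'I_B => inord (nth 0%N l i)] i : 'I_B.+1) | i <- enum 'I_B] =
    pad B l.
  apply: (@eq_from_nth _ 0%N); first by rewrite size_map size_enum_ord size_pad.
  move=> i; rewrite size_map size_enum_ord => iB.
  rewrite (nth_map (Ordinal iB)) ?size_enum_ord // ffunE nth_enum_ord // nth_pad.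
  rewrite /= inordK // ltnS; have [h|h] := ltnP i (size l).
    by apply: leq_trans lB; apply: mem_sumn; apply: mem_nth.
  by rewrite nth_default.
rewrite /pad filter_cat filter_nseq eqxx cats0; apply/esym/all_filterP/allP => a al.
by apply/eqP => a0; rewrite -a0 al in l0.
Qed.

Lemma uniq_partitions_upto (B : nat) : uniq (partitions_upto B).
Proof. exact: undup_uniq. Qed.

(** The predecessor lets the list be indexed by an ordinal of successor form, as [inord] requires;
    the list is never empty because it contains the empty partition. *)
Definition nparts (n : nat) : nat := (size (partitions_upto n)).-1.

Lemma npartsE (n : nat) : size (partitions_upto n) = (nparts n).+1.
Proof.
rewrite /nparts prednK //; have := (mem_partitions_upto n [::]).2.
case: (partitions_upto n) => // /(_ (conj isT (leq0n _))).
by rewrite in_nil.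
Qed.

(** A choice of one partition for each degree from 1 to [n], coded by positions in
    [partitions_upto n]. These finite functions are what appears when a product over degrees of sums
    over partitions is expanded; types of weight [n] embed among them. *)
Definition family (n : nat) := {ffun 'I_n -> 'I_(nparts n).+1}.

Definition family_part (n : nat) (f : family n) (k : nat) : seq nat :=
  if (insub k : option 'I_n) is Some i then nth [::] (partitions_upto n) (f i)
  else [::].

Definition family_of (n : nat) (tau : seq block) : family n :=
  [ffun k : 'I_n => inord (index (restr tau k.+1) (partitions_upto n))].

Lemma family_partP (n : nat) (f : family n) (k : nat) :
  is_partition (family_part f k).
Proof.
rewrite /family_part; case: insub => // i.
have : nth [::] (partitions_upto n) (f i) \in partitions_upto n.
  by rewrite mem_nth // npartsE.
by move=> /mem_partitions_upto[].
Qed.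

Lemma restr_upto (n : nat) (tau : seq block) (k : nat) : is_type tau ->
  (weight tau <= n)%N -> restr tau k.+1 \in partitions_upto n.
Proof.
move=> pt tn; apply/mem_partitions_upto; split; first exact: restr_partition.
apply: leq_trans tn; have [h|h] := ltnP k (weight tau); last by rewrite restr_large.
rewrite [leqRHS](@weightE tau (weight tau)) // (bigD1 (Ordinal h)) //=.
by apply: leq_trans (leq_addr _ _); rewrite leq_pmull.
Qed.

Lemma nth_family_of (n : nat) (tau : seq block) (k : 'I_n) : is_type tau ->
  (weight tau <= n)%N ->
  nth [::] (partitions_upto n) (family_of n tau k) = restr tau k.+1.
Proof.
move=> pt tn; have h := restr_upto k pt tn.
by rewrite ffunE inordK ?nth_index // -npartsE index_mem.
Qed.

Lemma type_of_family_of (n : nat) (tau : seq block) : is_type tau ->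
  (weight tau <= n)%N -> type_of n (family_part (family_of n tau)) = tau.
Proof.
move=> pt tn; apply: type_eq => //; first exact: type_ofP (@family_partP _ _).
case=> [|k]; first by rewrite !restr0 //; exact: type_ofP (@family_partP _ _).
rewrite restr_type_of; last exact: family_partP.
case: ltnP => kn; last by rewrite restr_large //; apply: leq_ltn_trans tn _.
by rewrite /family_part insubT nth_family_of.
Qed.

Definition types_list (n : nat) : seq (seq block) :=
  undup [seq t <- [seq type_of n (family_part f) | f : family n]
           | is_type t && (weight t == n)].

Lemma mem_types_list (n : nat) (tau : seq block) :
  tau \in types_list n <-> is_type tau /\ weight tau = n.
Proof.
rewrite mem_undup mem_filter; split=> [/andP[/andP[? /eqP]]//|[pt wt]].
rewrite pt wt eqxx /=; apply/mapP; exists (family_of n tau).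
  by rewrite mem_enum.
by rewrite type_of_family_of // wt.
Qed.

Lemma uniq_types_list (n : nat) : uniq (types_list n).
Proof. exact: undup_uniq. Qed.

Lemma schur_nil (k : nat) : schur k [::] = 1.
Proof.
apply/funext => m; transitivity (sone m); last by [].
rewrite /schur /sone; case: (eqVneq m mone) => [->|m1].
  have -> : [set T | ssyt [::] T /\ tab_monomial k T = mone] = [set [::]].
    apply/seteqP; split=> T /=; first by move=> [[]]; case: T.
    move=> ->; split; last by rewrite /tab_monomial big_nil.
    by apply: ssytP => // i; rewrite !nth_nil.
  by rewrite fsbig_set1.
rewrite fsbig1 // => T [[]]; case: T => // _ _ _ e.
by case/eqP: m1; rewrite -e /tab_monomial big_nil.
Qed.

(** A common bound [K] replaces the weight, so that types of different weights are products over the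
    same range; the additional factors are 1. *)
Lemma stensorE (tau : seq block) (K : nat) : is_type tau -> (weight tau <= K)%N ->
  stensor tau = \prod_(k < K) schur k.+1 (restr tau k.+1).
Proof.
move=> pt tK; rewrite /stensor prodE big_add1 /= -(big_mkord xpredT
  (fun k => schur k.+1 (restr tau k.+1))) (big_cat_nat _ tK) //=.
rewrite [X in _ = _ * X]big_nat_cond [X in _ = _ * X]big1 ?mulr1 //.
by move=> k /andP[/andP[hk _] _]; rewrite restr_large // schur_nil.
Qed.

(** * Tensor polyribbon tableaux *)

(** For [s = -1] this is [sgn_minus] by definition, and for [s = 1] it reduces to [sgn_plus]. *)
Definition step_sign (s : rat) (d r : nat) (tau rho : seq block) : rat :=
  s ^+ size (xget [::] [set lam | associated_partition d r tau rho lam])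
  * \prod_(1 <= k < (weight tau).+1) sgn' r (restr tau k) (restr rho k).

Definition step_coef (s : rat) (d r : nat) (rho tau : seq block) : rat :=
  if `[< is_tensor_polyribbon d r tau rho >] then step_sign s d r tau rho else 0.

Lemma partition_sum (l : seq nat) (K : nat) (F : nat -> nat) :
  is_partition l -> (sumn l <= K)%N ->
  (\sum_(a <- l) F a = \sum_(k < K) F k.+1 * count_mem k.+1 l)%N.
Proof.
move=> /andP[_ l0] lK; rewrite (@sum_by_degree _ _ id _ K).
  apply: eq_bigr => k _; rewrite -sum1_count big_distrr /=.
  by apply: eq_bigr => a /eqP ->; rewrite muln1.
move=> a al /=; rewrite (leq_trans (mem_sumn al)) // andbT lt0n.
by apply/eqP => a0; rewrite -a0 al in l0.
Qed.

Lemma partition_sumnE (l : seq nat) (K : nat) : is_partition l ->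
  (sumn l <= K)%N -> sumn l = (\sum_(k < K) k.+1 * count_mem k.+1 l)%N.
Proof. by move=> pl lK; rewrite -(partition_sum id pl lK) sumnE. Qed.

Lemma partition_sizeE (l : seq nat) (K : nat) : is_partition l ->
  (sumn l <= K)%N -> size l = (\sum_(k < K) count_mem k.+1 l)%N.
Proof.
move=> pl lK; rewrite -sum1_size (partition_sum (fun=> 1%N) pl lK).
by apply: eq_bigr => k _; rewrite mul1n.
Qed.

Definition partition_of_counts (K : nat) (c : nat -> nat) : seq nat :=
  sort geq (flatten [seq nseq (c k) k.+1 | k <- iota 0 K]).

Lemma partition_of_countsP (K : nat) (c : nat -> nat) :
  is_partition (partition_of_counts K c).
Proof.
apply/andP; split.
  by apply: sort_sorted => a b; rewrite /geq /= leq_total.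
rewrite mem_sort; apply/negP => /flattenP[_ /mapP[k _ ->]].
by rewrite mem_nseq andbF.
Qed.

Lemma count_partition_of_counts (K : nat) (c : nat -> nat) (k : nat) :
  count_mem k.+1 (partition_of_counts K c) = if (k < K)%N then c k else 0%N.
Proof.
rewrite /partition_of_counts; have /seq.permP -> := permEl (perm_sort geq
  (flatten [seq nseq (c k) k.+1 | k <- iota 0 K])).
elim: K => // K IH; rewrite -[K.+1]addn1 iotaD map_cat flatten_cat count_cat IH /=.
rewrite add0n cats0 addn1 ltnS count_nseq /= eqSS.
by case: (ltngtP k K) => [h|h|->]; rewrite ?addn0 // ?mul0n ?mul1n // eqxx mul1n.
Qed.

Lemma sumn_partition_of_counts (K : nat) (c : nat -> nat) :
  sumn (partition_of_counts K c) = (\sum_(k < K) k.+1 * c k)%N.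
Proof.
rewrite /partition_of_counts (perm_sumn (permEl (perm_sort _ _))).
elim: K => [|K IH]; first by rewrite big_ord0.
rewrite -[K.+1]addn1 iotaD map_cat flatten_cat sumn_cat IH addn1 big_ord_recr /=.
by rewrite cats0 sumn_nseq add0n.
Qed.

Lemma is_dual_polyribbon0 (r : nat) : is_dual_polyribbon r 0 [::] [::].
Proof. by exists [:: [::]]; split. Qed.

(** The restriction of degree [k.+1] grows by [r] times the multiplicity of [k.+1], and r > 0. *)
Lemma associated_count (d r : nat) (tau rho : seq block) (lam lam' : seq nat)
    (k : nat) : (0 < r)%N ->
  associated_partition d r tau rho lam -> associated_partition d r tau rho lam' ->
  count_mem k.+1 lam = count_mem k.+1 lam'.
Proof.
move=> r0 [_ _ /(_ k.+1 isT) h] [_ _ /(_ k.+1 isT) h'].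
have := is_dual_polyribbon_sumn h; rewrite (is_dual_polyribbon_sumn h').
by move=> /addnI /eqP; rewrite eqn_pmul2l // => /eqP.
Qed.

Lemma associated_size (d r : nat) (tau rho : seq block) (lam lam' : seq nat) :
  (0 < r)%N ->
  associated_partition d r tau rho lam -> associated_partition d r tau rho lam' ->
  size lam = size lam'.
Proof.
move=> r0 h h'; have [p s _] := h; have [p' s' _] := h'.
rewrite (@partition_sizeE lam d) ?s // (@partition_sizeE lam' d) ?s' //.
by apply: eq_bigr => k _; apply: associated_count h h'.
Qed.

(** Sizes of the restrictions determine the multiplicities, so at most one vector [c] has all its
    factors non-zero: that of the associated partition. Without an associated partition every vector
    meets a degree where the shape is not a polyribbon. *)
Lemma step_coefE (s : rat) (d r K : nat) (rho tau : seq block) :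
  (0 < r)%N -> is_type rho -> is_type tau -> weight tau = K ->
  (weight rho <= K)%N -> (d <= K)%N ->
  \sum_(c : {ffun 'I_K -> 'I_d.+1} | \sum_(k < K) k.+1 * c k == d)
    s ^+ (\sum_(k < K) c k) *
    \prod_(k < K) pieri_coef r (c k) (restr rho k.+1) (restr tau k.+1) =
  step_coef s d r rho tau.
Proof.
move=> r0 prho ptau tK rK dK; rewrite /step_coef; case: asboolP => [ht|nt].
  have [lam hl] := ht; have [pl sl dl] := hl.
  have cd (k : 'I_K) : (count_mem k.+1 lam < d.+1)%N.
    by rewrite ltnS -sl (leq_trans (count_size _ _)) // size_le_sumn //; case/andP: pl.
  pose c0 : {ffun 'I_K -> 'I_d.+1} := [ffun k => Ordinal (cd k)].
  have c0P : (\sum_(k < K) k.+1 * c0 k == d)%N.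
    rewrite -[X in _ == X]sl (@partition_sumnE lam K) ?sl //.
    by apply/eqP/eq_bigr => k _; rewrite ffunE.
  rewrite (bigD1 c0 c0P) /= [X in _ + X]big1 ?addr0 /=; last first.
    move=> c /andP[_ cc].
    have [k ck] : exists k, c k != c0 k.
      apply/existsP; rewrite -negb_forall; apply: contra cc => /forallP e.
      by apply/eqP/ffunP => k; apply/eqP.
    rewrite [X in _ * X](bigD1 k) //= [pieri_coef _ (c k) _ _]/pieri_coef asboolF ?mul0r ?mulr0 //.
    move=> /is_dual_polyribbon_sumn; have := is_dual_polyribbon_sumn (dl k.+1 isT).
    move=> -> /addnI /eqP; rewrite eqn_pmul2l // => /eqP e.
    by case/eqP: ck; apply: val_inj; rewrite ffunE /= -e.
  rewrite /step_sign tK; congr (_ * _).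
    have -> : size (xget [::] [set lam | associated_partition d r tau rho lam]) = size lam.
      apply: (associated_size r0 _ hl).
      by case: xgetP => [l _ //|/(_ lam)].
    rewrite (@partition_sizeE lam K) ?sl //; congr (_ ^+ _).
    by apply: eq_bigr => k _; rewrite ffunE.
  rewrite big_add1 big_mkord; apply: eq_bigr => k _.
  by rewrite /pieri_coef asboolT // ffunE; apply: dl.
rewrite big1 // => c /eqP hc.
case: (pselect (exists k : 'I_K, ~ is_dual_polyribbon r (c k) (restr tau k.+1) (restr rho k.+1))).
  by move=> [k nk]; rewrite [X in _ * X](bigD1 k) //= {1}/pieri_coef asboolF // mul0r mulr0.
move=> nk; case: nt.
pose c' (k : nat) : nat := if (insub k : option 'I_K) is Some i then c i : nat else 0%N.
have ec' (k : 'I_K) : c' k = c k by rewrite /c' valK.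
exists (partition_of_counts K c'); split.
- exact: partition_of_countsP.
- by rewrite sumn_partition_of_counts -hc; apply: eq_bigr => k _; rewrite ec'.
- case=> // k _; rewrite count_partition_of_counts; case: ltnP => kK.
    rewrite (ec' (Ordinal kK)); apply: contrapT => h; apply: nk.
    by exists (Ordinal kK).
  rewrite !restr_large ?tK //; first exact: is_dual_polyribbon0.
  exact: leq_ltn_trans rK _.
Qed.

Lemma weight_type_of (K : nat) (nu : nat -> seq nat) :
  weight (type_of K nu) = (\sum_(k < K) k.+1 * sumn (nu k))%N.
Proof.
rewrite /weight /type_of (perm_big _ (permEl (perm_sort _ _))) /=.
have e : iota 0 K = index_iota 0 K by rewrite /index_iota subn0.
rewrite big_flatten big_map e big_mkord.
apply: eq_bigr => k _.
by rewrite big_map sumnE big_distrr.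
Qed.

Lemma tensor_polyribbon_weight (d r : nat) (rho tau : seq block) :
  is_type rho -> is_type tau -> is_tensor_polyribbon d r tau rho ->
  weight tau = (weight rho + d * r)%N.
Proof.
move=> prho ptau [lam [pl sl dl]].
have [K [tK rK dK]] : exists K, [/\ weight tau <= K, weight rho <= K & d <= K]%N.
  by exists (weight tau + weight rho + d)%N; split; lia.
rewrite (weightE ptau tK) (weightE prho rK) -sl (partition_sumnE pl (K := K)) ?sl //.
rewrite big_distrl -big_split /=; apply: eq_bigr => k _.
by rewrite (is_dual_polyribbon_sumn (dl k.+1 isT)) mulnDr -mulnA [(r * _)%N]mulnC.
Qed.

Lemma pieri_scal (k r c B : nat) (mu : seq nat) :
  (0 < r)%N -> is_partition mu -> (sumn mu + r * c <= B)%N ->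
  schur k.+1 mu * elem_pow_series k r c =
  \sum_(nu <- partitions_upto B)
     scal (pieri_coef r c mu nu) (schur k.+1 nu).
Proof.
move=> r0 pmu hB; apply/funext => m.
rewrite (pieri_series k r0 pmu hB (uniq_partitions_upto B)); last first.
  exact: mem_partitions_upto.
by rewrite sumE.
Qed.

Lemma pieri_coef_sumn (r c : nat) (mu nu : seq nat) :
  pieri_coef r c mu nu != 0 -> sumn nu = (sumn mu + r * c)%N.
Proof.
rewrite /pieri_coef; case: asboolP => [h _|]; last by rewrite eqxx.
exact: is_dual_polyribbon_sumn.
Qed.

Lemma restr_sumn_le (tau : seq block) (k : nat) : is_type tau ->
  (k.+1 * sumn (restr tau k.+1) <= weight tau)%N.
Proof.
move=> pt; have [h|h] := ltnP k (weight tau); last by rewrite restr_large ?muln0.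
rewrite [leqRHS](@weightE tau (weight tau)) // (bigD1 (Ordinal h)) //=.
exact: leq_addr.
Qed.

(** One step of a tableau. The Pieri rule is applied in each degree separately and the product of
    the resulting sums is expanded over families; those families that are not types of weight [n]
    must then be shown to contribute nothing. *)
Lemma stensor_signed_E_block (s : rat) (d r n : nat) (rho : seq block) :
  (0 < r)%N -> is_type rho -> (weight rho + d * r)%N = n ->
  stensor rho * signed_E_block s d r =
  \sum_(tau <- types_list n) scal (step_coef s d r rho tau) (stensor tau).
Proof.
move=> r0 prho hn.
have rn : (weight rho <= n)%N by rewrite -hn leq_addr.
have dn : (d <= n)%N by rewrite -hn (leq_trans _ (leq_addl _ _)) // leq_pmulr.
pose S (f : family n) := \prod_(k < n) schur k.+1 (nth [::] (partitions_upto n) (f k)).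
pose cond (c : {ffun 'I_n -> 'I_d.+1}) := (\sum_(k < n) k.+1 * c k == d)%N.
pose C (f : family n) : rat := \sum_(c | cond c)
   s ^+ (\sum_(k < n) c k) *
   \prod_(k < n) pieri_coef r (c k) (restr rho k.+1) (nth [::] (partitions_upto n) (f k)).
have LHS_E : stensor rho * signed_E_block s d r = \sum_(f : family n) scal (C f) (S f).
  rewrite (stensorE prho rn) (signed_E_block_expand s r0 dn) mulr_sumr.
  rewrite [RHS](eq_bigr (fun f : family n => \sum_(c | cond c) scal (s ^+ (\sum_(k < n) c k) *
     \prod_(k < n) pieri_coef r (c k) (restr rho k.+1) (nth [::] (partitions_upto n) (f k)))
     (S f))); last by move=> f _; rewrite scal_suml.
  rewrite exchange_big /=; apply: eq_bigr => c /eqP hc.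
  rewrite -{1}[\prod_(k < n) schur _ _]scal1 scalM mul1r -big_split /=.
  rewrite (eq_bigr (fun k : 'I_n => \sum_(j < (nparts n).+1)
    scal (pieri_coef r (c k) (restr rho k.+1) (nth [::] (partitions_upto n) j))
      (schur k.+1 (nth [::] (partitions_upto n) j)))); last first.
    move=> k _; rewrite (@pieri_scal _ _ _ n) //.
    - by rewrite (big_nth [::]) npartsE big_mkord.
    - exact: restr_partition.
    have h1 := restr_sumn_le k prho.
    have h2 : (k.+1 * c k <= d)%N by apply: leq_trans (eq_leq hc);
      rewrite (bigD1 k) //= leq_addr.
    (* The sizes weighted by the degree stay within [n]; dropping the factor [k.+1] gives the bound
       that the Pieri rule needs. *)
    have : (k.+1 * (sumn (restr rho k.+1) + r * c k) <= n)%N.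
      apply: leq_trans (eq_leq hn); rewrite mulnDr leq_add // mulnCA mulnC.
      by rewrite leq_mul2r h2 orbT.
    by apply: leq_trans; rewrite leq_pmull.
  rewrite bigA_distr_bigA scal_sumr; apply: eq_bigr => f _.
  by rewrite scal_prod scalA.
rewrite {}LHS_E.
have stensor_fam tau : tau \in types_list n -> stensor tau = S (family_of n tau).
  move=> /mem_types_list[pt wt]; rewrite (@stensorE _ n) ?wt //.
  by apply: eq_bigr => k _; rewrite nth_family_of ?wt.
have C_fam tau : tau \in types_list n -> C (family_of n tau) = step_coef s d r rho tau.
  move=> /mem_types_list[pt wt]; rewrite -(@step_coefE s d r n) //.
  apply: eq_bigr => c _; congr (_ * _); apply: eq_bigr => k _.
  by rewrite nth_family_of ?wt.
pose im := [seq family_of n tau | tau <- types_list n].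
have uim : uniq im.
  rewrite map_inj_in_uniq ?uniq_types_list // => t t'.
  move=> /mem_types_list[pt wt] /mem_types_list[pt' wt'] e.
  by rewrite -(@type_of_family_of n t) ?wt // -(@type_of_family_of n t') ?wt' // e.
(* Families outside the image of the types have coefficient 0: a non-zero term of [C f] fixes the
   size of every restriction, and these sizes make [f] the family of a type of weight [n]. *)
rewrite (bigID (mem im)) /= [X in _ + X]big1 ?addr0.
  rewrite -(big_uniq _ uim) big_map; apply: eq_big_seq => tau ht.
  by rewrite C_fam // stensor_fam.
move=> f nf; suff -> : C f = 0.
  by apply/funext => m; rewrite /scal mul0r.
rewrite /C big1 // => c /eqP hc; apply/eqP; rewrite mulf_eq0; apply/orP; right.
apply: contraR nf => /prodf_neq0 nz.
have fk (k : 'I_n) : family_part f k = nth [::] (partitions_upto n) (f k).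
  by rewrite /family_part valK.
have pt : is_type (type_of n (family_part f)) := type_ofP _ (@family_partP _ f).
have rt (k : 'I_n) : restr (type_of n (family_part f)) k.+1 =
    nth [::] (partitions_upto n) (f k).
  by rewrite restr_type_of ?ltn_ord //; exact: family_partP.
have wt : weight (type_of n (family_part f)) = n.
  rewrite weight_type_of.
  transitivity (weight rho + (\sum_(k < n) k.+1 * c k) * r)%N; last by rewrite hc.
  rewrite {1}(weightE prho rn) big_distrl -big_split /=.
  apply: eq_bigr => k _; rewrite fk (pieri_coef_sumn (nz k isT)).
  by rewrite mulnDr -mulnA [(r * _)%N]mulnC.
apply/mapP; exists (type_of n (family_part f)); first exact/mem_types_list.
apply/ffunP => k; apply/val_inj/eqP.
rewrite -(nth_uniq [::] _ _ (uniq_partitions_upto n)) ?npartsE ?ltn_ord //; try exact: ltn_ord.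
by rewrite nth_family_of ?wt // rt.
Qed.

Fixpoint path_coef (s : rat) (rho : seq block) (sigma : seq block)
    (tau : seq block) : rat :=
  if sigma is b :: sigma' then
    \sum_(rho' <- types_list (weight rho + b.1 * b.2))
       step_coef s b.1 b.2 rho rho' * path_coef s rho' sigma' tau
  else (rho == tau)%:R.

Lemma stensor_prod_signed_E_block (s : rat) (sigma : seq block) (rho : seq block) :
  all (fun b => 0 < b.2)%N sigma -> is_type rho ->
  stensor rho * \prod_(b <- sigma) signed_E_block s b.1 b.2 =
  \sum_(tau <- types_list (weight rho + weight sigma))
    scal (path_coef s rho sigma tau) (stensor tau).
Proof.
elim: sigma rho => [|[d r] sigma IH] rho /=.
  move=> _ pr; rewrite big_nil mulr1 /weight [X in (_ + X)%N]big_nil addn0.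
  rewrite (bigD1_seq rho) ?uniq_types_list //=; last exact/mem_types_list.
  rewrite eqxx scal1 big1 ?addr0 // => tau nt.
  by rewrite eq_sym (negbTE nt); apply/funext => m; rewrite /scal mul0r.
move=> /andP[r0 ps] pr; rewrite big_cons mulrA /=.
rewrite (stensor_signed_E_block s r0 pr (erefl _)) mulr_suml.
have -> : weight ((d, r) :: sigma) = (d * r + weight sigma)%N.
  by rewrite /weight big_cons.
under [RHS]eq_bigr do rewrite scal_suml.
rewrite exchange_big /=; apply: eq_big_seq => rho' /mem_types_list[pr' wr'].
rewrite -[\prod_(b <- sigma) _]scal1 scalM mulr1 (IH rho' ps pr') scal_sumr wr' addnA.
by apply: eq_bigr => tau _; rewrite scalA.
Qed.

Fixpoint paths_list (rho : seq block) (sigma : seq block) (tau : seq block) :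
    seq (seq (seq block)) :=
  if sigma is b :: sigma' then
    [seq rho :: T | rho' <- [seq x <- types_list (weight rho + b.1 * b.2) |
                             `[< is_tensor_polyribbon b.1 b.2 x rho >]],
                    T <- paths_list rho' sigma' tau]
  else if rho == tau then [:: [:: rho]] else [::].

(** [TPRT'] with an arbitrary initial type in place of the empty one, as the induction on the
    content requires. *)
Definition is_path (rho : seq block) (sigma : seq block) (tau : seq block)
    (T : seq (seq block)) : Prop :=
  [/\ size T = (size sigma).+1, all is_type T,
      nth [::] T 0 = rho /\ nth [::] T (size sigma) = tau
    & forall i, (i < size sigma)%N ->
        is_tensor_polyribbon (nth (0, 0)%N sigma i).1 (nth (0, 0)%N sigma i).2
          (nth [::] T i.+1) (nth [::] T i)].

Lemma mem_paths_list (rho sigma tau : seq block) (T : seq (seq block)) :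
  is_type rho -> T \in paths_list rho sigma tau <-> is_path rho sigma tau T.
Proof.
elim: sigma rho T => [|b sigma IH] rho T pr /=.
  split; last first.
    case: T => [|t [|? ?]] [] //= _ /andP[_ _] [-> ->] _.
    by rewrite eqxx inE.
  case: eqP => // <-; rewrite inE => /eqP ->; split=> //=.
  by rewrite pr.
split.
  move=> /allpairsPdep[rho' [U [h hU ->]]]; move: h.
  rewrite mem_filter => /andP[/asboolP ht /mem_types_list[pr' _]].
  have [sU aU [h0 h1] hs] := (IH rho' U pr').1 hU.
  split=> //=; rewrite ?sU ?pr //.
  by case=> [|i] /=; [rewrite h0|rewrite ltnS; apply: hs].
case: T => [|t U] [] //= [sU] /andP[pt aU] [e0 e1] hs; subst t.
have ht := hs 0%N isT; rewrite /= in ht.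
have pr' : is_type (nth [::] U 0) by apply: (allP aU); rewrite mem_nth ?sU.
apply/allpairsPdep; exists (nth [::] U 0), U; split=> //.
  rewrite mem_filter asboolT //=; apply/mem_types_list; split=> //.
  exact: tensor_polyribbon_weight ht.
by apply/IH => //; split=> // i hi; apply: (hs i.+1).
Qed.

Lemma uniq_paths_list (rho sigma tau : seq block) : is_type rho ->
  uniq (paths_list rho sigma tau).
Proof.
elim: sigma rho => [|b sigma IH] rho pr /=; first by case: eqP.
apply: allpairs_uniq_dep; first by rewrite filter_uniq ?uniq_types_list.
  by move=> x; rewrite mem_filter => /andP[_ /mem_types_list[px _]]; apply: IH.
move=> p q /allpairsPdep[x [U [hx hU ->]]] /allpairsPdep[y [V [hy hV ->]]] /=.
move=> [e]; subst V.
have px : is_type x by move: hx; rewrite mem_filter => /andP[_ /mem_types_list[]].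
have py : is_type y by move: hy; rewrite mem_filter => /andP[_ /mem_types_list[]].
have [_ _ [ex _] _] := (mem_paths_list _ _ _ px).1 hU.
have [_ _ [ey _] _] := (mem_paths_list _ _ _ py).1 hV.
have exy : x = y by rewrite -ex -ey.
by rewrite exy.
Qed.

Definition sgnT (s : rat) (sigma : seq block) (T : seq (seq block)) : rat :=
  \prod_(i < size sigma)
    step_sign s (nth (0, 0)%N sigma i).1 (nth (0, 0)%N sigma i).2
      (nth [::] T i.+1) (nth [::] T i).

Lemma path_coefE (s : rat) (rho sigma tau : seq block) : is_type rho ->
  path_coef s rho sigma tau = \sum_(T <- paths_list rho sigma tau) sgnT s sigma T.
Proof.
elim: sigma rho => [|b sigma IH] rho pr /=.
  case: eqP => _; last by rewrite big_nil.
  by rewrite big_seq1 /sgnT big_ord0.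
rewrite big_allpairs_dep /= big_filter [RHS]big_mkcond /=.
apply: eq_big_seq => rho' /mem_types_list[pr' _].
rewrite /step_coef; case: asboolP => ht; last by rewrite mul0r.
rewrite (IH rho' pr') mulr_sumr !big_seq; apply: eq_bigr => T.
move=> /(mem_paths_list _ _ _ pr')[_ _ [e0 _] _].
by rewrite /sgnT big_ord_recl /= e0.
Qed.

Lemma sum_TPRT' (s : rat) (sigma tau : seq block) :
  \sum_(T \in TPRT' tau sigma) sgnT s sigma T = path_coef s [::] sigma tau.
Proof.
rewrite path_coefE //; apply: fsbig_list; first exact: uniq_paths_list.
by move=> T; rewrite mem_paths_list.
Qed.

(** * Linear independence of the tensor Schur functions *)

(* The sum of the entries of a tableau depends only on its content and, for a
   given shape, is minimal exactly at the superstandard tableau; this replaces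
   the dominance order in the triangularity of the Kostka numbers. *)
Definition superstandard (l : seq nat) : seq (seq nat) :=
  mkseq (fun i => nseq (nth 0%N l i) i) (size l).

Definition superstandard_sum (l : seq nat) : nat := sumn (flatten (superstandard l)).

Lemma nth_superstandard (l : seq nat) (i : nat) :
  nth [::] (superstandard l) i = nseq (nth 0%N l i) i.
Proof.
have [h|h] := ltnP i (size l); first by rewrite nth_mkseq.
by rewrite !nth_default ?size_mkseq.
Qed.

Lemma superstandard_ssyt (l : seq nat) : sorted geq l -> ssyt l (superstandard l).
Proof.
move=> ls; have lP := partition_nonincr ls.
apply: ssytP => [|i|i|i j]; rewrite ?nth_superstandard ?size_mkseq //.
- by rewrite size_nseq.
- apply/(sortedP 0%N) => j; rewrite size_nseq => hj.
  by rewrite !nth_nseq hj (ltnW hj).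
- by move=> hj; rewrite !nth_nseq hj (leq_trans hj (lP _ _ (leqnSn i))).
Qed.

Lemma sumn_ge_leqif (i : nat) (s : seq nat) : all (fun a => i <= a)%N s ->
  (size s * i <= sumn s ?= iff (s == nseq (size s) i))%N.
Proof.
elim: s => [|a s IH] /=; first by move=> _; split.
move=> /andP[ia is_]; rewrite mulSn eqseq_cons eq_sym.
by apply: leqif_add (IH is_); apply: leqif_eq.
Qed.

(** Entries of row [i] are at least [i], and they all equal [i] only in the superstandard
    tableau. *)
Lemma superstandard_sum_leqif (l : seq nat) (T : seq (seq nat)) : sorted geq l -> ssyt l T ->
  (superstandard_sum l <= sumn (flatten T) ?= iff (T == superstandard l))%N.
Proof.
move=> ls hT; have sT : size T = size l by case: hT => <- _ _; rewrite size_map.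
have rowsum (U : seq (seq nat)) : size U = size l ->
    sumn (flatten U) = (\sum_(i < size l) sumn (nth [::] U i))%N.
  move=> <-; rewrite sumn_flatten sumnE big_map (big_nth [::]) big_mkord.
  exact: eq_bigr.
rewrite /superstandard_sum !rowsum ?size_mkseq //.
have h (i : 'I_(size l)) : true -> (sumn (nth [::] (superstandard l) i) <=
    sumn (nth [::] T i) ?= iff (nth [::] T i == nseq (nth 0%N l i) (i : nat)))%N.
  move=> _; rewrite nth_superstandard sumn_nseq mulnC -(ssyt_rowE i hT).
  apply: sumn_ge_leqif; apply/(all_nthP 0%N) => j.
  rewrite (ssyt_rowE i hT); exact: ssyt_row_ge.
have := leqif_sum h; suff -> : [forall (i | true), nth [::] T (i : 'I_(size l)) ==
    nseq (nth 0%N l i) (i : nat)] = (T == superstandard l) by [].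
apply/forallP/eqP => [e|-> i]; last by rewrite nth_superstandard eqxx.
apply: (@eq_from_nth _ [::]); rewrite ?size_mkseq // => i hi.
by rewrite nth_superstandard; move: hi; rewrite sT => hi; apply/eqP/(e (Ordinal hi)).
Qed.

(** The monomial in the variables of degree [k.+1] whose exponents are the parts of [l] in order. *)
Definition content_monomial (k : nat) (l : seq nat) : monomial :=
  tab_monomial k.+1 (superstandard l).

Lemma tab_monomial_perm (k : nat) (T U : seq (seq nat)) :
  tab_monomial k.+1 T = tab_monomial k.+1 U -> perm_eq (flatten T) (flatten U).
Proof.
move=> e; apply/allP => a _; apply/eqP => /=.
have := congr1 (fun m : monomial => m (k, a)) e.
rewrite /= !tab_monomialE.
have ec : (fun j => (k, j) == (k, a)) =1 pred1 a.
  by move=> j /=; rewrite xpair_eqE eqxx.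
by rewrite !(eq_count ec).
Qed.

Lemma superstandard_inj (l l' : seq nat) : is_partition l -> is_partition l' ->
  perm_eq (flatten (superstandard l)) (flatten (superstandard l')) -> l = l'.
Proof.
have cnt (u : seq nat) j : count_mem j (flatten (superstandard u)) = nth 0%N u j.
  rewrite count_flatten sumnE big_map (big_nth [::]) size_mkseq big_mkord.
  rewrite (eq_bigr (fun i : 'I_(size u) => if val i == j then nth 0%N u j else 0%N)); last first.
    move=> i _; rewrite nth_superstandard count_nseq /=.
    by case: eqP => [->|]; rewrite ?mul1n ?mul0n.
  rewrite -big_mkcond; have [h|h] := ltnP j (size u).
    by rewrite (big_pred1 (Ordinal h)).
  rewrite nth_default // big1 //.
move=> pl pl' pe; apply: partition_eq => // j.
by rewrite -!cnt; apply/seq.permP.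
Qed.

(** A tableau of shape [l] and content [mu] has entry sum [superstandard_sum mu], which is at least
    the minimum [superstandard_sum l] for its shape. In case of equality it is the superstandard
    tableau of [l], whose content is [l]. *)
Lemma schur_content (k : nat) (l mu : seq nat) : is_partition l -> is_partition mu ->
  (schur k.+1 l (content_monomial k mu) != 0 ->
    (superstandard_sum l <= superstandard_sum mu)%N) /\
  (superstandard_sum l = superstandard_sum mu ->
   schur k.+1 l (content_monomial k mu) = (l == mu)%:R).
Proof.
move=> pl pmu; have ls : sorted geq l by case/andP: pl.
have mus : sorted geq mu by case/andP: pmu.
have key T : ssyt l T -> tab_monomial k.+1 T = content_monomial k mu ->
   (superstandard_sum l <= superstandard_sum mu ?= iff (T == superstandard l))%N.
  move=> hT /tab_monomial_perm /perm_sumn;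
    rewrite -/(superstandard_sum mu) => <-; exact: superstandard_sum_leqif.
split.
  apply: contraR => h; rewrite /schur fsbig1 // => T [hT eT].
  by case/negP: h; have [] := key T hT eT.
move=> en; have eqT T : ssyt l T -> tab_monomial k.+1 T = content_monomial k mu ->
    T = superstandard l.
  by move=> hT eT; have [_] := key T hT eT; rewrite en eqxx => /esym/eqP.
rewrite /schur; case: eqVneq => [elm|nlm].
  have -> : [set T | ssyt l T /\ tab_monomial k.+1 T = content_monomial k mu] =
     [set superstandard l].
    apply/seteqP; split=> T /=; first by move=> [hT eT]; apply: eqT.
    by move=> ->; split; [exact: superstandard_ssyt | rewrite elm].
  by rewrite fsbig_set1.
rewrite fsbig1 // => T [hT eT]; case/eqP: nlm; apply: superstandard_inj => //.
by apply: (@tab_monomial_perm k); rewrite -(eqT T hT eT).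
Qed.

Lemma stensor_content (n : nat) (tau rho : seq block) :
  is_type tau -> weight tau = n -> is_type rho -> weight rho = n ->
  stensor tau (\big[mmul/mone]_(k < n) content_monomial k (restr rho k.+1)) =
  \prod_(k < n) schur k.+1 (restr tau k.+1) (content_monomial k (restr rho k.+1)).
Proof.
move=> pt wt pr wr; set m := \big[mmul/mone]_(k < n) _.
have cv k l (v : var) : content_monomial k l v != 0%N -> v.1 = k.
  rewrite /content_monomial tab_monomialE -lt0n -has_count => /hasP[j _ /eqP <-].
  by [].
have mv (v : var) : m v = (\sum_(k < n) content_monomial k (restr rho k.+1) v)%N.
  exact: cm_prodE.
rewrite (@stensorE _ n) ?wt // (@prod_concentrated n
  (fun k => schur k.+1 (restr tau k.+1))); last first.
  by move=> k; apply: schur_concentrated.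
rewrite ifT; last first.
  apply/allP => v; rewrite -cmE_neq0; apply: contraR => nv.
  rewrite mv big1 // => k _; apply/eqP; apply: contraR nv => /cv ->.
  exact: ltn_ord.
apply: eq_bigr => k _; congr (schur _ _ _); apply: cm_eqP => v.
rewrite mfilterE mv; case: eqP => [e|ne].
  rewrite (bigD1 k) //= big1 ?addn0 // => i ik; apply/eqP.
  apply: contraR ik => /cv e'; apply/eqP/val_inj; by rewrite /= -e' e.
by apply/esym/eqP; apply: contraT => /cv.
Qed.

(** Triangularity with respect to the total entry sum [N] over all degrees, by induction on
    [N tau]. *)
Lemma stensor_independent (n : nat) (c : seq block -> rat) :
  (forall m, \sum_(tau <- types_list n) c tau * stensor tau m = 0) ->
  forall tau, tau \in types_list n -> c tau = 0.
Proof.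
move=> h0; pose N (tau : seq block) := (\sum_(k < n) superstandard_sum (restr tau k.+1))%N.
suff H b tau : (N tau < b)%N -> tau \in types_list n -> c tau = 0.
  by move=> tau; apply: (H (N tau).+1).
elim: b tau => // b IH tau; rewrite ltnS => tb ht.
have [pt wt] := (mem_types_list n tau).1 ht.
(* The relation is read at the monomial whose part in each degree is the content given by [tau];
   there [stensor tau] has coefficient 1. *)
have := h0 (\big[mmul/mone]_(k < n) content_monomial k (restr tau k.+1)).
rewrite (bigD1_seq tau) ?uniq_types_list //= [X in _ + X]big1_seq ?addr0 => [|rho /andP[rt hr]].
  rewrite (@stensor_content n) // big1 ?mulr1 // => k _.
  by rewrite (schur_content k (restr_partition _ pt) (restr_partition _ pt)).2 ?eqxx.
have [pr wr] := (mem_types_list n rho).1 hr.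
rewrite (@stensor_content n) //.
have [cr|cr] := eqVneq (c rho) 0; first by rewrite cr mul0r.
apply/eqP; rewrite mulf_eq0 (negbTE cr) /=; apply/negPn/negP => /prodf_neq0 nz.
have le (k : 'I_n) : (superstandard_sum (restr rho k.+1) <= superstandard_sum (restr tau k.+1))%N.
  by apply: (schur_content k (restr_partition _ pr) (restr_partition _ pt)).1; apply: nz.
(* A smaller [N rho] would make [c rho] vanish by induction. Equality of the totals then forces
   equality in each degree, where the coefficient is non-zero only for equal shapes. *)
have Neq : N rho = N tau.
  apply/eqP; rewrite eqn_leq leq_sum //= leqNgt; apply/negP => lt.
  by case/eqP: cr; apply: IH => //; apply: leq_trans lt tb.
have eqk (k : 'I_n) : superstandard_sum (restr rho k.+1) = superstandard_sum (restr tau k.+1).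
  have := leqif_sum (fun (k : 'I_n) (_ : true) => leqif_eq (le k)).
  by move=> [_]; rewrite -/(N rho) -/(N tau) Neq eqxx => /esym/forallP/(_ k)/eqP.
case/eqP: rt; apply: type_eq => // k; case: k => [|k]; first by rewrite !restr0.
have [kn|kn] := ltnP k n; last by rewrite !restr_large ?wt ?wr.
have := nz (Ordinal kn) isT.
rewrite (schur_content k (restr_partition _ pr) (restr_partition _ pt)).2; last first.
  exact: (eqk (Ordinal kn)).
by case: (restr rho k.+1 =P restr tau k.+1) => // _; rewrite eqxx.
Qed.

(** * The transition matrices *)

Definition signed_E (s : rat) (sigma : seq block) : series :=
  \big[smul/sone]_(b <- sigma) powvars b.2 (signed_E_deg s b.1).

(** Expanding along the blocks of [sigma] from the empty type shows that a transition matrix exists;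
    independence shows that any such matrix has these entries at types of weight [n]. *)
Lemma transition_signed_E (s : rat) (n : nat) (sigma tau : seq block) :
  types n sigma -> types n tau ->
  transition n (signed_E s) stensor tau sigma =
  \sum_(T \in TPRT' tau sigma) sgnT s sigma T.
Proof.
move=> hsigma htau; rewrite sum_TPRT'.
have expand sg : types n sg -> forall m, signed_E s sg m =
    \sum_(t <- types_list n) path_coef s [::] sg t * stensor t m.
  move=> [psg wsg] m; rewrite /signed_E.
  have pos : all (fun b => 0 < b.2)%N sg.
    by case/andP: psg => _; apply: sub_all => b /andP[].
  have -> : \big[smul/sone]_(b <- sg) powvars b.2 (signed_E_deg s b.1) =
      stensor [::] * \prod_(b <- sg) signed_E_block s b.1 b.2.
    rewrite (@stensorE [::] 0) //; last by rewrite /weight big_nil.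
    rewrite big_ord0 mul1r prodE; apply: eq_big_seq => b bs.
    by apply: powvars_signed_E_deg; apply: (allP pos).
  rewrite stensor_prod_signed_E_block // sumE wsg /weight [in types_list _]big_nil add0n.
  by [].
have sumt (F : seq block -> rat) :
    \sum_(t \in types n) F t = \sum_(t <- types_list n) F t.
  by apply: fsbig_list; [exact: uniq_types_list | exact: mem_types_list].
(* The path coefficients form a valid transition matrix, so [xget] does not return its default; the
   matrix [M] it does return is compared with them. *)
rewrite /transition; case: xgetP => [M _ /= hM|/(_ (fun t sg => path_coef s [::] sg t))]; last first.
  by case=> sg hsg m; rewrite expand // sumt.
apply/eqP; rewrite -subr_eq0; apply/eqP.
apply: (@stensor_independent n (fun t => M t sigma - path_coef s [::] sigma t)).
  move=> m; under eq_bigr do rewrite mulrBl.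
  rewrite big_split /= sumrN; apply/eqP; rewrite subr_eq0; apply/eqP.
  by rewrite -expand // hM // sumt.
exact/mem_types_list.
Qed.

Theorem corollary34 (n : nat) (sigma tau : seq block)
    (hsigma : types n sigma) (htau : types n tau) :
  transition n Eplus stensor tau sigma
    = \sum_(T \in TPRT' tau sigma) sgnT_plus sigma T
  /\
  transition n E stensor tau sigma
    = \sum_(T \in TPRT' tau sigma) sgnT_minus sigma T.
Proof.
(* At [s = -1] the series and the signs coincide with [E] and [sgnT_minus] by conversion, while
   [s = 1] requires rewriting the powers of 1. *)
split; last exact: (transition_signed_E (-1) hsigma htau).
have -> : Eplus = signed_E 1.
  apply/funext => sg; apply: eq_bigr => b _; congr (powvars _ _).
  by apply/funext => m; rewrite /Eplus_deg /signed_E_deg expr1n.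
rewrite transition_signed_E //; apply: eq_fsbigr => T _.
by apply: eq_bigr => i _; rewrite /step_sign expr1n mul1r.
Qed.
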